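(* The Heisenberg product of representations endows the category $\mathcal R=\prod_{n\ge 0}\mathrm{Rep}(S_n)$ with an additive monoidal structure whose unit object, denoted $\mathbf 1$, is the representation that is $\Bbbk$ in degree zero and zero elsewhere. Moreover, the functor $\mathcal F:\mathrm{Sp}\to\mathcal R$, $\mathcal F(\mathbf p)=(\mathbf p[0],\mathbf p[1],\ldots,\mathbf p[n],\ldots)$, is monoidal, i.e. $$\mathcal F(\mathbf p\#\mathbf q)\cong\mathcal F(\mathbf p)\#\mathcal F(\mathbf q),\qquad \mathcal F(\mathbf 1)\cong\mathbf 1$$ for all species $\mathbf p$ and $\mathbf q$.
   Context: Let $\Bbbk$ be a field of characteristic zero. Species: a species is a functor $\mathbf p$ from the category of finite sets with bijections to the category of (finite-dimensional) $\Bbbk$-vector spaces; $\mathrm{Sp}$ is the category of species with natural transformations. Write $\mathbf p[n]=\mathbf p[\{1,\dots,n\}]$ and $\mathbf p[0]=\mathbf p[\emptyset]$. The Heisenberg product of species is $(\mathbf p\#\mathbf q)[I]=\bigoplus_{I=S\cup T}\mathbf p[S]\otimes\mathbf q[T]$ (sum over all ordered pairs $(S,T)$ of subsets, not necessarily disjoint, with union $I$), with the evident action on bijections; its unit is the species $\mathbf 1$ with $\mathbf 1[\emptyset]=\Bbbk$, $\mathbf 1[I]=0$ for $I\neq\emptyset$. Representations: $\mathrm{Rep}(S_n)$ is the category of finite-dimensional $\Bbbk$-representations of the symmetric group $S_n$. In $\mathcal F(\mathbf p)$, the group $S_n$ acts on $\mathbf p[n]$ by $\sigma\cdot x=\mathbf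 p[\sigma](x)$. For $\sigma\in S_p,\tau\in S_q$ let $\sigma\times\tau\in S_{p+q}$ be $(\sigma\times\tau)(i)=\sigma(i)$ for $1\le i\le p$ and $(\sigma\times\tau)(i)=\tau(i-p)+p$ for $p+1\le i\le p+q$. For $\max(p,q)\le n\le p+q$ put $S_p\times_nS_q=S_{n-q}\times S_{p+q-n}\times S_{n-p}$, embedded in $S_n$ by $(\sigma,\rho,\tau)\mapsto\sigma\times\rho\times\tau$ and in $S_p\times S_q$ by $(\sigma,\rho,\tau)\mapsto(\sigma\times\rho,\rho\times\tau)$. The Heisenberg product of $V\in\mathrm{Rep}(S_p)$ and $W\in\mathrm{Rep}(S_q)$ is $$V\#W=\bigoplus_{n=\max(p,q)}^{p+q}\mathrm{Ind}_{S_p\times_nS_q}^{S_n}\mathrm{Res}^{S_p\times S_q}_{S_p\times_nS_q}(V\otimes W),$$ the $n$-th summand being the component in $\mathrm{Rep}(S_n)$; it is extended to $\mathcal R$ biadditively, i.e. $(V\#W)_n=\bigoplus_{p,q}(V_p\#W_q)_n$, a finite sum over $p,q\le n\le p+q$. *)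

(* Defs.v *)
From HB Require Import structures.
From mathcomp Require Import all_boot all_order all_fingroup all_algebra.
From mathcomp Require Import boolp.

Set Implicit Arguments.
Unset Strict Implicit.
Unset Printing Implicit Defensive.

Import GRing.Theory.
Import VectorInternalTheory.
Local Open Scope ring_scope.

Record category := Category {
  ob :> Type;
  hom : ob -> ob -> Type;
  idm : forall X, hom X X;
  comp : forall X Y Z, hom Y Z -> hom X Y -> hom X Z;
  comp_idl : forall X Y (f : hom X Y), comp (idm Y) f = f;
  comp_idr : forall X Y (f : hom X Y), comp f (idm X) = f;
  comp_assoc : forall X Y Z W (h : hom Z W) (g : hom Y Z) (f : hom X Y),
    comp h (comp g f) = comp (comp h g) f
}.

Arguments idm {c} X.
Arguments comp {c X Y Z} g f.

Declare Scope cat_scope.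
Delimit Scope cat_scope with cat.
Notation "g \oc f" := (comp g f)
  (at level 50, left associativity, format "g  \oc  f") : cat_scope.
Local Open Scope cat_scope.

Definition is_iso (C : category) (X Y : C) (f : hom X Y) : Prop :=
  exists g : hom Y X, g \oc f = idm X /\ f \oc g = idm Y.

Record functor (C D : category) := Functor {
  fob :> C -> D;
  fmap : forall X Y : C, hom X Y -> hom (fob X) (fob Y);
  fmap_id : forall X, fmap (idm X) = idm (fob X);
  fmap_comp : forall (X Y Z : C) (g : hom Y Z) (f : hom X Y),
    fmap (g \oc f) = fmap g \oc fmap f
}.

Arguments fmap {C D} f0 {X Y} f.

Record nattrans (C D : category) (F G : functor C D) := Nattrans {
  ncomp :> forall X : C, hom (F X) (G X);
  nnat : forall (X Y : C) (f : hom X Y),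
    ncomp Y \oc fmap F f = fmap G f \oc ncomp X
}.

Lemma nattrans_eq (C D : category) (F G : functor C D) (a b : nattrans F G) :
  (forall X, a X = b X) -> a = b.
Proof.
case: a b => [a an] [b bn] /= e.
have {}e : a = b by apply: functional_extensionality_dep.
by subst b; congr Nattrans; apply: Prop_irrelevance.
Qed.

Section FunctorCategory.
Variables C D : category.

Definition nat_id (F : functor C D) : nattrans F F.
Proof.
by exists (fun X => idm (F X)) => X Y f; rewrite comp_idl comp_idr.
Defined.

Definition nat_comp (F G H : functor C D) (b : nattrans G H)
  (a : nattrans F G) : nattrans F H.
Proof.
exists (fun X => b X \oc a X) => X Y f.
by rewrite -comp_assoc nnat comp_assoc nnat comp_assoc.
Defined.

Definition functor_category : category.
Proof.
refine (@Category (functor C D) (@nattrans C D) nat_id nat_comp _ _ _).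
- by move=> F G a; apply: nattrans_eq => X /=; rewrite comp_idl.
- by move=> F G a; apply: nattrans_eq => X /=; rewrite comp_idr.
- by move=> F G H K c b a; apply: nattrans_eq => X /=; rewrite comp_assoc.
Defined.

End FunctorCategory.

Definition product_category (I : Type) (C : I -> category) : category.
Proof.
refine (@Category (forall i, C i) (fun X Y => forall i, hom (X i) (Y i))
  (fun X i => idm (X i)) (fun X Y Z g f i => g i \oc f i) _ _ _).
- by move=> X Y f; apply: functional_extensionality_dep => i; apply: comp_idl.
- by move=> X Y f; apply: functional_extensionality_dep => i; apply: comp_idr.
- move=> X Y Z W h g f; apply: functional_extensionality_dep => i.
  exact: comp_assoc.
Defined.

Record preadditive (C : category) := Preadditive {
  hadd : forall X Y : C, hom X Y -> hom X Y -> hom X Y;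
  hzero : forall X Y : C, hom X Y;
  hopp : forall X Y : C, hom X Y -> hom X Y;
  haddA : forall X Y : C, associative (@hadd X Y);
  haddC : forall X Y : C, commutative (@hadd X Y);
  hadd0 : forall X Y : C, left_id (hzero X Y) (@hadd X Y);
  haddN : forall X Y : C, left_inverse (hzero X Y) (@hopp X Y) (@hadd X Y);
  hcompDl : forall (X Y Z : C) (g g' : hom Y Z) (f : hom X Y),
    hadd g g' \oc f = hadd (g \oc f) (g' \oc f);
  hcompDr : forall (X Y Z : C) (g : hom Y Z) (f f' : hom X Y),
    g \oc hadd f f' = hadd (g \oc f) (g \oc f')
}.

Arguments hadd {C} p {X Y} f g.
Arguments hzero {C} p X Y.

Definition is_additive (C : category) (A : preadditive C) : Prop :=
  (exists Z : C, forall X : C,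
     (forall f : hom X Z, f = hzero A X Z) /\
     (forall f : hom Z X, f = hzero A Z X)) /\
  (forall X Y : C, exists (S : C) (i1 : hom X S) (i2 : hom Y S)
     (p1 : hom S X) (p2 : hom S Y),
     [/\ p1 \oc i1 = idm X, p2 \oc i2 = idm Y,
         p1 \oc i2 = hzero A Y X, p2 \oc i1 = hzero A X Y
       & hadd A (i1 \oc p1) (i2 \oc p2) = idm S]).

Definition product_preadditive (I : Type) (C : I -> category)
  (A : forall i, preadditive (C i)) : preadditive (product_category C).
Proof.
refine (@Preadditive (product_category C)
  (fun X Y f g i => hadd (A i) (f i) (g i))
  (fun X Y i => hzero (A i) (X i) (Y i))
  (fun X Y f i => hopp (A i) (f i)) _ _ _ _ _ _).
- by move=> X Y f g h; apply: functional_extensionality_dep => i; apply: haddA.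
- by move=> X Y f g; apply: functional_extensionality_dep => i; apply: haddC.
- by move=> X Y f; apply: functional_extensionality_dep => i; apply: hadd0.
- by move=> X Y f; apply: functional_extensionality_dep => i; apply: haddN.
- move=> X Y Z g g' f; apply: functional_extensionality_dep => i.
  exact: hcompDl.
- move=> X Y Z g f f'; apply: functional_extensionality_dep => i.
  exact: hcompDr.
Defined.

Record bifunctor (C : category) := Bifunctor {
  bob :> C -> C -> C;
  bmap : forall X X' Y Y' : C,
    hom X X' -> hom Y Y' -> hom (bob X Y) (bob X' Y');
  bmap_id : forall X Y, bmap (idm X) (idm Y) = idm (bob X Y);
  bmap_comp : forall (X X' X'' Y Y' Y'' : C)
    (f' : hom X' X'') (f : hom X X') (g' : hom Y' Y'') (g : hom Y Y'),
    bmap (f' \oc f) (g' \oc g) = bmap f' g' \oc bmap f g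
}.

Arguments bmap {C} b {X X' Y Y'} f g.

Definition is_additive_bifunctor (C : category) (A : preadditive C)
  (T : bifunctor C) : Prop :=
  (forall (X X' Y Y' : C) (f f' : hom X X') (g : hom Y Y'),
     bmap T (hadd A f f') g = hadd A (bmap T f g) (bmap T f' g)) /\
  (forall (X X' Y Y' : C) (f : hom X X') (g g' : hom Y Y'),
     bmap T f (hadd A g g') = hadd A (bmap T f g) (bmap T f g')).

Record monoidal (C : category) (T : bifunctor C) (u : C) := Monoidal {
  massoc : forall X Y Z, hom (T (T X Y) Z) (T X (T Y Z));
  mlunit : forall X, hom (T u X) X;
  mrunit : forall X, hom (T X u) X;
  massoc_iso : forall X Y Z, is_iso (massoc X Y Z);
  mlunit_iso : forall X, is_iso (mlunit X);
  mrunit_iso : forall X, is_iso (mrunit X);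
  massoc_nat : forall (X X' Y Y' Z Z' : C)
    (f : hom X X') (g : hom Y Y') (h : hom Z Z'),
    massoc X' Y' Z' \oc bmap T (bmap T f g) h
    = bmap T f (bmap T g h) \oc massoc X Y Z;
  mlunit_nat : forall (X X' : C) (f : hom X X'),
    mlunit X' \oc bmap T (idm u) f = f \oc mlunit X;
  mrunit_nat : forall (X X' : C) (f : hom X X'),
    mrunit X' \oc bmap T f (idm u) = f \oc mrunit X;
  mtriangle : forall X Y,
    bmap T (idm X) (mlunit Y) \oc massoc X u Y = bmap T (mrunit X) (idm Y);
  mpentagon : forall X Y Z W,
    massoc X Y (T Z W) \oc massoc (T X Y) Z W
    = bmap T (idm X) (massoc Y Z W) \oc massoc X (T Y Z) W
        \oc bmap T (massoc X Y Z) (idm W)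
}.

Definition is_monoidal_functor (C D : category) (TC : bifunctor C)
  (TD : bifunctor D) (uC : C) (uD : D) (F : functor C D)
  (MC : monoidal TC uC) (MD : monoidal TD uD) : Prop :=
  exists (mu : forall X Y : C, hom (TD (F X) (F Y)) (F (TC X Y)))
         (eps : hom uD (F uC)),
  [/\ (forall X Y, is_iso (mu X Y)) /\ is_iso eps,
      forall (X X' Y Y' : C) (f : hom X X') (g : hom Y Y'),
        mu X' Y' \oc bmap TD (fmap F f) (fmap F g)
        = fmap F (bmap TC f g) \oc mu X Y,
      forall X Y Z : C,
        mu X (TC Y Z) \oc bmap TD (idm (F X)) (mu Y Z)
          \oc massoc MD (F X) (F Y) (F Z)
        = fmap F (massoc MC X Y Z) \oc mu (TC X Y) Z
            \oc bmap TD (mu X Y) (idm (F Z)),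
      forall X : C,
        fmap F (mlunit MC X) \oc mu uC X \oc bmap TD eps (idm (F X))
        = mlunit MD (F X)
    & forall X : C,
        fmap F (mrunit MC X) \oc mu X uC \oc bmap TD (idm (F X)) eps
        = mrunit MD (F X)].

Record bij (I J : finType) := Bij {
  bij_fun :> I -> J;
  bij_bij : bijective bij_fun
}.

Lemma bij_eq (I J : finType) (f g : bij I J) : f =1 g -> f = g.
Proof.
case: f g => [f fb] [g gb] /= /funext e.
by subst g; congr Bij; apply: Prop_irrelevance.
Qed.

Definition bij_id (I : finType) : bij I I :=
  Bij (inv_bij (fun x : I => erefl x) : bijective (fun x : I => x)).

Definition bij_comp (I J K : finType) (g : bij J K) (f : bij I J) : bij I K :=
  Bij (ssrfun.bij_comp (bij_bij g) (bij_bij f)).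

Definition finbij_category : category.
Proof.
refine (@Category finType bij bij_id bij_comp _ _ _);
  by move=> *; apply: bij_eq.
Defined.

Definition subft (I : finType) (S : {set I}) : finType := {x : I | x \in S}.

Section RestrictBij.
Variables (I J : finType) (f : bij I J) (S : {set J}).

Fact presub_proof (x : subft (f @^-1: S)) : f (val x) \in S.
Proof. by case: x => x /=; rewrite inE. Qed.

Definition presub_fun (x : subft (f @^-1: S)) : subft S :=
  exist _ (f (val x)) (presub_proof x).

Fact presub_bij : bijective presub_fun.
Proof.
have [g fK gK] := bij_bij f.
have gP (y : subft S) : g (val y) \in f @^-1: S.
  by rewrite inE gK; apply: valP.
by exists (fun y => exist _ (g (val y)) (gP y)) => x;
  apply: val_inj => /=; rewrite ?fK ?gK.
Qed.

Definition presub : bij (subft (f @^-1: S)) (subft S) := Bij presub_bij.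

End RestrictBij.

(* pairs (S, T) of subsets of I, not necessarily disjoint, with S U T = I *)
Definition cov (I : finType) : finType :=
  {st : {set I} * {set I} | st.1 :|: st.2 == [set: I]}.

Definition covl (I : finType) (c : cov I) : finType := subft (val c).1.
Definition covr (I : finType) (c : cov I) : finType := subft (val c).2.

Fact precov_proof (I J : finType) (f : bij I J) (c : cov J) :
  (f @^-1: (val c).1) :|: (f @^-1: (val c).2) == [set: I].
Proof. by rewrite -preimsetU (eqP (valP c)) preimsetT. Qed.

Definition precov (I J : finType) (f : bij I J) (c : cov J) : cov I :=
  exist _ (f @^-1: (val c).1, f @^-1: (val c).2) (precov_proof f c).

Section Linear.
Variable k : fieldType.

Lemma linfunE (U V : vectType k) (f : U -> V) : linear f -> linfun f =1 f.
Proof.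
move=> lf x.
pose ff : {linear U -> V} := HB.pack f (GRing.isLinear.Build k U V *:%R f lf).
exact: (lfunE ff x).
Qed.

Definition vect_category : category.
Proof.
refine (@Category (vectType k) (fun U V => 'Hom(U, V)) (fun V => \1%VF)
  (fun U V W g f => (g \o f)%VF) _ _ _).
- by move=> *; apply: comp_lfun1l.
- by move=> *; apply: comp_lfun1r.
- by move=> *; apply: comp_lfunA.
Defined.

(* Tensor products: in coordinates, v (x) w is the rank one matrix
   (v_i w_j)_(i, j).                                                          *)

Definition tens (V W : vectType k) : vectType k := 'M[k]_(dim V, dim W).

Definition pure (V W : vectType k) (v : V) (w : W) : tens V W :=
  (v2r v)^T *m v2r w.

Definition tmap (V V' W W' : vectType k) (f : 'Hom(V, V')) (g : 'Hom(W, W')) :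
  'Hom(tens V W, tens V' W') :=
  linfun (fun t : 'M_(dim V, dim W) => (f2mx f)^T *m t *m f2mx g).

Lemma tmapE (V V' W W' : vectType k) (f : 'Hom(V, V')) (g : 'Hom(W, W')) t :
  tmap f g t = (f2mx f)^T *m t *m f2mx g.
Proof.
rewrite linfunE // => a x y.
by rewrite mulmxDr mulmxDl -scalemxAr -scalemxAl.
Qed.

Lemma v2r_lfun (V V' : vectType k) (f : 'Hom(V, V')) v :
  v2r (f v) = v2r v *m f2mx f.
Proof. by rewrite unlock /= r2vK. Qed.

Lemma pureDl (V W : vectType k) (w : W) : linear (fun v : V => pure v w).
Proof.
by move=> a u v; rewrite /pure linearP linearP /= mulmxDl -scalemxAl.
Qed.

Lemma pureDr (V W : vectType k) (v : V) : linear (fun w : W => pure v w).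
Proof.
by move=> a u w; rewrite /pure linearP /= mulmxDr -scalemxAr.
Qed.

Lemma tmap_pure (V V' W W' : vectType k) (f : 'Hom(V, V')) (g : 'Hom(W, W'))
  v w : tmap f g (pure v w) = pure (f v) (g w).
Proof. by rewrite tmapE /pure !v2r_lfun trmx_mul !mulmxA. Qed.

Lemma pure_delta (V W : vectType k) i j :
  @pure V W (r2v (delta_mx 0 i)) (r2v (delta_mx 0 j)) = delta_mx i j.
Proof. by rewrite /pure !r2vK trmx_delta mul_delta_mx. Qed.

Lemma tens_ext (V W U : vectType k) (f g : 'Hom(tens V W, U)) :
  (forall v w, f (pure v w) = g (pure v w)) -> f = g.
Proof.
move=> e; apply/lfunP => t; rewrite [t]matrix_sum_delta !linear_sum /=.
apply: eq_bigr => i _; rewrite !linear_sum /=; apply: eq_bigr => j _.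
by rewrite !linearZ /= -pure_delta e.
Qed.

Lemma tens_lift (V W U : vectType k) (B : V -> W -> U) :
  (forall w, linear (fun v => B v w)) -> (forall v, linear (B v)) ->
  exists f : 'Hom(tens V W, U), forall v w, f (pure v w) = B v w.
Proof.
move=> Bl Br.
pose eV i : V := r2v (delta_mx 0 i); pose eW j : W := r2v (delta_mx 0 j).
pose F (t : tens V W) := \sum_i \sum_j (t : 'M_(_, _)) i j *: B (eV i) (eW j).
have Flin : linear F.
  move=> a x y; rewrite /F scaler_sumr -big_split /=; apply: eq_bigr => i _.
  rewrite scaler_sumr -big_split /=; apply: eq_bigr => j _.
  by rewrite !mxE scalerDl scalerA.
exists (linfun F) => v w; rewrite linfunE // /F.
have vE : v = \sum_i (v2r v) 0 i *: eV i.
  rewrite -{1}[v]v2rK {1}[v2r v]matrix_sum_delta big_ord1 linear_sum.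
  by apply: eq_bigr => i _; rewrite linearZ.
have wE : w = \sum_j (v2r w) 0 j *: eW j.
  rewrite -{1}[w]v2rK {1}[v2r w]matrix_sum_delta big_ord1 linear_sum.
  by apply: eq_bigr => i _; rewrite linearZ.
have suml n (x : 'I_n -> k) (e : 'I_n -> V) w' :
    B (\sum_i x i *: e i) w' = \sum_i x i *: B (e i) w'.
  pose f : {linear V -> U} :=
    HB.pack (B^~ w') (GRing.isLinear.Build k V U *:%R (B^~ w') (Bl w')).
  rewrite -[LHS]/(f _) linear_sum; apply: eq_bigr => i _; exact: linearZ.
have sumr n (x : 'I_n -> k) (e : 'I_n -> W) v' :
    B v' (\sum_i x i *: e i) = \sum_i x i *: B v' (e i).
  pose f : {linear W -> U} :=
    HB.pack (B v') (GRing.isLinear.Build k W U *:%R (B v') (Br v')).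
  rewrite -[LHS]/(f _) linear_sum; apply: eq_bigr => i _; exact: linearZ.
rewrite [in RHS]vE suml; apply: eq_bigr => i _.
rewrite [in RHS]wE sumr scaler_sumr; apply: eq_bigr => j _.
by rewrite scalerA /pure !mxE big_ord1 mxE.
Qed.

Lemma tmap_id (V W : vectType k) : tmap \1%VF \1%VF = \1%VF :> 'End(tens V W).
Proof. by apply: tens_ext => v w; rewrite tmap_pure !lfunE. Qed.

Lemma tmap_comp (V V' V'' W W' W'' : vectType k)
  (f' : 'Hom(V', V'')) (f : 'Hom(V, V'))
  (g' : 'Hom(W', W'')) (g : 'Hom(W, W')) :
  tmap (f' \o f)%VF (g' \o g)%VF = (tmap f' g' \o tmap f g)%VF.
Proof.
by apply: tens_ext => v w; rewrite comp_lfunE !tmap_pure !comp_lfunE.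
Qed.

Definition dsum_type (I : finType) (V : I -> vectType k) : Type :=
  {dffun forall i, V i}.

Section DirectSum.
Variables (I : finType) (V : I -> vectType k).

HB.instance Definition _ := Choice.on (dsum_type V).

Definition dsum_zero : dsum_type V := [ffun i => 0 : V i].
Definition dsum_add (f g : dsum_type V) : dsum_type V := [ffun i => f i + g i].
Definition dsum_opp (f : dsum_type V) : dsum_type V := [ffun i => - f i].
Definition dsum_scale (a : k) (f : dsum_type V) : dsum_type V :=
  [ffun i => a *: f i].

Fact dsum_addA : associative dsum_add.
Proof. by move=> f g h; apply/ffunP => i; rewrite !ffunE addrA. Qed.
Fact dsum_addC : commutative dsum_add.
Proof. by move=> f g; apply/ffunP => i; rewrite !ffunE addrC. Qed.
Fact dsum_add0 : left_id dsum_zero dsum_add.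
Proof. by move=> f; apply/ffunP => i; rewrite !ffunE add0r. Qed.
Fact dsum_addN : left_inverse dsum_zero dsum_opp dsum_add.
Proof. by move=> f; apply/ffunP => i; rewrite !ffunE addNr. Qed.

HB.instance Definition _ := GRing.isZmodule.Build (dsum_type V)
  dsum_addA dsum_addC dsum_add0 dsum_addN.

Fact dsum_scaleA a b f : dsum_scale a (dsum_scale b f) = dsum_scale (a * b) f.
Proof. by apply/ffunP => i; rewrite !ffunE scalerA. Qed.
Fact dsum_scale1 : left_id 1 dsum_scale.
Proof. by move=> f; apply/ffunP => i; rewrite !ffunE scale1r. Qed.
Fact dsum_scaleDr : right_distributive dsum_scale +%R.
Proof. by move=> a f g; apply/ffunP => i; rewrite !ffunE scalerDr. Qed.
Fact dsum_scaleDl f : {morph dsum_scale^~ f : a b / a + b}.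
Proof. by move=> a b; apply/ffunP => i; rewrite !ffunE scalerDl. Qed.

HB.instance Definition _ := GRing.Zmodule_isLmodule.Build k (dsum_type V)
  dsum_scaleA dsum_scale1 dsum_scaleDr dsum_scaleDl.

Fact dsum_vect_iso :
  Vector.axiom (\sum_(j < #|I|) dim (V (enum_val j))) (dsum_type V).
Proof.
pose to (f : dsum_type V) := \mxrow_(j < #|I|) v2r (f (enum_val j)).
exists to.
  move=> a f g; apply/matrixP => i j; rewrite /to !mxE.
  have -> l : (a *: f + g : dsum_type V) l = a *: f l + g l by rewrite !ffunE.
  by rewrite linearP !mxE.
pose from (r : 'rV_(\sum_(j < #|I|) dim (V (enum_val j)))) : dsum_type V :=
  [ffun i => ecast i (V i) (enum_rankK i) (r2v (submxrow r (enum_rank i)))].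
exists from => [f|r].
  apply/ffunP => i; rewrite ffunE mxrowK v2rK.
  by move: (enum_rank i) (enum_rankK i) => j; case: _ /.
apply/mxrowP => j; rewrite mxrowK ffunE.
move: (enum_rank _) (enum_rankK _) => j' e.
have ej := enum_val_inj e; subst j'.
by rewrite [e]eq_axiomK /= r2vK.
Qed.

HB.instance Definition _ :=
  Lmodule_hasFinDim.Build k (dsum_type V) dsum_vect_iso.

Definition dsum : vectType k := dsum_type V.

Definition dproj (i : I) (x : dsum) : V i := (x : dsum_type V) i.

Definition dinj (i : I) (v : V i) : dsum :=
  [ffun j => if @eqP _ i j is ReflectT e then ecast j (V j) e v else 0]
    : dsum_type V.

Lemma dproj_dinj i (v : V i) : dproj i (dinj v) = v.
Proof. by rewrite /dproj ffunE; case: eqP => // e; rewrite eq_axiomK. Qed.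

Lemma dproj_dinj_neq i j (v : V i) : i != j -> dproj j (dinj v) = 0.
Proof. by rewrite /dproj ffunE; case: eqP. Qed.

Lemma dproj_lin i : linear (dproj i).
Proof. by move=> a x y; rewrite /dproj !ffunE. Qed.

Lemma dsumP (x y : dsum) : (forall i, dproj i x = dproj i y) -> x = y.
Proof. by move=> e; apply/ffunP. Qed.

End DirectSum.

Definition dsum_map (I : finType) (V W : I -> vectType k)
  (f : forall i, 'Hom(V i, W i)) : 'Hom(dsum V, dsum W) :=
  linfun (fun x : dsum V => [ffun i => f i (dproj i x)] : dsum_type W).

Lemma dproj_map (I : finType) (V W : I -> vectType k)
  (f : forall i, 'Hom(V i, W i)) x i : dproj i (dsum_map f x) = f i (dproj i x).
Proof.
rewrite linfunE; first by rewrite /dproj ffunE.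
by move=> a y z; apply/ffunP => j; rewrite !ffunE dproj_lin linearP.
Qed.

Lemma dsum_map_id (I : finType) (V : I -> vectType k) :
  dsum_map (fun i => \1%VF : 'End(V i)) = \1%VF.
Proof.
by apply/lfunP => x; apply: dsumP => i; rewrite dproj_map !id_lfunE.
Qed.

Lemma dsum_map_comp (I : finType) (U V W : I -> vectType k)
  (g : forall i, 'Hom(V i, W i)) (f : forall i, 'Hom(U i, V i)) :
  dsum_map (fun i => g i \o f i)%VF = (dsum_map g \o dsum_map f)%VF.
Proof.
apply/lfunP => x; apply: dsumP => i.
by rewrite [in RHS]comp_lfunE !dproj_map comp_lfunE.
Qed.

Lemma eq_dsum_map (I : finType) (V W : I -> vectType k)
  (f g : forall i, 'Hom(V i, W i)) :
  (forall i, f i = g i) -> dsum_map f = dsum_map g.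
Proof. by move=> e; rewrite (functional_extensionality_dep e). Qed.

End Linear.

Section Species.
Variable k : fieldType.

Definition Sp : category := functor_category finbij_category (vect_category k).

Definition sp_ob (p : Sp) (I : finType) : vectType k := fob p I.

Definition sp_map (p : Sp) (I J : finType) (f : bij I J) :
  'Hom(sp_ob p I, sp_ob p J) := @fmap _ _ p I J f.

Definition sp_hom (p q : Sp) (a : hom p q) (I : finType) :
  'Hom(sp_ob p I, sp_ob q I) := ncomp a I.

Lemma sp_map_id (p : Sp) I : sp_map p (bij_id I) = \1%VF.
Proof. exact: (@fmap_id _ _ p I). Qed.

Lemma sp_map_comp (p : Sp) I J K (g : bij J K) (f : bij I J) :
  sp_map p (bij_comp g f) = (sp_map p g \o sp_map p f)%VF.
Proof. exact: (@fmap_comp _ _ p I J K g f). Qed.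

Lemma sp_hom_nat (p q : Sp) (a : hom p q) I J (f : bij I J) :
  (sp_hom a J \o sp_map p f)%VF = (sp_map q f \o sp_hom a I)%VF.
Proof. exact: (@nnat _ _ p q a I J f). Qed.

Section HeisObject.
Variables p q : Sp.

Definition heis_summand (I : finType) (c : cov I) : vectType k :=
  tens (sp_ob p (covl c)) (sp_ob q (covr c)).

Definition heis_sp_ob (I : finType) : vectType k := dsum (@heis_summand I).

(* p[f|S] (x) q[f|T] maps the summand of (S, T) to that of (f S, f T); the
   summand of the target indexed by c thus comes from that of precov f c.     *)
Definition heis_sp_map (I J : finType) (f : bij I J) :
  'Hom(heis_sp_ob I, heis_sp_ob J) :=
  linfun (fun x : heis_sp_ob I =>
    [ffun c => tmap (sp_map p (presub f (val c).1))
                    (sp_map q (presub f (val c).2)) (dproj (precov f c) x)]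
      : dsum_type (@heis_summand J)).

Lemma heis_sp_mapE (I J : finType) (f : bij I J) x c :
  dproj c (heis_sp_map f x) =
  tmap (sp_map p (presub f (val c).1)) (sp_map q (presub f (val c).2))
    (dproj (precov f c) x).
Proof.
rewrite linfunE; first by rewrite /dproj ffunE.
by move=> a y z; apply/ffunP => j; rewrite !ffunE dproj_lin linearP.
Qed.

Lemma heis_sp_map_cong (I : finType) (x : heis_sp_ob I) (A B : finType)
  (c c' : cov I) (f : bij (covl c) A) (g : bij (covr c) B)
  (f' : bij (covl c') A) (g' : bij (covr c') B) :
  val c = val c' -> (forall y y', val y = val y' -> f y = f' y') ->
  (forall y y', val y = val y' -> g y = g' y') ->
  tmap (sp_map p f) (sp_map q g) (dproj c x) =
  tmap (sp_map p f') (sp_map q g') (dproj c' x).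
Proof.
move=> /val_inj e; subst c' => fE gE.
have -> : f = f' by apply: bij_eq => y; apply: fE.
by have -> : g = g' by apply: bij_eq => y; apply: gE.
Qed.

Definition heis_sp : Sp.
Proof.
refine (@Functor finbij_category (vect_category k) heis_sp_ob heis_sp_map _ _).
- move=> I; apply/lfunP => x; apply: dsumP => c.
  rewrite id_lfunE heis_sp_mapE -[RHS]id_lfunE -tmap_id -!sp_map_id.
  apply: (@heis_sp_map_cong I x _ _ (precov (bij_id I) c) c
    (presub (bij_id I) (val c).1) (presub (bij_id I) (val c).2)
    (bij_id _) (bij_id _)) => [|y y' e|y y' e]; last 2 first.
  + exact: val_inj.
  + exact: val_inj.
  by rewrite /= [RHS]surjective_pairing; congr pair; apply/setP => y;
    rewrite inE.
- move=> I J K g f; apply/lfunP => x; apply: dsumP => c.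
  rewrite comp_lfunE !heis_sp_mapE -comp_lfunE -tmap_comp -!sp_map_comp.
  apply: (@heis_sp_map_cong I x _ _ (precov (bij_comp g f) c)
    (precov f (precov g c)) (presub (bij_comp g f) (val c).1)
    (presub (bij_comp g f) (val c).2)) => [|y y' e|y y' e].
  + by rewrite /=; congr pair; apply/setP => y; rewrite !inE.
  + by apply: val_inj; rewrite /= e.
  + by apply: val_inj; rewrite /= e.
Defined.

End HeisObject.

Definition heis_sp_hom_ob (p p' q q' : Sp) (a : hom p p') (b : hom q q')
  (I : finType) : 'Hom(heis_sp_ob p q I, heis_sp_ob p' q' I) :=
  dsum_map (fun c : cov I => tmap (sp_hom a (covl c)) (sp_hom b (covr c))).

Lemma heis_sp_hom_nat (p p' q q' : Sp) (a : hom p p') (b : hom q q')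
  (I J : finType) (f : bij I J) :
  (heis_sp_hom_ob a b J \o heis_sp_map p q f)%VF =
  (heis_sp_map p' q' f \o heis_sp_hom_ob a b I)%VF.
Proof.
apply/lfunP => x; rewrite [LHS]comp_lfunE [RHS]comp_lfunE.
apply: dsumP => c; rewrite [LHS]dproj_map [RHS]heis_sp_mapE.
rewrite [X in _ = fun_of_lfun _ X]dproj_map.
rewrite [X in fun_of_lfun _ X = _]heis_sp_mapE.
by rewrite -!comp_lfunE -!tmap_comp !sp_hom_nat.
Qed.

Definition heis_sp_hom (p p' q q' : Sp) (a : hom p p') (b : hom q q') :
  hom (heis_sp p q) (heis_sp p' q') :=
  @Nattrans finbij_category (vect_category k) (heis_sp p q) (heis_sp p' q')
    (heis_sp_hom_ob a b) (heis_sp_hom_nat a b).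

Lemma heis_sp_hom_ob_id (p q : Sp) (I : finType) :
  heis_sp_hom_ob (idm p) (idm q) I = \1%VF.
Proof.
apply/lfunP => x; apply: dsumP => c.
by rewrite dproj_map !id_lfunE -[RHS]id_lfunE -tmap_id.
Qed.

Lemma heis_sp_hom_ob_comp (p p' p'' q q' q'' : Sp) (a' : hom p' p'')
  (a : hom p p') (b' : hom q' q'') (b : hom q q') (I : finType) :
  heis_sp_hom_ob (a' \oc a) (b' \oc b) I =
  (heis_sp_hom_ob a' b' I \o heis_sp_hom_ob a b I)%VF.
Proof.
apply/lfunP => x; apply: dsumP => c.
by rewrite comp_lfunE !dproj_map -comp_lfunE -tmap_comp.
Qed.

Definition heisSp : bifunctor Sp.
Proof.
refine (@Bifunctor Sp heis_sp heis_sp_hom _ _).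
- by move=> p q; apply: nattrans_eq => I; apply: heis_sp_hom_ob_id.
- move=> p p' p'' q q' q'' a' a b' b; apply: nattrans_eq => I.
  exact: heis_sp_hom_ob_comp.
Defined.

Definition k_if (b : bool) : vectType k :=
  if b then (k^o : vectType k) else ('rV[k]_0 : vectType k).

Definition k_if_map (b c : bool) : 'Hom(k_if b, k_if c) :=
  match b, c with true, true => \1%VF | _, _ => 0 end.

Lemma k_if_map_id b : k_if_map b b = \1%VF.
Proof. by case: b => //; apply/lfunP => x; apply/rowP => -[]. Qed.

Lemma k_if_map_comp b : (k_if_map b b \o k_if_map b b = k_if_map b b)%VF.
Proof. by rewrite k_if_map_id comp_lfun1l. Qed.

Definition is_empty (I : finType) : bool := #|I| == 0%N.

Lemma is_empty_bij I J (f : bij I J) : is_empty I = is_empty J.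
Proof. by rewrite /is_empty (bij_eq_card (bij_bij f)). Qed.

Definition oneSp : Sp.
Proof.
refine (@Functor finbij_category (vect_category k) (fun I => k_if (is_empty I))
  (fun I J _ => k_if_map (is_empty I) (is_empty J)) _ _).
- by move=> I; apply: k_if_map_id.
- move=> I J K g f.
  by rewrite (is_empty_bij f) (is_empty_bij g) /= k_if_map_comp.
Defined.

Definition oneSp_val (I : finType) : sp_ob oneSp I -> k :=
  k_if_map (is_empty I) true.

Definition heis_pure (p q : Sp) (I : finType) (c : cov I)
  (x : sp_ob p (covl c)) (y : sp_ob q (covr c)) : sp_ob (heis_sp p q) I :=
  @dinj k (cov I) (@heis_summand p q I) c (pure x y).

(* The usual monoidal structure on Sp: on pure tensors the associator sends
   (x (x) y) (x) z to x (x) (y (x) z), and the unitors send 1 (x) x and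
   x (x) 1 to x. The sets A in S in I and A in I (etc.) are identified along
   the unique bijections compatible with the inclusions into I.               *)
Definition is_canonical (M : monoidal heisSp oneSp) : Prop :=
  [/\ forall (p q r : Sp) (I : finType)
        (st : cov I) (ab : cov (covl st)) (au : cov I) (bt : cov (covr au))
        (f : bij (covl ab) (covl au)) (g : bij (covr ab) (covl bt))
        (h : bij (covr st) (covr bt)),
        (forall i, val (f i) = val (val i)) ->
        (forall i, val (val (g i)) = val (val i)) ->
        (forall i, val (val (h i)) = val i) ->
        forall (x : sp_ob p (covl ab)) (y : sp_ob q (covr ab))
          (z : sp_ob r (covr st)),
        sp_hom (massoc M p q r) I
          (@heis_pure (heis_sp p q) r I st (@heis_pure p q _ ab x y) z)
        = @heis_pure p (heis_sp q r) I au (sp_map p f x)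
            (@heis_pure q r _ bt (sp_map q g y) (sp_map r h z)),
      forall (p : Sp) (I : finType) (st : cov I) (f : bij (covr st) I),
        (forall i, f i = val i) ->
        forall (c : sp_ob oneSp (covl st)) (x : sp_ob p (covr st)),
        sp_hom (mlunit M p) I (@heis_pure oneSp p I st c x)
        = oneSp_val c *: sp_map p f x
    & forall (p : Sp) (I : finType) (st : cov I) (f : bij (covl st) I),
        (forall i, f i = val i) ->
        forall (x : sp_ob p (covl st)) (c : sp_ob oneSp (covr st)),
        sp_hom (mrunit M p) I (@heis_pure p oneSp I st x c)
        = oneSp_val c *: sp_map p f x].

End Species.

Section Representations.
Variable k : fieldType.

(* Permutations compose from left to right in the library: (s * t) x = t (s x).
   The order of the factors in rep_mul is the one that makes a rep 'S_n an
   ordinary (left) representation of S_n.                                     *)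
Record rep (gT : finGroupType) := Rep {
  rep_sp :> vectType k;
  rep_act : gT -> 'End(rep_sp);
  rep_one : rep_act 1%g = \1%VF;
  rep_mul : forall g h, rep_act (g * h)%g = (rep_act h \o rep_act g)%VF
}.

Arguments rep_act {gT} r g.

Record rep_hom (gT : finGroupType) (V W : rep gT) := RepHom {
  rhom :> 'Hom(rep_sp V, rep_sp W);
  rhom_act : forall g, (rhom \o rep_act V g)%VF = (rep_act W g \o rhom)%VF
}.

Section RepCategory.
Variable gT : finGroupType.

Lemma rep_hom_eq (V W : rep gT) (f g : rep_hom V W) :
  (f : 'Hom(_, _)) = g -> f = g.
Proof.
case: f g => [f fa] [g ga] /= e.
by subst g; congr RepHom; apply: Prop_irrelevance.
Qed.

Definition rep_id (V : rep gT) : rep_hom V V.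
Proof. by exists \1%VF => g; rewrite comp_lfun1l comp_lfun1r. Defined.

Definition rep_comp (U V W : rep gT) (g : rep_hom V W) (f : rep_hom U V) :
  rep_hom U W.
Proof.
exists (rhom g \o rhom f)%VF => x.
by rewrite -comp_lfunA rhom_act comp_lfunA rhom_act comp_lfunA.
Defined.

Definition rep_category : category.
Proof.
refine (@Category (rep gT) (@rep_hom gT) rep_id rep_comp _ _ _).
- by move=> *; apply: rep_hom_eq; apply: comp_lfun1l.
- by move=> *; apply: rep_hom_eq; apply: comp_lfun1r.
- by move=> *; apply: rep_hom_eq; apply: comp_lfunA.
Defined.

Definition rep_hom_add (V W : rep gT) (f g : rep_hom V W) : rep_hom V W.
Proof.
exists (rhom f + rhom g) => x.
by rewrite comp_lfunDl comp_lfunDr !rhom_act.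
Defined.

Definition rep_hom_zero (V W : rep gT) : rep_hom V W.
Proof. by exists 0 => x; rewrite comp_lfun0l comp_lfun0r. Defined.

Definition rep_hom_opp (V W : rep gT) (f : rep_hom V W) : rep_hom V W.
Proof.
by exists (- rhom f) => x; rewrite comp_lfunNl comp_lfunNr rhom_act.
Defined.

Definition rep_preadditive : preadditive rep_category.
Proof.
refine (@Preadditive rep_category rep_hom_add rep_hom_zero rep_hom_opp
  _ _ _ _ _ _).
- by move=> V W f g h; apply: rep_hom_eq; apply: addrA.
- by move=> V W f g; apply: rep_hom_eq; apply: addrC.
- by move=> V W f; apply: rep_hom_eq; apply: add0r.
- by move=> V W f; apply: rep_hom_eq; apply: addNr.
- by move=> *; apply: rep_hom_eq; apply: comp_lfunDl.
- by move=> *; apply: rep_hom_eq; apply: comp_lfunDr.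
Defined.

Definition rep_dsum (I : finType) (V : I -> rep gT) : rep gT.
Proof.
refine (@Rep gT (dsum (fun i => rep_sp (V i)))
  (fun g => dsum_map (fun i => rep_act (V i) g)) _ _).
- apply/lfunP => x; apply: dsumP => i.
  by rewrite dproj_map rep_one !id_lfunE.
- move=> g h; apply/lfunP => x; apply: dsumP => i.
  by rewrite comp_lfunE !dproj_map rep_mul comp_lfunE.
Defined.

Definition rep_dsum_hom (I : finType) (V W : I -> rep gT)
  (f : forall i, rep_hom (V i) (W i)) : rep_hom (rep_dsum V) (rep_dsum W).
Proof.
exists (dsum_map (fun i => rhom (f i))) => g.
apply/lfunP => x; apply: dsumP => i.
by rewrite !comp_lfunE !dproj_map -!comp_lfunE rhom_act.
Defined.

Lemma rep_dsum_hom_id (I : finType) (V : I -> rep gT) :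
  rep_dsum_hom (fun i => rep_id (V i)) = rep_id (rep_dsum V).
Proof. by apply: rep_hom_eq; apply: dsum_map_id. Qed.

Lemma rep_dsum_hom_comp (I : finType) (U V W : I -> rep gT)
  (g : forall i, rep_hom (V i) (W i)) (f : forall i, rep_hom (U i) (V i)) :
  rep_dsum_hom (fun i => rep_comp (g i) (f i)) =
  rep_comp (rep_dsum_hom g) (rep_dsum_hom f).
Proof. by apply: rep_hom_eq; apply: dsum_map_comp. Qed.

Lemma eq_rep_dsum_hom (I : finType) (V W : I -> rep gT)
  (f g : forall i, rep_hom (V i) (W i)) :
  (forall i, f i = g i) -> rep_dsum_hom f = rep_dsum_hom g.
Proof. by move=> e; rewrite (functional_extensionality_dep e). Qed.

End RepCategory.

Definition rep_tens (gT hT : finGroupType) (V : rep gT) (W : rep hT) :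
  rep (gT * hT)%type.
Proof.
refine (@Rep (gT * hT)%type (tens V W)
  (fun g => tmap (rep_act V g.1) (rep_act W g.2)) _ _).
- by rewrite !rep_one tmap_id.
- by move=> g h; rewrite /= !rep_mul tmap_comp.
Defined.

Definition rep_tens_hom (gT hT : finGroupType) (V V' : rep gT) (W W' : rep hT)
  (f : rep_hom V V') (g : rep_hom W W') :
  rep_hom (rep_tens V W) (rep_tens V' W').
Proof. by exists (tmap f g) => x; rewrite -!tmap_comp !rhom_act. Defined.

Lemma rep_tens_hom_id (gT hT : finGroupType) (V : rep gT) (W : rep hT) :
  rep_tens_hom (rep_id V) (rep_id W) = rep_id (rep_tens V W).
Proof. by apply: rep_hom_eq; apply: tmap_id. Qed.

Lemma rep_tens_hom_comp (gT hT : finGroupType)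
  (V V' V'' : rep gT) (W W' W'' : rep hT)
  (f' : rep_hom V' V'') (f : rep_hom V V')
  (g' : rep_hom W' W'') (g : rep_hom W W') :
  rep_tens_hom (rep_comp f' f) (rep_comp g' g) =
  rep_comp (rep_tens_hom f' g') (rep_tens_hom f g).
Proof. by apply: rep_hom_eq; apply: tmap_comp. Qed.

Section ResInd.
Variables (hT gT : finGroupType) (i : hT -> gT).

Section Res.
Hypothesis iM : {morph i : x y / (x * y)%g}.

Definition rep_res (V : rep gT) : rep hT.
Proof.
refine (@Rep hT V (fun h => rep_act V (i h)) _ _).
- have -> : i 1%g = 1%g by apply: (mulgI (i 1%g)); rewrite -iM !mulg1.
  exact: rep_one.
- by move=> g h; rewrite iM rep_mul.
Defined.

Definition rep_res_hom (V W : rep gT) (f : rep_hom V W) :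
  rep_hom (rep_res V) (rep_res W).
Proof.
by refine (@RepHom hT (rep_res V) (rep_res W) (@rhom gT V W f) _) => h;
  apply: (@rhom_act gT V W f (i h)).
Defined.

Lemma rep_res_hom_id (V : rep gT) :
  rep_res_hom (rep_id V) = rep_id (rep_res V).
Proof. exact: rep_hom_eq. Qed.

Lemma rep_res_hom_comp (U V W : rep gT) (g : rep_hom V W) (f : rep_hom U V) :
  rep_res_hom (rep_comp g f) = rep_comp (rep_res_hom g) (rep_res_hom f).
Proof. exact: rep_hom_eq. Qed.

End Res.

(* The induced representation along i, as the space of functions f : G -> V
   with f (i(h) x) = h . f x, on which G acts by (g . f) x = f (x g); the
   products of G are reversed here because of the convention made in rep.     *)
Definition ind_defect (V : rep hT) (hx : hT * gT) :
  'Hom({ffun gT -> rep_sp V}, rep_sp V) :=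
  linfun (fun f : {ffun gT -> rep_sp V} =>
    f (hx.2 * i hx.1)%g - rep_act V hx.1 (f hx.2)).

Definition ind_space (V : rep hT) : {vspace {ffun gT -> rep_sp V}} :=
  (\bigcap_(hx : hT * gT) lker (ind_defect V hx))%VS.

Lemma ind_spaceP (V : rep hT) (f : {ffun gT -> rep_sp V}) :
  reflect (forall h x, f (x * i h)%g = rep_act V h (f x)) (f \in ind_space V).
Proof.
have E hx : ind_defect V hx f = f (hx.2 * i hx.1)%g - rep_act V hx.1 (f hx.2).
  rewrite linfunE // => a u v; rewrite !ffunE linearP /=.
  by rewrite scalerBr opprD addrACA.
apply: (iffP subv_bigcapP) => [H h x|H hx _].
  have := H (h, x) isT; rewrite -memvE memv_ker E subr_eq0 => /eqP; exact.
by rewrite -memvE memv_ker E subr_eq0 H.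
Qed.

Definition ind_sp (V : rep hT) : vectType k := subvs_of (ind_space V).

Lemma ind_spP (V : rep hT) (f : ind_sp V) h x :
  vsval f (x * i h)%g = rep_act V h (vsval f x).
Proof. exact: (elimT (ind_spaceP (vsval f)) (subvsP f)). Qed.

Lemma ind_sp_eq (V : rep hT) (f g : ind_sp V) :
  (forall x, vsval f x = vsval g x) -> f = g.
Proof. by move=> e; apply: val_inj; apply/ffunP. Qed.

Definition ind_act (V : rep hT) (g : gT) : 'End(ind_sp V) :=
  linfun (fun f : ind_sp V =>
    vsproj (ind_space V) [ffun x => vsval f (g * x)%g]).

Lemma ind_actE (V : rep hT) (g : gT) (f : ind_sp V) x :
  vsval (ind_act V g f) x = vsval f (g * x)%g.
Proof.
rewrite linfunE.
  rewrite vsprojK ?ffunE //; apply/ind_spaceP => h y.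
  by rewrite !ffunE mulgA ind_spP.
move=> a u v; rewrite -linearP; congr vsproj.
by apply/ffunP => y; rewrite !ffunE.
Qed.

Definition rep_ind (V : rep hT) : rep gT.
Proof.
refine (@Rep gT (ind_sp V) (ind_act V) _ _).
- apply/lfunP => f; apply: ind_sp_eq => x.
  by rewrite ind_actE mul1g id_lfunE.
- move=> g h; apply/lfunP => f; apply: ind_sp_eq => x.
  by rewrite comp_lfunE !ind_actE mulgA.
Defined.

Definition ind_map (V W : rep hT) (f : rep_hom V W) :
  'Hom(ind_sp V, ind_sp W) :=
  linfun (fun u : ind_sp V =>
    vsproj (ind_space W) [ffun x => rhom f (vsval u x)]).

Lemma ind_mapE (V W : rep hT) (f : rep_hom V W) (u : ind_sp V) x :
  vsval (ind_map f u) x = rhom f (vsval u x).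
Proof.
rewrite linfunE.
  rewrite vsprojK ?ffunE //; apply/ind_spaceP => h y.
  by rewrite !ffunE ind_spP -!comp_lfunE rhom_act.
move=> a v w; rewrite -linearP; congr vsproj.
by apply/ffunP => y; rewrite !ffunE linearP.
Qed.

Definition rep_ind_hom (V W : rep hT) (f : rep_hom V W) :
  rep_hom (rep_ind V) (rep_ind W).
Proof.
exists (ind_map f) => g; apply/lfunP => u; apply: ind_sp_eq => x.
by rewrite !comp_lfunE /= ind_actE !ind_mapE ind_actE.
Defined.

Lemma rep_ind_hom_id (V : rep hT) :
  rep_ind_hom (rep_id V) = rep_id (rep_ind V).
Proof.
apply: rep_hom_eq; apply/lfunP => u; apply: ind_sp_eq => x.
by rewrite ind_mapE [LHS]id_lfunE id_lfunE.
Qed.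

Lemma rep_ind_hom_comp (U V W : rep hT) (g : rep_hom V W) (f : rep_hom U V) :
  rep_ind_hom (rep_comp g f) = rep_comp (rep_ind_hom g) (rep_ind_hom f).
Proof.
apply: rep_hom_eq; apply/lfunP => u; apply: ind_sp_eq => x.
by rewrite ind_mapE [in RHS]comp_lfunE !ind_mapE [LHS]comp_lfunE.
Qed.

End ResInd.

End Representations.

Section Juxtaposition.
Variables p q : nat.

Definition juxt_fun (s : 'S_p) (t : 'S_q) (i : 'I_(p + q)) : 'I_(p + q) :=
  match split i with
  | inl j => lshift q (s j)
  | inr j => rshift p (t j)
  end.

Fact juxt_inj s t : injective (juxt_fun s t).
Proof.
apply: (can_inj (g := juxt_fun s^-1 t^-1)) => i; rewrite /juxt_fun.
rewrite -[RHS]splitK; case: (split i) => j.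
  by rewrite -[lshift q (s j)]/(unsplit (inl _)) unsplitK permK.
by rewrite -[rshift p (t j)]/(unsplit (inr _)) unsplitK permK.
Qed.

Definition juxt (s : 'S_p) (t : 'S_q) : 'S_(p + q) := perm (@juxt_inj s t).

Lemma juxtM s s' t t' :
  juxt (s * s')%g (t * t')%g = (juxt s t * juxt s' t')%g.
Proof.
apply/permP => i; rewrite permM !permE /juxt_fun.
case: (split i) => j.
  by rewrite -[lshift q (s j)]/(unsplit (inl _)) unsplitK permM.
by rewrite -[rshift p (t j)]/(unsplit (inr _)) unsplitK permM.
Qed.

End Juxtaposition.

Section HeisDegree.
Variables p q n : nat.
Hypothesis pqn : (maxn p q <= n <= p + q)%N.

(* S_p x_n S_q and its embeddings in S_n and in S_p x S_q *)
Definition overlap_group : finGroupType :=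
  ('S_(n - q) * 'S_(p + q - n) * 'S_(n - p))%type.

Fact overlap_p : (n - q + (p + q - n) = p)%N.
Proof.
move: pqn; rewrite geq_max => /andP[/andP[_ qn] npq].
by rewrite addnBA // [(p + q)%N]addnC addnA subnK // addKn.
Qed.

Fact overlap_q : (p + q - n + (n - p) = q)%N.
Proof.
move: pqn; rewrite geq_max => /andP[/andP[pn _] npq].
by rewrite addnC addnBA // addnA subnK // addKn.
Qed.

Fact overlap_n : (n - q + (p + q - n) + (n - p) = n)%N.
Proof.
move: (pqn); rewrite geq_max => /andP[/andP[pn _] _].
by rewrite overlap_p subnKC.
Qed.

Definition overlap_to_n (x : overlap_group) : 'S_n :=
  cast_perm overlap_n (juxt (juxt x.1.1 x.1.2) x.2).

Definition overlap_to_pq (x : overlap_group) : ('S_p * 'S_q)%type :=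
  (cast_perm overlap_p (juxt x.1.1 x.1.2),
   cast_perm overlap_q (juxt x.1.2 x.2)).

Lemma overlap_to_pqM : {morph overlap_to_pq : x y / (x * y)%g}.
Proof. by move=> x y; rewrite /overlap_to_pq !juxtM !cast_perm_morphM. Qed.

Definition heis_degree (k : fieldType) (V : rep k 'S_p) (W : rep k 'S_q) :
  rep k 'S_n :=
  rep_ind overlap_to_n (rep_res overlap_to_pqM (rep_tens V W)).

Definition heis_degree_hom (k : fieldType) (V V' : rep k 'S_p)
  (W W' : rep k 'S_q) (f : rep_hom V V') (g : rep_hom W W') :
  rep_hom (heis_degree V W) (heis_degree V' W') :=
  rep_ind_hom overlap_to_n
    (rep_res_hom overlap_to_pqM (rep_tens_hom f g)).

Lemma heis_degree_hom_id (k : fieldType) (V : rep k 'S_p) (W : rep k 'S_q) :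
  heis_degree_hom (rep_id V) (rep_id W) = rep_id (heis_degree V W).
Proof.
by rewrite /heis_degree_hom rep_tens_hom_id rep_res_hom_id rep_ind_hom_id.
Qed.

Lemma heis_degree_hom_comp (k : fieldType) (V V' V'' : rep k 'S_p)
  (W W' W'' : rep k 'S_q) (f' : rep_hom V' V'') (f : rep_hom V V')
  (g' : rep_hom W' W'') (g : rep_hom W W') :
  heis_degree_hom (rep_comp f' f) (rep_comp g' g) =
  rep_comp (heis_degree_hom f' g') (heis_degree_hom f g).
Proof.
by rewrite /heis_degree_hom rep_tens_hom_comp rep_res_hom_comp
  rep_ind_hom_comp.
Qed.

End HeisDegree.

Section HeisRep.
Variable k : fieldType.

Definition Rcat : category :=
  product_category (fun n : nat => rep_category k 'S_n).

Definition Rpreadditive : preadditive Rcat :=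
  product_preadditive (fun n : nat => rep_preadditive k 'S_n).

(* max(p, q) <= n forces p, q <= n, so ranging over 'I_n.+1 misses no pair *)
Definition degrees (n : nat) : finType :=
  {pq : 'I_n.+1 * 'I_n.+1 | maxn pq.1 pq.2 <= n <= pq.1 + pq.2}%N.

Definition heis_rep (V W : Rcat) : Rcat := fun n =>
  rep_dsum (fun d : degrees n =>
    heis_degree (valP d) (V (val d).1) (W (val d).2)).

Definition heis_rep_hom (V V' W W' : Rcat) (f : hom V V') (g : hom W W') :
  hom (heis_rep V W) (heis_rep V' W') := fun n =>
  rep_dsum_hom (fun d : degrees n =>
    heis_degree_hom (valP d) (f (val d).1) (g (val d).2)).

Definition heisR : bifunctor Rcat.
Proof.
refine (@Bifunctor Rcat heis_rep heis_rep_hom _ _).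
- move=> V W; apply: functional_extensionality_dep => n.
  rewrite -[RHS]rep_dsum_hom_id; apply: eq_rep_dsum_hom => d.
  exact: heis_degree_hom_id.
- move=> V V' V'' W W' W'' f' f g' g; apply: functional_extensionality_dep => n.
  rewrite -[RHS]rep_dsum_hom_comp; apply: eq_rep_dsum_hom => d.
  exact: heis_degree_hom_comp.
Defined.

Definition oneR : Rcat.
Proof.
refine (fun n => @Rep k 'S_n (k_if k (n == 0%N)) (fun=> \1%VF) _ _) => //.
by move=> *; rewrite comp_lfun1l.
Defined.

Definition perm_bij (n : nat) (s : 'S_n) : bij 'I_n 'I_n :=
  Bij (injF_bij (@perm_inj _ s)).

(* 'I_n = {0, ..., n - 1} plays the role of {1, ..., n} *)
Definition FR_ob (p : Sp k) : Rcat.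
Proof.
refine (fun n => @Rep k 'S_n (sp_ob p 'I_n) (fun s => sp_map p (perm_bij s))
  _ _).
- by rewrite -sp_map_id; congr sp_map; apply: bij_eq => i; rewrite /= perm1.
- move=> s t; rewrite -sp_map_comp; congr sp_map.
  by apply: bij_eq => i; rewrite /= permM.
Defined.

Definition FR_hom (p q : Sp k) (a : hom p q) : hom (FR_ob p) (FR_ob q).
Proof.
by refine (fun n => @RepHom k 'S_n (FR_ob p n) (FR_ob q n) (sp_hom a 'I_n) _)
  => s; apply: sp_hom_nat.
Defined.

Definition FR : functor (Sp k) Rcat.
Proof.
refine (@Functor (Sp k) Rcat FR_ob FR_hom _ _).
- by move=> p; apply: functional_extensionality_dep => n; apply: rep_hom_eq.
- move=> p q r b a; apply: functional_extensionality_dep => n.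
  exact: rep_hom_eq.
Defined.

End HeisRep.

(* Main.v *)
(* The restriction functor F from species to sequences of representations is
   full and essentially surjective, and F(p # q) is isomorphic to F(p) # F(q):
   the pairs (S, T) covering {1, ..., n} with #|S| = p and #|T| = q form a
   single S_n-orbit, with stabilizer S_p x_n S_q at the pair
   ({1, ..., p}, {n-q+1, ..., n}).  The canonical monoidal structure of species,
   whose coherence is checked on pure tensors, therefore transports along F,
   and F is monoidal for the transported structure by construction.           *)
From mathcomp Require Import all_boot all_fingroup all_algebra.
From mathcomp Require Import boolp zify.
Require Import Defs.

Set Implicit Arguments.
Unset Strict Implicit.
Unset Printing Implicit Defensive.

Import GRing.Theory.
Local Open Scope ring_scope.
Local Open Scope cat_scope.

(** * Transport of monoidal structures *)

(** Iterated induction would force the associator of R to be compared through choices of cosets.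
    Fullness removes these choices: two presentations of an object as an image under F differ by the
    image of a morphism of species, so naturality on species makes the transported constraint
    independent of the presentation, and each coherence equation may be tested after precomposing
    with an invertible tensor of presentations. On species the obstacle is that iterated products
    are indexed by subsets of subsets, so that the two bracketings live on different types. Pure
    tensors are therefore formed along arbitrary pairs of jointly surjective injections; a triple
    tensor then depends only on the three composites into I, up to relabelling. The comparison has
    an explicit formula from species to representations: an element of an induced representation is
    an equivariant function on S_n, and its value at s is the coordinate along the cover that s
    moves to standard position. *)

Section Iso.
Variable C : category.

Lemma is_iso_comp (X Y Z : C) (g : hom Y Z) (f : hom X Y) :
  is_iso g -> is_iso f -> is_iso (g \oc f).
Proof.
move=> [g' [gK Kg]] [f' [fK Kf]]; exists (f' \oc g'); split.
  by rewrite comp_assoc -(comp_assoc f') gK comp_idr fK.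
by rewrite comp_assoc -(comp_assoc g) Kf comp_idr Kg.
Qed.

Lemma is_iso_epi (X Y Z : C) (f : hom X Y) (g h : hom Y Z) :
  is_iso f -> g \oc f = h \oc f -> g = h.
Proof.
move=> [f' [_ Kf]] e.
by rewrite -(comp_idr g) -(comp_idr h) -Kf !comp_assoc e.
Qed.

End Iso.

Lemma is_iso_fmap (C D : category) (F : functor C D) (X Y : C) (f : hom X Y) :
  is_iso f -> is_iso (fmap F f).
Proof.
by move=> [g [fK Kf]]; exists (fmap F g); rewrite -!fmap_comp fK Kf !fmap_id.
Qed.

Lemma is_iso_bmap (C : category) (T : bifunctor C) (X X' Y Y' : C)
  (f : hom X X') (g : hom Y Y') : is_iso f -> is_iso g -> is_iso (bmap T f g).
Proof.
move=> [f' [fK Kf]] [g' [gK Kg]]; exists (bmap T f' g').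
by rewrite -!bmap_comp fK Kf gK Kg !bmap_id.
Qed.

Section Transport.
Variables (C D : category) (F : functor C D).
Variables (TC : bifunctor C) (uC : C) (TD : bifunctor D) (uD : D).
Variable MC : monoidal TC uC.
Variable mu : forall X Y : C, hom (TD (F X) (F Y)) (F (TC X Y)).
Variable nu : forall X Y : C, hom (F (TC X Y)) (TD (F X) (F Y)).
Hypothesis nuK : forall X Y, mu X Y \oc nu X Y = idm _.
Hypothesis muK : forall X Y, nu X Y \oc mu X Y = idm _.
Hypothesis nu_nat : forall (X X' Y Y' : C) (f : hom X X') (g : hom Y Y'),
  nu X' Y' \oc fmap F (bmap TC f g) =
  bmap TD (fmap F f) (fmap F g) \oc nu X Y.
Variables (eps : hom uD (F uC)) (eta : hom (F uC) uD).
Hypothesis etaK : eps \oc eta = idm _.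
Hypothesis epsK : eta \oc eps = idm _.
Hypothesis F_full : forall (X Y : C) (h : hom (F X) (F Y)),
  exists f, h = fmap F f.
Hypothesis F_esurj : forall X : D, exists (A : C) (e : hom (F A) X), is_iso e.

Local Notation "f \ox g" := (bmap TD f g) (at level 40, left associativity).
Local Notation "f \oC g" := (bmap TC f g) (at level 40, left associativity).

(* Locked, since rewriting with associativity would otherwise unfold it. *)
Definition ftens (A B : C) (X Y : D) (x : hom (F A) X) (y : hom (F B) Y) :
  hom (F (TC A B)) (TD X Y) := locked ((x \ox y) \oc nu A B).

Lemma ftensE (A B : C) (X Y : D) (x : hom (F A) X) (y : hom (F B) Y) :
  ftens x y = (x \ox y) \oc nu A B.
Proof. by rewrite /ftens -lock. Qed.

Lemma ftens_fmap A A' B B' X Y (x : hom (F A) X) (y : hom (F B) Y)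
  (f : hom A' A) (g : hom B' B) :
  ftens (x \oc fmap F f) (y \oc fmap F g) = ftens x y \oc fmap F (f \oC g).
Proof. by rewrite !ftensE bmap_comp -!comp_assoc nu_nat. Qed.

Lemma ftens_comp A B X Y X' Y' (x : hom (F A) X) (y : hom (F B) Y)
  (u : hom X X') (v : hom Y Y') :
  ftens (u \oc x) (v \oc y) = (u \ox v) \oc ftens x y.
Proof. by rewrite !ftensE bmap_comp !comp_assoc. Qed.

Lemma ftens_iso A B X Y (x : hom (F A) X) (y : hom (F B) Y) :
  is_iso x -> is_iso y -> is_iso (ftens x y).
Proof.
move=> xi yi; rewrite ftensE; apply: is_iso_comp; first exact: is_iso_bmap.
by exists (mu A B).
Qed.

Lemma ftens_fmapl A A' B X Y (x : hom (F A) X) (y : hom (F B) Y)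
  (f : hom A' A) :
  ftens (x \oc fmap F f) y = ftens x y \oc fmap F (f \oC idm B).
Proof. by rewrite -ftens_fmap fmap_id comp_idr. Qed.

Lemma ftens_fmapr A B B' X Y (x : hom (F A) X) (y : hom (F B) Y)
  (g : hom B' B) :
  ftens x (y \oc fmap F g) = ftens x y \oc fmap F (idm A \oC g).
Proof. by rewrite -ftens_fmap fmap_id comp_idr. Qed.

Lemma ftens_compl A B X Y X' (x : hom (F A) X) (y : hom (F B) Y)
  (u : hom X X') :
  ftens (u \oc x) y = (u \ox idm Y) \oc ftens x y.
Proof. by rewrite -ftens_comp comp_idl. Qed.

Lemma ftens_compr A B X Y Y' (x : hom (F A) X) (y : hom (F B) Y)
  (v : hom Y Y') :
  ftens x (v \oc y) = (idm X \ox v) \oc ftens x y.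
Proof. by rewrite -ftens_comp comp_idl. Qed.

(** Fullness enters here: every presentation of X factors through a given invertible one by the
    image of a morphism of C. *)
Lemma factor_iso (A A' : C) (X : D) (e : hom (F A) X) (x : hom (F A') X) :
  is_iso e -> exists f : hom A' A, x = e \oc fmap F f.
Proof.
move=> [e' [eK Ke]]; have [f ef] := F_full (e' \oc x).
by exists f; rewrite -ef comp_assoc Ke comp_idl.
Qed.

(* Along presentations [x : F A -> X] the associator of D is forced by that of
   C; by fullness it does not depend on the presentations.                    *)
Definition assoc_spec (X Y Z : D) (a : hom (TD (TD X Y) Z) (TD X (TD Y Z))) :=
  forall (A B E : C) (x : hom (F A) X) (y : hom (F B) Y) (z : hom (F E) Z),
  a \oc ftens (ftens x y) z = ftens x (ftens y z) \oc fmap F (massoc MC A B E).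

(** The associator of C is conjugated by one choice of invertible presentations; any other
    presentation factors through these, and naturality of [massoc] absorbs the factors. *)
Lemma assoc_exists X Y Z :
  exists a, @assoc_spec X Y Z a /\ is_iso a.
Proof.
have [A [x xi]] := F_esurj X; have [B [y yi]] := F_esurj Y.
have [E [z zi]] := F_esurj Z.
have li : is_iso (ftens (ftens x y) z) by do 2?apply: ftens_iso.
have ri : is_iso (ftens x (ftens y z)) by do 2?apply: ftens_iso.
have [l [lK Kl]] := li.
exists (ftens x (ftens y z) \oc fmap F (massoc MC A B E) \oc l); split.
  move=> A' B' E' x' y' z'.
  have [f ->] := factor_iso x' xi; have [g ->] := factor_iso y' yi.
  have [h ->] := factor_iso z' zi.
  rewrite !ftens_fmap -!comp_assoc; congr comp.
  by rewrite (comp_assoc l) lK comp_idl -!fmap_comp massoc_nat.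
apply: is_iso_comp; last by exists (ftens (ftens x y) z).
by apply: is_iso_comp => //; apply/is_iso_fmap/massoc_iso.
Qed.

(** [eta] presents [uD] as the image of [uC], so only the other factor needs a varying
    presentation. *)
Definition lunit_spec (X : D) (l : hom (TD uD X) X) :=
  forall (A : C) (x : hom (F A) X), l \oc ftens eta x = x \oc fmap F (mlunit MC A).

Definition runit_spec (X : D) (r : hom (TD X uD) X) :=
  forall (A : C) (x : hom (F A) X), r \oc ftens x eta = x \oc fmap F (mrunit MC A).

Lemma eta_iso : is_iso eta. Proof. by exists eps. Qed.

Lemma lunit_exists X : exists l, @lunit_spec X l /\ is_iso l.
Proof.
have [A [x xi]] := F_esurj X.
have li : is_iso (ftens eta x) by apply: ftens_iso => //; apply: eta_iso.
have [l [lK Kl]] := li.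
exists (x \oc fmap F (mlunit MC A) \oc l); split.
  move=> A' x'; have [f ->] := factor_iso x' xi.
  rewrite ftens_fmapr -!comp_assoc; congr comp.
  by rewrite (comp_assoc l) lK comp_idl -!fmap_comp mlunit_nat.
apply: is_iso_comp; last by exists (ftens eta x).
by apply: is_iso_comp => //; apply/is_iso_fmap/mlunit_iso.
Qed.

Lemma runit_exists X : exists r, @runit_spec X r /\ is_iso r.
Proof.
have [A [x xi]] := F_esurj X.
have li : is_iso (ftens x eta) by apply: ftens_iso => //; apply: eta_iso.
have [l [lK Kl]] := li.
exists (x \oc fmap F (mrunit MC A) \oc l); split.
  move=> A' x'; have [f ->] := factor_iso x' xi.
  rewrite ftens_fmapl -!comp_assoc; congr comp.
  by rewrite (comp_assoc l) lK comp_idl -!fmap_comp mrunit_nat.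
apply: is_iso_comp; last by exists (ftens x eta).
by apply: is_iso_comp => //; apply/is_iso_fmap/mrunit_iso.
Qed.

Lemma mu_nat (X X' Y Y' : C) (f : hom X X') (g : hom Y Y') :
  mu X' Y' \oc (fmap F f \ox fmap F g) = fmap F (f \oC g) \oc mu X Y.
Proof.
apply: (@is_iso_epi _ _ _ _ (nu X Y)); first by exists (mu X Y).
by rewrite -!comp_assoc -nu_nat nuK comp_idr comp_assoc nuK comp_idl.
Qed.

(** Both sides of each axiom are precomposed with an isomorphism [ftens]; the specifications then
    turn the axiom into the image under F of the same axiom in C. *)
Theorem transport_monoidal :
  exists MD : monoidal TD uD, is_monoidal_functor F MC MD.
Proof.
pose al X Y Z := projT1 (cid (assoc_exists X Y Z)).
have alP X Y Z : assoc_spec (al X Y Z) by rewrite /al; case: cid => a [].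
have ali X Y Z : is_iso (al X Y Z) by rewrite /al; case: cid => a [].
pose la X := projT1 (cid (lunit_exists X)).
have laP X : lunit_spec (la X) by rewrite /la; case: cid => a [].
have lai X : is_iso (la X) by rewrite /la; case: cid => a [].
pose ra X := projT1 (cid (runit_exists X)).
have raP X : runit_spec (ra X) by rewrite /ra; case: cid => a [].
have rai X : is_iso (ra X) by rewrite /ra; case: cid => a [].
clearbody al la ra.
have al_nat X X' Y Y' Z Z' (f : hom X X') (g : hom Y Y') (h : hom Z Z') :
    al X' Y' Z' \oc (f \ox g \ox h) = f \ox (g \ox h) \oc al X Y Z.
  have [A [x xi]] := F_esurj X; have [B [y yi]] := F_esurj Y.
  have [E [z zi]] := F_esurj Z.
  apply: (@is_iso_epi _ _ _ _ (ftens (ftens x y) z)).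
    by do 2?apply: ftens_iso.
  by rewrite -!comp_assoc alP -!ftens_comp alP comp_assoc -!ftens_comp.
have la_nat X X' (f : hom X X') : la X' \oc (idm uD \ox f) = f \oc la X.
  have [A [x xi]] := F_esurj X.
  apply: (@is_iso_epi _ _ _ _ (ftens eta x)).
    by apply: ftens_iso => //; apply: eta_iso.
  by rewrite -!comp_assoc laP -ftens_compr laP comp_assoc.
have ra_nat X X' (f : hom X X') : ra X' \oc (f \ox idm uD) = f \oc ra X.
  have [A [x xi]] := F_esurj X.
  apply: (@is_iso_epi _ _ _ _ (ftens x eta)).
    by apply: ftens_iso => //; apply: eta_iso.
  by rewrite -!comp_assoc raP -ftens_compl raP comp_assoc.
have tri X Y : (idm X \ox la Y) \oc al X uD Y = ra X \ox idm Y.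
  have [A [x xi]] := F_esurj X; have [B [y yi]] := F_esurj Y.
  apply: (@is_iso_epi _ _ _ _ (ftens (ftens x eta) y)).
    by do 2?apply: ftens_iso => //; apply: eta_iso.
  rewrite -comp_assoc alP comp_assoc -ftens_compr laP ftens_fmapr.
  by rewrite -comp_assoc -fmap_comp mtriangle -ftens_compl raP ftens_fmapl.
have pent X Y Z W : al X Y (TD Z W) \oc al (TD X Y) Z W
    = (idm X \ox al Y Z W) \oc al X (TD Y Z) W \oc (al X Y Z \ox idm W).
  have [A [x xi]] := F_esurj X; have [B [y yi]] := F_esurj Y.
  have [E [z zi]] := F_esurj Z; have [G [w wi]] := F_esurj W.
  apply: (@is_iso_epi _ _ _ _ (ftens (ftens (ftens x y) z) w)).
    by do 3?apply: ftens_iso.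
  rewrite -!comp_assoc -ftens_compl !alP ftens_fmapl.
  rewrite (comp_assoc (al X Y _)) alP (comp_assoc (al X _ W)) alP.
  rewrite !comp_assoc -ftens_compr alP ftens_fmapr -!comp_assoc.
  by rewrite -!fmap_comp mpentagon comp_assoc.
exists (Monoidal ali lai rai al_nat la_nat ra_nat tri pent).
exists mu, eps; split => /=.
- by split=> [X Y|]; [exists (nu X Y) | exists eta].
- exact: mu_nat.
- move=> X Y Z.
  (* For identity presentations [ftens] is [nu], which cancels against [mu]. *)
  apply: (@is_iso_epi _ _ _ _ (ftens (ftens (idm (F X)) (idm (F Y))) (idm (F Z)))).
    by do 2?apply: ftens_iso; exists (idm _); rewrite !comp_idl.
  rewrite -!comp_assoc alP -ftens_compl !ftensE !bmap_id !comp_idl nuK.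
  rewrite bmap_id comp_idl nuK comp_idr.
  rewrite !comp_assoc -(comp_assoc (mu _ _)) -bmap_comp nuK comp_idl bmap_id.
  by rewrite comp_idr nuK comp_idl.
- move=> X; apply: (@is_iso_epi _ _ _ _ (ftens eta (idm (F X)))).
    apply: ftens_iso; first exact: eta_iso.
    by exists (idm _); rewrite !comp_idl.
  rewrite -!comp_assoc laP comp_idl -ftens_compl etaK ftensE bmap_id comp_idl.
  by rewrite nuK comp_idr.
move=> X; apply: (@is_iso_epi _ _ _ _ (ftens (idm (F X)) eta)).
  apply: ftens_iso; last exact: eta_iso.
  by exists (idm _); rewrite !comp_idl.
rewrite -!comp_assoc raP comp_idl -ftens_compr etaK ftensE bmap_id comp_idl.
by rewrite nuK comp_idr.
Qed.

End Transport.

(** * Pure tensors in the Heisenberg product of species *)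

(** Index sets are compared through their images in I: as both maps are injective, a point with a
    given image is unique. *)
Lemma lift_bij (A A' I : finType) (a : A -> I) (a' : A' -> I) :
  injective a -> injective a' ->
  (forall i, (exists x, a x = i) <-> (exists x, a' x = i)) ->
  exists f : bij A A', forall x, a' (f x) = a x.
Proof.
move=> ai ai' im.
have H x : exists y, a' y = a x by apply/im; exists x.
have H' y : exists x, a x = a' y by apply/im; exists y.
pose f x := projT1 (cid (H x)); pose g y := projT1 (cid (H' y)).
have fE x : a' (f x) = a x by rewrite /f; case: cid.
have gE x : a (g x) = a' x by rewrite /g; case: cid.
have fb : bijective f.
  by exists g => x; [apply: ai; rewrite gE fE | apply: ai'; rewrite fE gE].
by exists (Bij fb).
Qed.

Section Inc.
Variables (I : finType) (S : {set I}).

Definition inc (x : subft S) : I := val x.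

Lemma inc_inj : injective inc.
Proof. exact: val_inj. Qed.

Lemma incP x : inc x \in S.
Proof. exact: valP. Qed.

Lemma inc_onto i : i \in S -> exists x, inc x = i.
Proof. by move=> iS; exists (exist _ i iS). Qed.

End Inc.

(** A cover by injections instead of subsets, so that blocks of blocks are again plain finite sets
    mapping to I. *)
Definition cover2 (A B I : finType) (a : A -> I) (b : B -> I) : Prop :=
  [/\ injective a, injective b
    & forall i, (exists x, a x = i) \/ (exists y, b y = i)].

Lemma cover2_sym (A B I : finType) (a : A -> I) (b : B -> I) :
  cover2 a b -> cover2 b a.
Proof. by move=> [ai bi ab]; split=> // i; case: (ab i); [right|left]. Qed.

Lemma cover2_bij (A B I J : finType) (a : A -> I) (b : B -> I) (h : bij I J) :
  cover2 a b -> cover2 (h \o a) (h \o b).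
Proof.
have [g hK gK] := bij_bij h; have hi := can_inj hK.
move=> [ai bi ab]; split; try exact: inj_comp.
move=> j; case: (ab (g j)) => [[x e]|[x e]]; [left|right]; exists x => /=;
  by rewrite e gK.
Qed.

Definition linc (I : finType) (c : cov I) : covl c -> I := @inc I (val c).1.

Definition rinc (I : finType) (c : cov I) : covr c -> I := @inc I (val c).2.

Lemma linc_inj (I : finType) (c : cov I) : injective (@linc I c).
Proof. exact: inc_inj. Qed.

Lemma rinc_inj (I : finType) (c : cov I) : injective (@rinc I c).
Proof. exact: inc_inj. Qed.

Lemma cover2_cov (I : finType) (c : cov I) : cover2 (@linc I c) (@rinc I c).
Proof.
split; try exact: inc_inj.
move=> i; have : i \in (val c).1 :|: (val c).2 by rewrite (eqP (valP c)) inE.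
by rewrite inE => /orP[]/inc_onto; [left | right].
Qed.

Lemma cov_exists (I : finType) (S T : {set I}) :
  (forall i, i \in S \/ i \in T) -> exists c : cov I, val c = (S, T).
Proof.
move=> ST; have cP : (S, T).1 :|: (S, T).2 == [set: I].
  by apply/eqP/setP => i; rewrite !inE /=; case: (ST i) => ->; rewrite ?orbT.
by exists (exist _ (S, T) cP).
Qed.

Lemma cover2_to_cov (A B I : finType) (a : A -> I) (b : B -> I) :
  cover2 a b -> exists c : cov I,
    (exists f : bij A (covl c), forall x, linc (f x) = a x) /\
    (exists g : bij B (covr c), forall x, rinc (g x) = b x).
Proof.
move=> [ai bi ab].
have [|c ec] := @cov_exists I (a @: setT) (b @: setT).
  by move=> i; case: (ab i) => [[x <-]|[x <-]]; [left|right]; apply: imset_f.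
have im (X : finType) (f : X -> I) (S : {set I}) i : S = f @: setT ->
    (exists x, f x = i) <-> exists y : subft S, inc y = i.
  move=> ->; split=> [[x <-]|[y <-]]; first by apply/inc_onto/imset_f.
  by have /imsetP[x _ ->] := incP y; exists x.
exists c; split.
  by apply: (lift_bij ai (@inc_inj _ _)) => i; apply: im; rewrite ec.
by apply: (lift_bij bi (@inc_inj _ _)) => i; apply: im; rewrite ec.
Qed.

(* The covers of the two bracketings of a triple product determine each other:
   U is the union of the second and third blocks.                             *)
Lemma cover2_assoc (A B S T I : finType) (s : S -> I) (t : T -> I)
  (a : A -> S) (b : B -> S) : cover2 s t -> cover2 a b ->
  exists (U : finType) (u : U -> I) (b' : B -> U) (c' : T -> U),
    [/\ cover2 (s \o a) u, cover2 b' c', forall x, u (b' x) = s (b x)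
      & forall x, u (c' x) = t x].
Proof.
move=> [si ti st] [ai bi ab].
pose Us := ((s \o b) @: setT) :|: (t @: setT).
have bP x : s (b x) \in Us by rewrite inE (imset_f (s \o b)) ?inE.
have tP x : t x \in Us by rewrite inE (imset_f t) ?inE ?orbT.
pose b' x : subft Us := exist _ (s (b x)) (bP x).
pose c' x : subft Us := exist _ (t x) (tP x).
exists (subft Us), (@inc _ _), b', c'; split=> //.
  split; [exact: inj_comp | exact: inc_inj | move=> i].
  case: (st i) => [[x <-]|[x <-]]; last by right; exists (c' x).
  case: (ab x) => [[y <-]|[y <-]]; first by left; exists y.
  by right; exists (b' y).
split=> [x y /(congr1 (@inc _ _)) /si /bi //|x y /(congr1 (@inc _ _)) /ti //|].
move=> i; have := incP i; rewrite in_setU => /orP[]/imsetP[x _ e];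
  by [left; exists x; apply: inc_inj | right; exists x; apply: inc_inj].
Qed.

(** Exchanging the two sides of every cover reverses the bracketing, so this is the mirror image of
    [cover2_assoc]. *)
Lemma cover2_assoc' (A B T U I : finType) (i : A -> I) (u : U -> I)
  (b : B -> U) (c : T -> U) : cover2 i u -> cover2 b c ->
  exists (S : finType) (s : S -> I) (a' : A -> S) (b' : B -> S),
    [/\ cover2 s (u \o c), cover2 a' b', forall x, s (a' x) = i x
      & forall x, s (b' x) = u (b x)].
Proof.
move=> /cover2_sym iu /cover2_sym bc.
have [S [s [b' [a' [H H' e e']]]]] := cover2_assoc iu bc.
by exists S, s, a', b'; split=> //; apply: cover2_sym.
Qed.

Lemma cov_eq (I A B : finType) (c c' : cov I)
  (f : bij A (covl c)) (g : bij B (covr c)) (f' : bij A (covl c'))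
  (g' : bij B (covr c')) :
  (forall x, linc (f x) = linc (f' x)) ->
  (forall x, rinc (g x) = rinc (g' x)) -> c = c'.
Proof.
move=> fE gE.
have im (S S' : {set I}) (X : finType) (h : bij X (subft S))
    (h' : bij X (subft S')) : (forall x, inc (h x) = inc (h' x)) -> S = S'.
  have [h0 hK h0K] := bij_bij h; have [h0' hK' h0K'] := bij_bij h'.
  move=> hE; apply/setP => i; apply/idP/idP => /inc_onto[z <-].
    by rewrite -(h0K z) hE incP.
  by rewrite -(h0K' z) -hE incP.
apply: val_inj; rewrite [LHS]surjective_pairing [RHS]surjective_pairing.
by congr pair; [apply: im fE | apply: im gE].
Qed.

(** [h] restricts to a bijection from the preimage of [S] onto [S]; this describes the blocks of
    [precov h c]. *)
Lemma preim_bij (I J X : finType) (h : bij I J) (S : {set J})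
  (f : bij X (subft S)) (a : X -> I) :
  injective a -> (forall x, h (a x) = inc (f x)) ->
  exists f' : bij X (subft (h @^-1: S)), forall x, inc (f' x) = a x.
Proof.
move=> ai hE; have [f1 f0K fK0] := bij_bij f.
have hi := bij_inj (bij_bij h).
apply: (lift_bij ai (@inc_inj _ _)) => i; split=> [[z <-]|[z <-]].
  by apply: inc_onto; rewrite inE hE incP.
have := incP z; rewrite inE => /inc_onto[w we].
by exists (f1 w); apply: hi; rewrite hE fK0.
Qed.

(** The witness is chosen, but the cover is determined by the images of [a] and [b] ([cov_eq]). *)
Definition cov_of (A B I : finType) (a : A -> I) (b : B -> I)
  (H : cover2 a b) : cov I := projT1 (cid (cover2_to_cov H)).

Lemma cov_ofP (A B I : finType) (a : A -> I) (b : B -> I) (H : cover2 a b) :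
  (exists f : bij A (covl (cov_of H)), forall x, linc (f x) = a x) /\
  (exists g : bij B (covr (cov_of H)), forall x, rinc (g x) = b x).
Proof. exact: (projT2 (cid (cover2_to_cov H))). Qed.

Definition cov_ofl (A B I : finType) (a : A -> I) (b : B -> I)
  (H : cover2 a b) : bij A (covl (cov_of H)) :=
  projT1 (cid (proj1 (cov_ofP H))).

Definition cov_ofr (A B I : finType) (a : A -> I) (b : B -> I)
  (H : cover2 a b) : bij B (covr (cov_of H)) :=
  projT1 (cid (proj2 (cov_ofP H))).

Lemma cov_oflE (A B I : finType) (a : A -> I) (b : B -> I) (H : cover2 a b) x :
  linc (cov_ofl H x) = a x.
Proof. exact: (projT2 (cid (proj1 (cov_ofP H)))). Qed.

Lemma cov_ofrE (A B I : finType) (a : A -> I) (b : B -> I) (H : cover2 a b) x :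
  rinc (cov_ofr H x) = b x.
Proof. exact: (projT2 (cid (proj2 (cov_ofP H)))). Qed.

(** * Pure tensors along covers: invariance, spanning and multilinear lifts *)

Section Gpure.
Variable k : fieldType.

Lemma dinj_lin (I : finType) (V : I -> vectType k) i :
  linear (@dinj k I V i).
Proof.
move=> l u v; apply: dsumP => d; rewrite dproj_lin.
have [<-|cd] := eqVneq i d; first by rewrite !dproj_dinj.
by rewrite !dproj_dinj_neq // scaler0 add0r.
Qed.

Lemma dproj_sum (I J : finType) (V : I -> vectType k) i (F : J -> dsum V) :
  dproj i (\sum_j F j) = \sum_j dproj i (F j).
Proof.
rewrite -(linfunE (@dproj_lin k _ V i)) linear_sum; apply: eq_bigr => j _ /=.
exact: (linfunE (@dproj_lin k _ V i)).
Qed.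

Lemma dsum_decomp (I : finType) (V : I -> vectType k) (x : dsum V) :
  x = \sum_i dinj (dproj i x).
Proof.
apply: dsumP => d; rewrite dproj_sum (bigD1 d) //= dproj_dinj big1 ?addr0 //.
by move=> i id; rewrite dproj_dinj_neq.
Qed.

Lemma sp_mapK (p : Sp k) (I J : finType) (f : bij I J) (g : bij J I) x :
  cancel f g -> sp_map p g (sp_map p f x) = x.
Proof.
move=> fK; rewrite -comp_lfunE -sp_map_comp -[RHS]id_lfunE -sp_map_id.
by congr (sp_map p _ _); apply: bij_eq => i /=; rewrite fK.
Qed.

Lemma sp_map_natE (p q : Sp k) (a : hom p q) (I J : finType) (f : bij I J) x :
  sp_hom a J (sp_map p f x) = sp_map q f (sp_hom a I x).
Proof. by rewrite -!comp_lfunE sp_hom_nat. Qed.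

Lemma sp_map_compE (p : Sp k) (I J K : finType) (g : bij J K) (f : bij I J) x :
  sp_map p g (sp_map p f x) = sp_map p (bij_comp g f) x.
Proof. by rewrite -comp_lfunE -sp_map_comp. Qed.

Lemma sp_map_idE (p : Sp k) (I : finType) (f : bij I I) x :
  (forall i, f i = i) -> sp_map p f x = x.
Proof.
move=> fE; rewrite -[RHS]id_lfunE -sp_map_id; congr (sp_map p _ _).
exact: bij_eq.
Qed.

Lemma eq_sp_map (p : Sp k) (I J : finType) (f g : bij I J) x :
  f =1 g -> sp_map p f x = sp_map p g x.
Proof. by move=> /bij_eq ->. Qed.

Section TwoSpecies.
Variables p q : Sp k.

(* [pure] for arbitrary finite sets [A], [B] injected in [I] rather than for
   subsets of [I]: this removes all nested subset types below.                *)
Definition gpure (A B I : finType) (a : A -> I) (b : B -> I) (H : cover2 a b)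
  (x : sp_ob p A) (y : sp_ob q B) : sp_ob (heis_sp p q) I :=
  @heis_pure k p q I (cov_of H) (sp_map p (cov_ofl H) x) (sp_map q (cov_ofr H) y).

Lemma gpureE (A B I : finType) (a : A -> I) (b : B -> I) (H : cover2 a b)
  x y (c : cov I) (f : bij A (covl c)) (g : bij B (covr c)) :
  (forall x, linc (f x) = a x) -> (forall x, rinc (g x) = b x) ->
  gpure H x y = @heis_pure k p q I c (sp_map p f x) (sp_map q g y).
Proof.
move=> fE gE; have e : cov_of H = c.
  by apply: (@cov_eq I A B _ _ (cov_ofl H) (cov_ofr H) f g) => z;
    rewrite ?cov_oflE ?fE ?cov_ofrE ?gE.
rewrite /gpure; move: (cov_ofl H) (cov_ofr H) (cov_oflE H) (cov_ofrE H).
(* The equality of covers is eliminated before the bijections are compared, since their types depend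
   on the cover. *)
case: _ / e f g fE gE => f g fE gE f' g' f'E g'E.
congr (@heis_pure k p q I _); apply: eq_sp_map => z.
  by apply: linc_inj; rewrite f'E fE.
by apply: rinc_inj; rewrite g'E gE.
Qed.

Lemma gpure_cov (I : finType) (c : cov I) x y :
  @heis_pure k p q I c x y = gpure (cover2_cov c) x y.
Proof.
have ex : sp_map p (bij_id (covl c)) x = x by apply: sp_map_idE.
have ey : sp_map q (bij_id (covr c)) y = y by apply: sp_map_idE.
have := @gpureE _ _ _ _ _ (cover2_cov c) x y c (bij_id _) (bij_id _).
by rewrite ex ey => ->.
Qed.

Lemma gpure_bij (A B A' B' I : finType) (a : A -> I) (b : B -> I)
  (a' : A' -> I) (b' : B' -> I) (H : cover2 a b) (H' : cover2 a' b')
  (f : bij A A') (g : bij B B') x y :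
  (forall x, a' (f x) = a x) -> (forall x, b' (g x) = b x) ->
  gpure H' (sp_map p f x) (sp_map q g y) = gpure H x y.
Proof.
move=> fE gE; have [c [[f' fE'] [g' gE']]] := cover2_to_cov H'.
rewrite (gpureE _ _ _ fE' gE') !sp_map_compE.
rewrite (@gpureE _ _ _ a b H x y c (bij_comp f' f) (bij_comp g' g)) // => z.
  exact: etrans (fE' _) (fE z).
exact: etrans (gE' _) (gE z).
Qed.

Lemma eq_gpure (A B I : finType) (a : A -> I) (b : B -> I)
  (a' : A -> I) (b' : B -> I) (H : cover2 a b) (H' : cover2 a' b') x y :
  a =1 a' -> b =1 b' -> gpure H x y = gpure H' x y.
Proof.
move=> ea eb.
have ex : sp_map p (bij_id A) x = x by apply: sp_map_idE.
have ey : sp_map q (bij_id B) y = y by apply: sp_map_idE.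
have := @gpure_bij _ _ _ _ _ _ _ _ _ H H' (bij_id A) (bij_id B) x y.
by rewrite ex ey => -> // z; rewrite ?ea ?eb.
Qed.

Lemma gpure_mapl (A B A' I : finType) (a : A -> I) (b : B -> I)
  (a' : A' -> I) (H : cover2 a b) (H' : cover2 a' b) (f : bij A A') x y :
  (forall x, a' (f x) = a x) -> gpure H' (sp_map p f x) y = gpure H x y.
Proof.
move=> fE.
have ey : sp_map q (bij_id B) y = y by apply: sp_map_idE.
have := @gpure_bij _ _ _ _ _ _ _ _ _ H H' f (bij_id B) x y fE.
by rewrite ey => ->.
Qed.

Lemma gpure_mapr (A B B' I : finType) (a : A -> I) (b : B -> I)
  (b' : B' -> I) (H : cover2 a b) (H' : cover2 a b') (f : bij B B') x y :
  (forall x, b' (f x) = b x) -> gpure H' x (sp_map q f y) = gpure H x y.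
Proof.
move=> fE.
have ex : sp_map p (bij_id A) x = x by apply: sp_map_idE.
have := @gpure_bij _ _ _ _ _ _ _ _ _ H H' (bij_id A) f x y.
by rewrite ex => ->.
Qed.

Lemma heis_pure_linl (I : finType) (c : cov I) y :
  linear (fun x => @heis_pure k p q I c x y).
Proof.
move=> l u v; apply: dsumP => d; rewrite dproj_lin /heis_pure.
have [<-|cd] := eqVneq c d; last by rewrite !dproj_dinj_neq // scaler0 add0r.
by rewrite !dproj_dinj pureDl.
Qed.

Lemma heis_pure_linr (I : finType) (c : cov I) x :
  linear (@heis_pure k p q I c x).
Proof.
move=> l u v; apply: dsumP => d; rewrite dproj_lin /heis_pure.
have [<-|cd] := eqVneq c d; last by rewrite !dproj_dinj_neq // scaler0 add0r.
by rewrite !dproj_dinj pureDr.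
Qed.

Lemma gpure_linl (A B I : finType) (a : A -> I) (b : B -> I) (H : cover2 a b)
  y : linear (fun x => gpure H x y).
Proof. by move=> l u v; rewrite /gpure linearP heis_pure_linl. Qed.

Lemma gpure_linr (A B I : finType) (a : A -> I) (b : B -> I) (H : cover2 a b)
  x : linear (gpure H x).
Proof. by move=> l u v; rewrite /gpure linearP heis_pure_linr. Qed.

Lemma gpure_map (A B I J : finType) (a : A -> I) (b : B -> I) (a' : A -> J)
  (b' : B -> J) (H : cover2 a b) (H' : cover2 a' b') (h : bij I J) x y :
  (forall x, h (a x) = a' x) -> (forall x, h (b x) = b' x) ->
  sp_map (heis_sp p q) h (gpure H x y) = gpure H' x y.
Proof.
move=> aE bE; have [c [[f fE] [g gE]]] := cover2_to_cov H'.
have [ai bi _] := H.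
have [f' fE'] : exists f' : bij A (covl (precov h c)), forall x, linc (f' x) = a x.
  by apply: (preim_bij (f := f)) => // z; rewrite aE; apply/esym/fE.
have [g' gE'] : exists g' : bij B (covr (precov h c)), forall x, rinc (g' x) = b x.
  by apply: (preim_bij (f := g)) => // z; rewrite bE; apply/esym/gE.
rewrite (gpureE _ _ _ fE gE) (gpureE _ _ _ fE' gE').
apply: dsumP => d; rewrite [LHS]heis_sp_mapE /heis_pure.
(* [precov h] is injective because [h] is onto, so both sides vanish on every summand other than
   [c]. *)
have [<-|cd] := eqVneq c d; last first.
  rewrite [RHS]dproj_dinj_neq // dproj_dinj_neq ?linear0 //.
  apply: contra cd => /eqP /(congr1 val) [] e1 e2; apply/eqP/val_inj.
  have [h0 hK h0K] := bij_bij h.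
  rewrite [LHS]surjective_pairing [RHS]surjective_pairing; congr pair.
    apply/setP => j; move/setP/(_ (h0 j)): e1; by rewrite !inE h0K.
  apply/setP => j; move/setP/(_ (h0 j)): e2; by rewrite !inE h0K.
rewrite !dproj_dinj tmap_pure !sp_map_compE; congr pure;
  apply: eq_sp_map => z.
  by apply: linc_inj; rewrite [RHS]fE -aE -fE'.
by apply: rinc_inj; rewrite [RHS]gE -bE -gE'.
Qed.

(** Each vector is the sum of its components, and each summand is spanned by pure tensors. *)
Lemma heis_ext (W : vectType k) (I : finType)
  (f g : 'Hom(sp_ob (heis_sp p q) I, W)) :
  (forall (A B : finType) (a : A -> I) (b : B -> I) (H : cover2 a b) x y,
     f (gpure H x y) = g (gpure H x y)) -> f = g.
Proof.
move=> e; apply/lfunP => w.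
rewrite (dsum_decomp (w : dsum (@heis_summand k p q I))) !linear_sum.
apply: eq_bigr => c _ /=; move: (dproj c w) => t.
have lin (h : 'Hom(sp_ob (heis_sp p q) I, W)) :
    linear (fun t => h (@dinj k (cov I) (@heis_summand k p q I) c t)).
  by move=> l u v; rewrite dinj_lin linearP.
rewrite -(linfunE (lin f)) -(linfunE (lin g)); congr (fun_of_lfun _ t).
apply: tens_ext => x y; rewrite !linfunE //.
by have := e _ _ _ _ (cover2_cov c) x y; rewrite -gpure_cov.
Qed.

Lemma heis_lift (W : vectType k) (I : finType)
  (B : forall c : cov I, sp_ob p (covl c) -> sp_ob q (covr c) -> W) :
  (forall c y, linear (fun x => B c x y)) -> (forall c x, linear (B c x)) ->
  exists f : 'Hom(sp_ob (heis_sp p q) I, W),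
    forall c x y, f (heis_pure x y) = B c x y.
Proof.
move=> Bl Br.
pose L c := projT1 (cid (tens_lift (Bl c) (Br c))).
have LE c x y : L c (pure x y) = B c x y by rewrite /L; case: cid.
exists (\sum_c (L c \o linfun (@dproj k (cov I) (@heis_summand _ p q I) c))%VF).
move=> c x y; rewrite sum_lfunE (bigD1 c) //= comp_lfunE.
rewrite linfunE ?dproj_dinj ?LE; last exact: dproj_lin.
rewrite big1 ?addr0 // => d dc; rewrite comp_lfunE linfunE; last exact: dproj_lin.
by rewrite dproj_dinj_neq ?linear0 // eq_sym.
Qed.

End TwoSpecies.

Lemma gpure_hom (p p' q q' : Sp k) (f : hom p p') (g : hom q q')
  (A B I : finType) (a : A -> I) (b : B -> I) (H : cover2 a b) x y :
  sp_hom (heis_sp_hom f g) I (gpure H x y) =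
  gpure H (sp_hom f A x) (sp_hom g B y).
Proof.
rewrite /gpure -!sp_map_natE.
move: (cov_of H) (sp_map p _ x) (sp_map q _ y) => c {}x {}y.
apply: dsumP => d; rewrite [LHS]dproj_map /heis_pure.
have [<-|cd] := eqVneq c d; last by rewrite !dproj_dinj_neq // linear0.
by rewrite !dproj_dinj tmap_pure.
Qed.

Lemma heis_ext3l (p q r : Sp k) (W : vectType k) (I : finType)
  (f g : 'Hom(sp_ob (heis_sp (heis_sp p q) r) I, W)) :
  (forall (A B S T : finType) (s : S -> I) (t : T -> I) (a : A -> S)
      (b : B -> S) (H : cover2 s t) (H' : cover2 a b) x y z,
     f (gpure H (gpure (p := p) (q := q) H' x y) z) = g (gpure H (gpure H' x y) z)) ->
  f = g.
Proof.
move=> e; apply: heis_ext => S T s t H w z.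
have lin (h : 'Hom(sp_ob (heis_sp (heis_sp p q) r) I, W)) :
    linear (fun w => h (gpure H w z)).
  by move=> l u v; rewrite gpure_linl linearP.
rewrite -(linfunE (lin f)) -(linfunE (lin g)); congr (fun_of_lfun _ w).
by apply: heis_ext => A B a b H' x y; rewrite !linfunE.
Qed.

Lemma heis_ext3r (p q r : Sp k) (W : vectType k) (I : finType)
  (f g : 'Hom(sp_ob (heis_sp p (heis_sp q r)) I, W)) :
  (forall (A B T U : finType) (i : A -> I) (u : U -> I) (b : B -> U)
      (c : T -> U) (H : cover2 i u) (H' : cover2 b c) x y z,
     f (gpure H x (gpure (p := q) (q := r) H' y z)) = g (gpure H x (gpure H' y z))) ->
  f = g.
Proof.
move=> e; apply: heis_ext => A U i u H x w.
have lin (h : 'Hom(sp_ob (heis_sp p (heis_sp q r)) I, W)) :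
    linear (fun w => h (gpure H x w)).
  by move=> l v v'; rewrite gpure_linr linearP.
rewrite -(linfunE (lin f)) -(linfunE (lin g)); congr (fun_of_lfun _ w).
by apply: heis_ext => B T b c H' y z; rewrite !linfunE.
Qed.

Section Lift3.
Variables (p q r : Sp k) (W : vectType k) (I : finType).

(** [P] carries a specification of the trilinear map on each summand through the choice of these
    maps. For fixed z the inner product is lifted; the resulting linear map depends linearly on z
    and is lifted again. *)
Lemma heis_lift3l (P : forall (st : cov I) (ab : cov (covl st)),
    (sp_ob p (covl ab) -> sp_ob q (covr ab) -> sp_ob r (covr st) -> W) -> Prop) :
  (forall st ab, exists B, [/\ forall y z, linear (fun x => B x y z),
     forall x z, linear (fun y => B x y z), forall x y, linear (B x y)
     & P st ab B]) ->
  exists f : 'Hom(sp_ob (heis_sp (heis_sp p q) r) I, W),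
    forall st ab, P st ab (fun x y z =>
      f (@heis_pure k (heis_sp p q) r I st (@heis_pure k p q _ ab x y) z)).
Proof.
move=> exB; pose B st ab := projT1 (cid (exB st ab)).
have BP st ab : [/\ forall y z, linear (fun x => B st ab x y z),
     forall x z, linear (fun y => B st ab x y z),
     forall x y, linear (B st ab x y) & P st ab (B st ab)].
  by rewrite /B; case: cid.
clearbody B.
have ex st z : exists f : 'Hom(sp_ob (heis_sp p q) (covl st), W),
    forall ab x y, f (heis_pure x y) = B st ab x y z.
  by apply: (heis_lift (B := fun ab x y => B st ab x y z)) => ab;
    have [] := BP st ab.
pose L st z := projT1 (cid (ex st z)).
have LE st z ab x y : L st z (heis_pure x y) = B st ab x y z.
  by rewrite /L; case: cid.
have Ll st : linear (L st).
  move=> l u v; apply: heis_ext => A B' a b H x y.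
  have [c [[f fE] [g gE]]] := cover2_to_cov H.
  rewrite (gpureE _ _ _ fE gE) lfunE /= lfunE /= !LE.
  by have [_ _ ->] := BP st c.
have lin1 st z : linear (fun w => L st z w) by move=> l u v; rewrite linearP.
have lin2 st w : linear (fun z => L st z w).
  by move=> l u v; rewrite Ll lfunE /= lfunE.
have [f fE] := heis_lift lin1 lin2; exists f => st ab.
have [_ _ _] := BP st ab; congr P; do 3!apply: functional_extensionality_dep => ?.
by rewrite fE LE.
Qed.

Lemma heis_lift3r (P : forall (au : cov I) (bt : cov (covr au)),
    (sp_ob p (covl au) -> sp_ob q (covl bt) -> sp_ob r (covr bt) -> W) -> Prop) :
  (forall au bt, exists B, [/\ forall y z, linear (fun x => B x y z),
     forall x z, linear (fun y => B x y z), forall x y, linear (B x y)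
     & P au bt B]) ->
  exists f : 'Hom(sp_ob (heis_sp p (heis_sp q r)) I, W),
    forall au bt, P au bt (fun x y z =>
      f (@heis_pure k p (heis_sp q r) I au x (@heis_pure k q r _ bt y z))).
Proof.
move=> exB; pose B au bt := projT1 (cid (exB au bt)).
have BP au bt : [/\ forall y z, linear (fun x => B au bt x y z),
     forall x z, linear (fun y => B au bt x y z),
     forall x y, linear (B au bt x y) & P au bt (B au bt)].
  by rewrite /B; case: cid.
clearbody B.
have ex au x : exists f : 'Hom(sp_ob (heis_sp q r) (covr au), W),
    forall bt y z, f (heis_pure y z) = B au bt x y z.
  by apply: (heis_lift (B := fun bt y z => B au bt x y z)) => bt;
    have [] := BP au bt.
pose L au x := projT1 (cid (ex au x)).
have LE au x bt y z : L au x (heis_pure y z) = B au bt x y z.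
  by rewrite /L; case: cid.
have Ll au : linear (L au).
  move=> l u v; apply: heis_ext => A B' a b H y z.
  have [c [[f fE] [g gE]]] := cover2_to_cov H.
  rewrite (gpureE _ _ _ fE gE) lfunE /= lfunE /= !LE.
  by have [->] := BP au c.
have lin1 au w : linear (fun x => L au x w).
  by move=> l u v; rewrite Ll lfunE /= lfunE.
have lin2 au x : linear (fun w => L au x w) by move=> l u v; rewrite linearP.
have [f fE] := heis_lift lin1 lin2; exists f => au bt.
have [_ _ _] := BP au bt; congr P; do 3!apply: functional_extensionality_dep => ?.
by rewrite fE LE.
Qed.

End Lift3.

End Gpure.

(** * The monoidal structure on species *)

Section SpMonoidal.
Variable k : fieldType.

(** The two nested covers, with intermediate sets S and U, induce the same three maps from A, B and
    T to I. *)
Definition rebracket (A B T S U I : finType) (s : S -> I) (t : T -> I)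
  (a : A -> S) (b : B -> S) (i : A -> I) (u : U -> I) (b' : B -> U)
  (c : T -> U) : Prop :=
  [/\ forall x, s (a x) = i x, forall x, s (b x) = u (b' x)
    & forall x, t x = u (c x)].

Section Congruence.
Variables p q r : Sp k.
Variables (A B T A' B' T' I : finType).
Variables (f : bij A A') (g : bij B B') (h : bij T T').

(** The image of the intermediate set in I is the union of the images of its two blocks, so two
    choices S and S' are identified compatibly with their maps to I. *)
Lemma gpure3l_bij (S S' : finType) (s : S -> I) (t : T -> I) (a : A -> S)
  (b : B -> S) (s' : S' -> I) (t' : T' -> I) (a' : A' -> S') (b' : B' -> S')
  (H : cover2 s t) (K : cover2 a b) (H' : cover2 s' t') (K' : cover2 a' b')
  (x : sp_ob p A) (y : sp_ob q B) (z : sp_ob r T) :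
  (forall x, s' (a' (f x)) = s (a x)) -> (forall x, s' (b' (g x)) = s (b x)) ->
  (forall x, t' (h x) = t x) ->
  gpure H' (gpure K' (sp_map p f x) (sp_map q g y)) (sp_map r h z) =
  gpure H (gpure K x y) z.
Proof.
move=> fE gE hE; have [si ti _] := H; have [si' ti' _] := H'.
have [_ _ ab] := K; have [_ _ ab'] := K'.
have [f0 fK f0K] := bij_bij f; have [g0 gK g0K] := bij_bij g.
have [v vE] : exists v : bij S S', forall x, s' (v x) = s x.
  apply: (lift_bij si si') => i; split=> -[w <-].
    by case: (ab w) => -[w' <-]; [exists (a' (f w')) | exists (b' (g w'))].
  case: (ab' w) => -[w' <-]; [exists (a (f0 w')) | exists (b (g0 w'))].
    by rewrite -fE f0K.
  by rewrite -gE g0K.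
have KK := cover2_bij v K.
rewrite -(gpure_bij H H' _ z vE hE) (gpure_map K KK) //; congr gpure.
by apply: gpure_bij => w; apply: si'; rewrite ?fE ?gE /= vE.
Qed.

Lemma gpure3r_bij (U U' : finType) (i : A -> I) (u : U -> I) (b : B -> U)
  (c : T -> U) (i' : A' -> I) (u' : U' -> I) (b' : B' -> U') (c' : T' -> U')
  (H : cover2 i u) (K : cover2 b c) (H' : cover2 i' u') (K' : cover2 b' c')
  (x : sp_ob p A) (y : sp_ob q B) (z : sp_ob r T) :
  (forall x, i' (f x) = i x) -> (forall x, u' (b' (g x)) = u (b x)) ->
  (forall x, u' (c' (h x)) = u (c x)) ->
  gpure H' (sp_map p f x) (gpure K' (sp_map q g y) (sp_map r h z)) =
  gpure H x (gpure K y z).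
Proof.
move=> fE gE hE; have [_ ui _] := H; have [_ ui' _] := H'.
have [_ _ bc] := K; have [_ _ bc'] := K'.
have [h0 hK h0K] := bij_bij h; have [g0 gK g0K] := bij_bij g.
have [v vE] : exists v : bij U U', forall x, u' (v x) = u x.
  apply: (lift_bij ui ui') => j; split=> -[w <-].
    by case: (bc w) => -[w' <-]; [exists (b' (g w')) | exists (c' (h w'))].
  case: (bc' w) => -[w' <-]; [exists (b (g0 w')) | exists (c (h0 w'))].
    by rewrite -gE g0K.
  by rewrite -hE h0K.
have KK := cover2_bij v K.
rewrite -(gpure_bij H H' x _ fE vE) (gpure_map K KK) //; congr gpure.
by apply: gpure_bij => w; apply: ui'; rewrite ?hE ?gE /= vE.
Qed.

End Congruence.

Section Associator.
Variables p q r : Sp k.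

Local Notation L := (heis_sp (heis_sp p q) r).
Local Notation R := (heis_sp p (heis_sp q r)).

(** Quantifying over all presentations of both bracketings, not only over subsets, makes naturality
    and the inverse laws direct instances of the specification. *)
Definition assocl_spec (I : finType) (f : 'Hom(sp_ob L I, sp_ob R I)) : Prop :=
  forall (A B T S U : finType) (s : S -> I) (t : T -> I) (a : A -> S)
    (b : B -> S) (i : A -> I) (u : U -> I) (b' : B -> U) (c : T -> U)
    (H : cover2 s t) (K : cover2 a b) (H' : cover2 i u) (K' : cover2 b' c),
  rebracket s t a b i u b' c -> forall x y z,
  f (gpure H (gpure K x y) z) = gpure H' x (gpure K' y z).

Definition assocr_spec (I : finType) (f : 'Hom(sp_ob R I, sp_ob L I)) : Prop :=
  forall (A B T S U : finType) (s : S -> I) (t : T -> I) (a : A -> S)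
    (b : B -> S) (i : A -> I) (u : U -> I) (b' : B -> U) (c : T -> U)
    (H : cover2 s t) (K : cover2 a b) (H' : cover2 i u) (K' : cover2 b' c),
  rebracket s t a b i u b' c -> forall x y z,
  f (gpure H' x (gpure K' y z)) = gpure H (gpure K x y) z.

Lemma gpure3r_eq (A B T U U' I : finType) (i : A -> I) (u : U -> I)
  (b : B -> U) (c : T -> U) (i' : A -> I) (u' : U' -> I) (b' : B -> U')
  (c' : T -> U') (H : cover2 i u) (K : cover2 b c) (H' : cover2 i' u')
  (K' : cover2 b' c') (x : sp_ob p A) (y : sp_ob q B) (z : sp_ob r T) :
  (forall x, i' x = i x) -> (forall x, u' (b' x) = u (b x)) ->
  (forall x, u' (c' x) = u (c x)) ->
  gpure H' x (gpure K' y z) = gpure H x (gpure K y z).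
Proof.
move=> e e' e''.
have := @gpure3r_bij p q r _ _ _ _ _ _ I (bij_id A) (bij_id B) (bij_id T) _ _
  _ _ _ _ _ _ _ _ H K H' K' x y z e e' e''.
by rewrite !(@sp_map_idE _ _ _ (bij_id _)).
Qed.

Lemma gpure3l_eq (A B T S S' I : finType) (s : S -> I) (t : T -> I)
  (a : A -> S) (b : B -> S) (s' : S' -> I) (t' : T -> I) (a' : A -> S')
  (b' : B -> S') (H : cover2 s t) (K : cover2 a b) (H' : cover2 s' t')
  (K' : cover2 a' b') (x : sp_ob p A) (y : sp_ob q B) (z : sp_ob r T) :
  (forall x, s' (a' x) = s (a x)) -> (forall x, s' (b' x) = s (b x)) ->
  (forall x, t' x = t x) ->
  gpure H' (gpure K' x y) z = gpure H (gpure K x y) z.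
Proof.
move=> e e' e''.
have := @gpure3l_bij p q r _ _ _ _ _ _ I (bij_id A) (bij_id B) (bij_id T) _ _
  _ _ _ _ _ _ _ _ H K H' K' x y z e e' e''.
by rewrite !(@sp_map_idE _ _ _ (bij_id _)).
Qed.

Lemma assocl_exists (I : finType) : exists f, @assocl_spec I f.
Proof.
pose P (st : cov I) (ab : cov (covl st)) (B : sp_ob p (covl ab) ->
    sp_ob q (covr ab) -> sp_ob r (covr st) -> sp_ob R I) :=
  forall (U : finType) i (u : U -> I) b c (H : cover2 i u) (K : cover2 b c),
  rebracket (@linc _ st) (@rinc _ st) (@linc _ ab) (@rinc _ ab) i u b c ->
  forall x y z, B x y z = gpure H x (gpure K y z).
have [st ab|f fE] := @heis_lift3l k p q r (sp_ob R I) I P.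
  (* The value does not depend on this choice of [U], by [gpure3r_eq]. *)
  have [U [u [b [c [H K bE cE]]]]] := cover2_assoc (cover2_cov st) (cover2_cov ab).
  exists (fun x y z => gpure H x (gpure K y z)); split.
  - by move=> y z; apply: gpure_linl.
  - by move=> x z l v w; rewrite gpure_linl gpure_linr.
  - by move=> x y l v w; rewrite gpure_linr gpure_linr.
  move=> U' i u' b' c' H' K' [e1 e2 e3] x y z.
  by apply: gpure3r_eq => w; rewrite ?bE ?cE; [apply: e1|apply: e2|apply: e3].
exists f => A B' T S U s t a b i u b' c H K H' K' [e1 e2 e3] x y z.
(* The given nested cover is replaced by the nested subsets with the same images, where [fE]
   applies; [gpure3r_bij] undoes the relabelling. *)
have [st [[sf sfE] [tf tfE]]] := cover2_to_cov H.
rewrite (gpureE _ _ _ sfE tfE) (gpure_map K (cover2_bij sf K)) //.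
have [ab [[af afE] [bf bfE]]] := cover2_to_cov (cover2_bij sf K).
rewrite (gpureE _ _ _ afE bfE).
have [U' [u' [b0 [c0 [H0 K0 bE cE]]]]] :=
  cover2_assoc (cover2_cov st) (cover2_cov ab).
rewrite (fE st ab _ _ _ _ _ H0 K0); last by split.
apply: gpure3r_bij => w.
+ by rewrite /= afE /= sfE e1.
+ by rewrite bE bfE /= sfE e2.
+ by rewrite cE tfE e3.
Qed.

Lemma assocr_exists (I : finType) : exists f, @assocr_spec I f.
Proof.
pose P (au : cov I) (bt : cov (covr au)) (B : sp_ob p (covl au) ->
    sp_ob q (covl bt) -> sp_ob r (covr bt) -> sp_ob L I) :=
  forall (S : finType) (s : S -> I) t a b (H : cover2 s t) (K : cover2 a b),
  rebracket s t a b (@linc _ au) (@rinc _ au) (@linc _ bt) (@rinc _ bt) ->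
  forall x y z, B x y z = gpure H (gpure K x y) z.
have [au bt|f fE] := @heis_lift3r k p q r (sp_ob L I) I P.
  have [S [s [a [b [H K aE bE]]]]] := cover2_assoc' (cover2_cov au) (cover2_cov bt).
  exists (fun x y z => gpure H (gpure K x y) z); split.
  - by move=> y z l v w; rewrite gpure_linl gpure_linl.
  - by move=> x z l v w; rewrite gpure_linr gpure_linl.
  - by move=> x y; apply: gpure_linr.
  move=> S' s' t' a' b' H' K' [e1 e2 e3] x y z.
  by apply: gpure3l_eq => w; rewrite ?aE ?bE; [apply: esym; apply: e1
    |apply: esym; apply: e2|apply: esym; apply: e3].
exists f => A B' T S U s t a b i u b' c H K H' K' [e1 e2 e3] x y z.
have [au [[af afE] [uf ufE]]] := cover2_to_cov H'.
rewrite (gpureE _ _ _ afE ufE) (gpure_map K' (cover2_bij uf K')) //.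
have [bt [[bf bfE] [tf tfE]]] := cover2_to_cov (cover2_bij uf K').
rewrite (gpureE _ _ _ bfE tfE).
have [S' [s' [a0 [b0 [H0 K0 aE bE]]]]] :=
  cover2_assoc' (cover2_cov au) (cover2_cov bt).
rewrite (fE au bt _ _ _ _ _ H0 K0); last by split.
apply: gpure3l_bij => w.
+ by rewrite aE afE e1.
+ by rewrite bE bfE /= ufE e2.
+ by rewrite /= tfE /= ufE e3.
Qed.

End Associator.

End SpMonoidal.

(** * The unit species and the constraint isomorphisms *)

Section SpUnitors.
Variable k : fieldType.

Lemma gpure0l (p q : Sp k) (A B I : finType) (a : A -> I) (b : B -> I)
  (H : cover2 a b) (y : sp_ob q B) : gpure (p := p) H 0 y = 0.
Proof.
(* Linearity with scalar -1 at two zero vectors reads as a cancellation. *)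
have := gpure_linl (p := p) H y (-1) 0 0.
by rewrite scaler0 addr0 scaleN1r addNr.
Qed.

Lemma gpureZl (p q : Sp k) (A B I : finType) (a : A -> I) (b : B -> I)
  (H : cover2 a b) l (x : sp_ob p A) (y : sp_ob q B) :
  gpure H (l *: x) y = l *: gpure H x y.
Proof. by have := gpure_linl H y l x 0; rewrite addr0 gpure0l addr0. Qed.

Lemma gpure0r (p q : Sp k) (A B I : finType) (a : A -> I) (b : B -> I)
  (H : cover2 a b) (x : sp_ob p A) : gpure (q := q) H x 0 = 0.
Proof.
have := gpure_linr (q := q) H x (-1) 0 0.
by rewrite scaler0 addr0 scaleN1r addNr.
Qed.

Lemma gpureZr (p q : Sp k) (A B I : finType) (a : A -> I) (b : B -> I)
  (H : cover2 a b) l (x : sp_ob p A) (y : sp_ob q B) :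
  gpure H x (l *: y) = l *: gpure H x y.
Proof. by have := gpure_linr H x l y 0; rewrite addr0 gpure0r addr0. Qed.

Lemma oneSp_val_inj (I : finType) : injective (@oneSp_val k I).
Proof.
rewrite /oneSp_val /sp_ob /=; case: (is_empty I) => c c' /=.
  by rewrite !id_lfunE.
by move=> _; apply/rowP => -[].
Qed.

Lemma oneSp_val0 (I : finType) (c : sp_ob (oneSp k) I) :
  ~~ is_empty I -> oneSp_val c = 0.
Proof.
rewrite /oneSp_val; move: c; rewrite /sp_ob /=; case: (is_empty I) => //= c _.
by rewrite lfunE.
Qed.

Lemma oneSp_eq0 (I : finType) (c : sp_ob (oneSp k) I) : ~~ is_empty I -> c = 0.
Proof.
move=> I0; apply: oneSp_val_inj; rewrite oneSp_val0 //.
by rewrite /oneSp_val linear0.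
Qed.

Lemma oneSp_val_map (I J : finType) (f : bij I J) (c : sp_ob (oneSp k) I) :
  oneSp_val (sp_map (oneSp k) f c) = oneSp_val c.
Proof.
rewrite /oneSp_val /sp_map /=; move: c; rewrite /sp_ob /= -(is_empty_bij f).
by case: (is_empty I) => c /=; rewrite ?id_lfunE // !lfunE.
Qed.

Lemma oneSp_valZ (I : finType) l (c : sp_ob (oneSp k) I) :
  oneSp_val (l *: c) = l * oneSp_val c.
Proof. by rewrite /oneSp_val linearZ. Qed.

Lemma oneSp_unit (I : finType) : is_empty I ->
  exists c : sp_ob (oneSp k) I, oneSp_val c = 1.
Proof.
rewrite /oneSp_val /sp_ob /=; case: (is_empty I) => // _.
by exists 1; rewrite /= id_lfunE.
Qed.

(** An empty first block covers no point, so the injection [b] is onto. *)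
Lemma cover2_empty (A B I : finType) (a : A -> I) (b : B -> I) :
  cover2 a b -> is_empty A -> exists h : bij B I, forall x, h x = b x.
Proof.
move=> [_ bi ab] A0; apply: (lift_bij bi (a' := id)) => // i; split=> _.
  by exists i.
case: (ab i) => // -[x _]; have := max_card (pred1 x).
by rewrite (eqP A0) card1.
Qed.

Lemma void_empty : is_empty void.
Proof. by rewrite /is_empty card_void. Qed.

Lemma cover2_void (I : finType) : cover2 (of_void I) (fun x : I => x).
Proof. by split=> [[]|x y|i] //; right; exists i. Qed.

Lemma empty_bij (A B : finType) : is_empty A -> is_empty B ->
  exists f : bij A B, True.
Proof.
move=> /eqP A0 /eqP B0.
have A0' (x : A) : False by have := max_card (pred1 x); rewrite A0 card1.
have B0' (x : B) : False by have := max_card (pred1 x); rewrite B0 card1.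
have fb : bijective (fun x : A => match A0' x return B with end).
  by exists (fun x : B => match B0' x return A with end) => x;
    [case: (A0' x) | case: (B0' x)].
by exists (Bij fb).
Qed.

Lemma sp_hom_comp (p q r : Sp k) (b : hom q r) (a : hom p q) (I : finType) x :
  sp_hom (b \oc a) I x = sp_hom b I (sp_hom a I x).
Proof. exact: comp_lfunE. Qed.

Lemma sp_hom_id (p : Sp k) (I : finType) x : sp_hom (idm p) I x = x.
Proof. exact: id_lfunE. Qed.

Lemma sp_hom_eq (p q : Sp k) (a b : hom p q) :
  (forall I, sp_hom a I = sp_hom b I) -> a = b.
Proof.
move=> e; apply: (@nattrans_eq finbij_category (vect_category k) p q) => I.
exact: e.
Qed.

Lemma sp_hom_exists (p q : Sp k) (F : forall I, 'Hom(sp_ob p I, sp_ob q I)) :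
  (forall I J (f : bij I J) x, F J (sp_map p f x) = sp_map q f (F I x)) ->
  exists a : hom p q, forall I, sp_hom a I = F I.
Proof.
move=> nat; have nat' I J (f : bij I J) :
    (F J \o sp_map p f = sp_map q f \o F I)%VF.
  apply/lfunP => x; rewrite [LHS]comp_lfunE [RHS]comp_lfunE; exact: nat.
by exists (@Nattrans finbij_category (vect_category k) p q F nat').
Qed.

(** Naturality of a pointwise inverse is automatic. *)
Lemma sp_iso (p q : Sp k) (a : hom p q) (b : forall I, 'Hom(sp_ob q I, sp_ob p I)) :
  (forall I x, b I (sp_hom a I x) = x) -> (forall I y, sp_hom a I (b I y) = y) ->
  is_iso a.
Proof.
move=> aK bK; have [|b' bE] := @sp_hom_exists q p b.
  move=> I J f x; rewrite -{1}(bK I x) -sp_map_natE aK //.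
by exists b'; split; apply: sp_hom_eq => I; apply/lfunP => x;
  rewrite sp_hom_comp bE sp_hom_id ?aK ?bK.
Qed.

(** All laws are tested on triple pure tensors: a bijection of I only composes with the outer cover,
    and the inverse is the opposite rebracketing. *)
Lemma assoc_hom_exists (p q r : Sp k) :
  exists a : hom (heis_sp (heis_sp p q) r) (heis_sp p (heis_sp q r)),
  (forall I, assocl_spec (sp_hom a I)) /\ is_iso a.
Proof.
pose F I := projT1 (cid (assocl_exists p q r I)).
have FP I : assocl_spec (F I) := projT2 (cid (assocl_exists p q r I)).
clearbody F.
have [|a aE] := @sp_hom_exists (heis_sp (heis_sp p q) r)
    (heis_sp p (heis_sp q r)) F.
  move=> I J f x; rewrite -!comp_lfunE; congr (fun_of_lfun _ x).
  apply: heis_ext3l => A B S T s t a b H K {}x y z; rewrite !comp_lfunE.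
  have [U [u [b' [c [H' K' bE cE]]]]] := cover2_assoc H K.
  rewrite (gpure_map H (cover2_bij f H)) // (FP _ _ _ _ _ _ _ _ _ _ _ _ _ _ H K H' K');
    last by split=> // w; rewrite ?bE ?cE.
  rewrite (gpure_map H' (cover2_bij f H')) //.
  by apply: FP; split=> // w; rewrite /= ?bE ?cE.
exists a; split=> [I|]; first by rewrite aE.
pose G I := projT1 (cid (assocr_exists p q r I)).
have GP I : assocr_spec (G I) := projT2 (cid (assocr_exists p q r I)).
clearbody G.
apply: (@sp_iso _ _ a G) => I x; rewrite aE -comp_lfunE -[RHS]id_lfunE;
    congr (fun_of_lfun _ x).
  apply: heis_ext3l => A B S T s t a' b H K {}x y z.
  have [U [u [b' [c [H' K' bE cE]]]]] := cover2_assoc H K.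
  rewrite comp_lfunE (FP _ _ _ _ _ _ _ _ _ _ _ _ _ _ H K H' K');
    last by split=> // w; rewrite ?bE ?cE.
  by rewrite id_lfunE; apply: GP; split=> // w; rewrite ?bE ?cE.
apply: heis_ext3r => A B T U i u b c H' K' {}x y z.
have [S [s [a' [b' [H K aE' bE]]]]] := cover2_assoc' H' K'.
rewrite comp_lfunE (GP _ _ _ _ _ _ _ _ _ _ _ _ _ _ H K H' K');
  last by split=> // w; rewrite ?bE.
by rewrite id_lfunE; apply: FP; split=> // w; rewrite ?bE.
Qed.

Lemma heis_liftP (p q : Sp k) (W : vectType k) (I : finType)
  (P : forall c : cov I, (sp_ob p (covl c) -> sp_ob q (covr c) -> W) -> Prop) :
  (forall c, exists B, [/\ forall y, linear (fun x => B x y),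
     forall x, linear (B x) & P c B]) ->
  exists f : 'Hom(sp_ob (heis_sp p q) I, W),
    forall c, P c (fun x y => f (@heis_pure k p q I c x y)).
Proof.
move=> exB; pose B c := projT1 (cid (exB c)).
have BP c : [/\ forall y, linear (fun x => B c x y),
     forall x, linear (B c x) & P c (B c)] by rewrite /B; case: cid.
clearbody B.
have [||f fE] := @heis_lift k p q W I B; try by move=> c; have [] := BP c.
exists f => c; have [_ _] := BP c; congr P.
by do 2!apply: functional_extensionality_dep => ?; rewrite fE.
Qed.

Section Unitors.
Variable p : Sp k.

(** Only covers with [t] bijective are constrained. For the others S is nonempty and the summand is
    zero; if [t] is bijective and S nonempty, [oneSp_val c] vanishes and the formula still
    agrees. *)
Definition lunitor_spec (I : finType)
  (f : 'Hom(sp_ob (heis_sp (oneSp k) p) I, sp_ob p I)) : Prop :=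
  forall (S T : finType) (s : S -> I) (t : T -> I) (H : cover2 s t)
    (h : bij T I), (forall x, h x = t x) -> forall c x,
  f (gpure H c x) = oneSp_val c *: sp_map p h x.

Definition runitor_spec (I : finType)
  (f : 'Hom(sp_ob (heis_sp p (oneSp k)) I, sp_ob p I)) : Prop :=
  forall (S T : finType) (s : S -> I) (t : T -> I) (H : cover2 s t)
    (h : bij S I), (forall x, h x = s x) -> forall x c,
  f (gpure H x c) = oneSp_val c *: sp_map p h x.

Lemma lunitor_exists (I : finType) : exists f, @lunitor_spec I f.
Proof.
pose P (c : cov I) (B : sp_ob (oneSp k) (covl c) -> sp_ob p (covr c) ->
    sp_ob p I) :=
  forall (h : bij (covr c) I), (forall x, h x = rinc x) -> forall a x,
  B a x = oneSp_val a *: sp_map p h x.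
have [c|f fE] := @heis_liftP (oneSp k) p (sp_ob p I) I P.
  have [[h hE]|nh] := pselect (exists h : bij (covr c) I, forall x, h x = rinc x).
    exists (fun a x => oneSp_val a *: sp_map p h x); split.
    - by move=> x l u v; rewrite /oneSp_val linearP scalerDl scalerA.
    - move=> a l u v; rewrite linearP scalerDr !scalerA.
      by rewrite [_ * l]mulrC.
    - move=> h' h'E a x; congr (_ *: _); apply: eq_sp_map => y.
      by rewrite hE h'E.
  (* No bijection extends the inclusion here, so the specification is vacuous and zero serves as a
     default. *)
  exists (fun _ _ => 0); split=> [x l u v|x l u v|h hE].
  - by rewrite scaler0 addr0.
  - by rewrite scaler0 addr0.
  - by case: nh; exists h.
exists f => S T s t H h hE a x.
have [c [[sf sfE] [tf tfE]]] := cover2_to_cov H.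
rewrite (gpureE _ _ _ sfE tfE).
have [tg tfK tgK] := bij_bij tf.
pose tgb : bij (covr c) T := Bij (Bijective tgK tfK).
rewrite (fE c (bij_comp h tgb)) => [|y].
  by rewrite oneSp_val_map sp_map_compE; congr (_ *: _); apply: eq_sp_map => y;
    rewrite /= tfK.
by rewrite /= hE -tfE tgK.
Qed.

Lemma runitor_exists (I : finType) : exists f, @runitor_spec I f.
Proof.
pose P (c : cov I) (B : sp_ob p (covl c) -> sp_ob (oneSp k) (covr c) ->
    sp_ob p I) :=
  forall (h : bij (covl c) I), (forall x, h x = linc x) -> forall x a,
  B x a = oneSp_val a *: sp_map p h x.
have [c|f fE] := @heis_liftP p (oneSp k) (sp_ob p I) I P.
  have [[h hE]|nh] := pselect (exists h : bij (covl c) I, forall x, h x = linc x).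
    exists (fun x a => oneSp_val a *: sp_map p h x); split.
    - move=> a l u v; rewrite linearP scalerDr !scalerA.
      by rewrite [_ * l]mulrC.
    - by move=> x l u v; rewrite /oneSp_val linearP scalerDl scalerA.
    - move=> h' h'E a x; congr (_ *: _); apply: eq_sp_map => y.
      by rewrite hE h'E.
  exists (fun _ _ => 0); split=> [x l u v|x l u v|h hE].
  - by rewrite scaler0 addr0.
  - by rewrite scaler0 addr0.
  - by case: nh; exists h.
exists f => S T s t H h hE a x.
have [c [[sf sfE] [tf tfE]]] := cover2_to_cov H.
rewrite (gpureE _ _ _ sfE tfE).
have [sg sfK sgK] := bij_bij sf.
pose sgb : bij (covl c) S := Bij (Bijective sgK sfK).
rewrite (fE c (bij_comp h sgb)) => [|y].
  by rewrite oneSp_val_map sp_map_compE; congr (_ *: _); apply: eq_sp_map => y;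
    rewrite /= sfK.
by rewrite /= hE -sfE sgK.
Qed.

(** The inverse tensors x with the generator of the unit species along the cover of I by the empty
    set and I itself. *)
Lemma lunitor_hom_exists : exists a : hom (heis_sp (oneSp k) p) p,
  (forall I, lunitor_spec (sp_hom a I)) /\ is_iso a.
Proof.
pose F I := projT1 (cid (lunitor_exists I)).
have FP I : lunitor_spec (F I) := projT2 (cid (lunitor_exists I)).
clearbody F.
have [|a aE] := @sp_hom_exists (heis_sp (oneSp k) p) p F.
  move=> I J f x; rewrite -!comp_lfunE; congr (fun_of_lfun _ x).
  apply: heis_ext => A B a b H {}x y; rewrite !comp_lfunE.
  have [A0|/oneSp_eq0 x0] := boolP (is_empty A); last first.
    by rewrite (x0 x) gpure0l !linear0.
  have [h hE] := cover2_empty H A0.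
  rewrite (gpure_map H (cover2_bij f H)) // (FP _ _ _ _ _ _ _ hE) linearZ /=.
  rewrite sp_map_compE; apply: FP => z; by rewrite /= hE.
exists a; split=> [I|]; first by rewrite aE.
have [c1 c1E] := oneSp_unit void_empty.
pose V I := cover2_void I.
pose G (I : finType) : 'Hom(sp_ob p I, sp_ob (heis_sp (oneSp k) p) I) :=
  linfun (gpure (V I) c1).
have GE I x : G I x = gpure (V I) c1 x by rewrite linfunE //; apply: gpure_linr.
apply: (@sp_iso _ _ a G) => I x; rewrite aE; last first.
  by rewrite GE (FP _ _ _ _ _ _ (bij_id I)) // c1E scale1r sp_map_idE.
rewrite -comp_lfunE -[RHS]id_lfunE; congr (fun_of_lfun _ x).
apply: heis_ext => A B a' b H {}x y; rewrite comp_lfunE id_lfunE.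
have [A0|/oneSp_eq0 x0] := boolP (is_empty A); last first.
  by rewrite (x0 x) gpure0l !linear0.
have [h hE] := cover2_empty H A0.
(* The scalar moves to the first factor, where it turns [c1] into the image of the given unit
   element under the bijection between empty sets. *)
rewrite (FP _ _ _ _ _ _ _ hE) GE gpureZr -gpureZl.
have [e _] := empty_bij A0 void_empty.
rewrite -(gpure_bij H (V I) (f := e) _ y _ hE).
  congr gpure; apply: oneSp_val_inj; rewrite oneSp_val_map.
  by rewrite oneSp_valZ c1E mulr1.
by move=> z; case: (e z).
Qed.

Lemma runitor_hom_exists : exists a : hom (heis_sp p (oneSp k)) p,
  (forall I, runitor_spec (sp_hom a I)) /\ is_iso a.
Proof.
pose F I := projT1 (cid (runitor_exists I)).
have FP I : runitor_spec (F I) := projT2 (cid (runitor_exists I)).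
clearbody F.
have [|a aE] := @sp_hom_exists (heis_sp p (oneSp k)) p F.
  move=> I J f x; rewrite -!comp_lfunE; congr (fun_of_lfun _ x).
  apply: heis_ext => A B a b H {}x y; rewrite !comp_lfunE.
  have [B0|/oneSp_eq0 y0] := boolP (is_empty B); last first.
    by rewrite (y0 y) gpure0r !linear0.
  have [h hE] := cover2_empty (cover2_sym H) B0.
  rewrite (gpure_map H (cover2_bij f H)) // (FP _ _ _ _ _ _ _ hE) linearZ /=.
  rewrite sp_map_compE; apply: FP => z; by rewrite /= hE.
exists a; split=> [I|]; first by rewrite aE.
have [c1 c1E] := oneSp_unit void_empty.
pose V I := cover2_sym (cover2_void I).
pose G (I : finType) : 'Hom(sp_ob p I, sp_ob (heis_sp p (oneSp k)) I) :=
  linfun (fun x => gpure (V I) x c1).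
have GE I x : G I x = gpure (V I) x c1 by rewrite linfunE //; apply: gpure_linl.
apply: (@sp_iso _ _ a G) => I x; rewrite aE; last first.
  by rewrite GE (FP _ _ _ _ _ _ (bij_id I)) // c1E scale1r sp_map_idE.
rewrite -comp_lfunE -[RHS]id_lfunE; congr (fun_of_lfun _ x).
apply: heis_ext => A B a' b H {}x y; rewrite comp_lfunE id_lfunE.
have [B0|/oneSp_eq0 y0] := boolP (is_empty B); last first.
  by rewrite (y0 y) gpure0r !linear0.
have [h hE] := cover2_empty (cover2_sym H) B0.
rewrite (FP _ _ _ _ _ _ _ hE) GE gpureZl -gpureZr.
have [e _] := empty_bij B0 void_empty.
rewrite -(gpure_bij H (V I) (g := e) x _ hE _).
  congr gpure; apply: oneSp_val_inj; rewrite oneSp_val_map.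
  by rewrite oneSp_valZ c1E mulr1.
by move=> z; case: (e z).
Qed.

End Unitors.

End SpUnitors.

(** * Naturality, triangle and pentagon for species *)

Section SpCoherence.
Variable k : fieldType.
Variable al : forall p q r : Sp k,
  hom (heis_sp (heis_sp p q) r) (heis_sp p (heis_sp q r)).
Hypothesis alP : forall p q r I, assocl_spec (sp_hom (al p q r) I).
Variable la : forall p : Sp k, hom (heis_sp (oneSp k) p) p.
Hypothesis laP : forall p I, lunitor_spec (sp_hom (la p) I).
Variable ra : forall p : Sp k, hom (heis_sp p (oneSp k)) p.
Hypothesis raP : forall p I, runitor_spec (sp_hom (ra p) I).

Local Notation "f \ox g" := (heis_sp_hom f g)
  (at level 40, left associativity).

Lemma alE (p q r : Sp k) (A B T S U I : finType) (s : S -> I) (t : T -> I)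
  (a : A -> S) (b : B -> S) (i : A -> I) (u : U -> I) (b' : B -> U)
  (c : T -> U) (H : cover2 s t) (K : cover2 a b) (H' : cover2 i u)
  (K' : cover2 b' c) (x : sp_ob p A) (y : sp_ob q B) (z : sp_ob r T) :
  (forall x, s (a x) = i x) -> (forall x, u (b' x) = s (b x)) ->
  (forall x, u (c x) = t x) ->
  sp_hom (al p q r) I (gpure H (gpure K x y) z) = gpure H' x (gpure K' y z).
Proof. by move=> e1 e2 e3; apply: (alP H K H' K'); split=> // w; rewrite ?e2 ?e3. Qed.

Lemma al_nat (p p' q q' r r' : Sp k) (f : hom p p') (g : hom q q')
  (h : hom r r') :
  al p' q' r' \oc (f \ox g \ox h) = f \ox (g \ox h) \oc al p q r.
Proof.
apply: sp_hom_eq => I; apply: heis_ext3l => A B S T s t a b H K x y z.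
have [U [u [b' [c [H' K' bE cE]]]]] := cover2_assoc H K.
rewrite !sp_hom_comp !gpure_hom (alE H K H' K') //.
by rewrite (alE H K H' K') // !gpure_hom.
Qed.

Lemma la_nat (p p' : Sp k) (f : hom p p') :
  la p' \oc (idm (oneSp k) \ox f) = f \oc la p.
Proof.
apply: sp_hom_eq => I; apply: heis_ext => A B a b H c x.
have [A0|A0] := boolP (is_empty A); last first.
  by rewrite (oneSp_eq0 c A0) gpure0l !linear0.
have [h hE] := cover2_empty H A0.
rewrite !sp_hom_comp gpure_hom (laP H hE) (laP H hE) sp_hom_id.
by rewrite linearZ /= sp_map_natE.
Qed.

Lemma ra_nat (p p' : Sp k) (f : hom p p') :
  ra p' \oc (f \ox idm (oneSp k)) = f \oc ra p.
Proof.
apply: sp_hom_eq => I; apply: heis_ext => A B a b H x c.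
have [B0|B0] := boolP (is_empty B); last first.
  by rewrite (oneSp_eq0 c B0) gpure0r !linear0.
have [h hE] := cover2_empty (cover2_sym H) B0.
rewrite !sp_hom_comp gpure_hom (raP H hE) (raP H hE) sp_hom_id.
by rewrite linearZ /= sp_map_natE.
Qed.

(** The middle factor lies in the unit species, so a nonempty B gives zero. Otherwise S is
    identified with A and U with T, and both sides are the same multiple of the pure tensor on the
    cover of I by A and T. *)
Lemma sp_triangle (p q : Sp k) :
  (idm p \ox la q) \oc al p (oneSp k) q = ra p \ox idm q.
Proof.
apply: sp_hom_eq => I; apply: heis_ext3l => A B S T s t a b H K x c z.
have [B0|B0] := boolP (is_empty B); last first.
  by rewrite (oneSp_eq0 c B0) gpure0r gpure0l !linear0.
have [U [u [b' [d [H' K' bE dE]]]]] := cover2_assoc H K.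
have [h hE] := cover2_empty K' B0.
have [g gE] := cover2_empty (cover2_sym K) B0.
rewrite sp_hom_comp (alE H K H' K') // !gpure_hom !sp_hom_id.
rewrite (laP K' hE) (raP K gE) gpureZr gpureZl; congr (_ *: _).
have H2 : cover2 (s \o a) t.
  have [_ ti _] := H; have [si ui su] := H'; split=> // i.
  case: (su i) => [[w <-]|[w <-]]; [by left; exists w | right].
  have [h' h'K hK'] := bij_bij h.
  by exists (h' w); rewrite -dE -hE hK'.
by rewrite (gpure_mapl H2 H) ?(gpure_mapr H2 H') // => w; rewrite ?gE ?hE.
Qed.

Lemma heis_ext4l (p q r o : Sp k) (W : vectType k) (I : finType)
  (f g : 'Hom(sp_ob (heis_sp (heis_sp (heis_sp p q) r) o) I, W)) :
  (forall (A B E G S T : finType) (t : T -> I) (g0 : G -> I) (s : S -> T)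
      (e : E -> T) (a : A -> S) (b : B -> S) (H : cover2 t g0)
      (K : cover2 s e) (M : cover2 a b)
      (x : sp_ob p A) (y : sp_ob q B) (z : sp_ob r E) (w : sp_ob o G),
     f (gpure H (gpure K (gpure M x y) z) w) =
     g (gpure H (gpure K (gpure M x y) z) w)) -> f = g.
Proof.
move=> e; apply: heis_ext3l => S E T G t g0 s e0 H K v z w.
have lin (h : 'Hom(sp_ob (heis_sp (heis_sp (heis_sp p q) r) o) I, W)) :
    linear (fun v : sp_ob (heis_sp p q) S => h (gpure H (gpure K v z) w)).
  by move=> l u u'; rewrite gpure_linl gpure_linl linearP.
rewrite -(linfunE (lin f)) -(linfunE (lin g)); congr (fun_of_lfun _ v).
by apply: heis_ext => A B a b M x y; rewrite !linfunE.
Qed.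

(** Both routes end in a nested tensor of the same four vectors; only the intermediate sets differ,
    and they have equal images in I. *)
Lemma sp_pentagon (p q r o : Sp k) :
  al p q (heis_sp r o) \oc al (heis_sp p q) r o
  = (idm p \ox al q r o) \oc al p (heis_sp q r) o \oc (al p q r \ox idm o).
Proof.
apply: sp_hom_eq => I.
apply: heis_ext4l => A B E G S T t g s e a b H K M x y z w.
(* The covers through U and V follow the route of two associators, those through X, Y and Z the
   route of three; the blocks E and G end up merged in U and in Z respectively. *)
have [U [u [e1 [g1 [H1 K1 e1E g1E]]]]] := cover2_assoc H K.
have [V [v [b2 [u2 [H2 K2 b2E u2E]]]]] := cover2_assoc H1 M.
have [X [xx [b3 [e3 [H3 K3 b3E e3E]]]]] := cover2_assoc K M.
have [Y [yy [x4 [g4 [H4 K4 x4E g4E]]]]] := cover2_assoc H H3.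
have [Z [zz [e5 [g5 [H5 K5 e5E g5E]]]]] := cover2_assoc K4 K3.
rewrite !sp_hom_comp (alE H K H1 K1) // (alE H1 M H2 K2) //.
rewrite gpure_hom (alE K M H3 K3) // sp_hom_id (alE H H3 H4 K4) //.
rewrite gpure_hom sp_hom_id (alE K4 K3 H5 K5) //.
have eE c : yy (zz (e5 c)) = v (u2 (e1 c)) by rewrite e5E x4E e3E u2E e1E.
have gE c : yy (zz (g5 c)) = v (u2 (g1 c)) by rewrite g5E g4E u2E g1E.
have [_ vi _] := H2; have [_ u2i _] := K2; have [_ yi _] := H4.
have [_ zi _] := H5; have [_ _ eg1] := K1; have [_ _ eg5] := K5.
(* U and Z have the same image in I, the union of the images of E and G. *)
have [h hE] : exists h : bij U Z, forall c, yy (zz (h c)) = v (u2 c).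
  apply: (@lift_bij _ _ _ (v \o u2) (yy \o zz)); try exact: inj_comp.
  move=> i; split=> -[c <-] /=.
    by case: (eg1 c) => -[d <-]; [exists (e5 d) | exists (g5 d)].
  by case: (eg5 c) => -[d <-]; [exists (e1 d) | exists (g1 d)].
have KK := cover2_bij h K1.
rewrite -(@gpure3r_bij _ p q (heis_sp r o) _ _ _ _ _ _ I (bij_id A) (bij_id B)
  h _ _ _ _ _ _ _ _ _ _ H2 K2 H4 H5 x y) //.
- rewrite (gpure_map K1 KK) // !(@sp_map_idE _ _ _ (bij_id _)) //.
  congr (gpure _ _ (gpure _ _ _)); apply: eq_gpure => c; apply: zi; apply: yi;
    by rewrite hE.
- by move=> c; rewrite b2E /= x4E b3E.
Qed.

End SpCoherence.

Lemma sp_monoidal (k : fieldType) :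
  exists M : monoidal (heisSp k) (oneSp k), is_canonical M.
Proof.
pose al (p q r : Sp k) := projT1 (cid (assoc_hom_exists p q r)).
have alP p q r I : assocl_spec (sp_hom (al p q r) I).
  by rewrite /al; case: cid => a [].
have ali p q r : is_iso (al p q r) by rewrite /al; case: cid => a [].
pose la (p : Sp k) := projT1 (cid (lunitor_hom_exists p)).
have laP p I : lunitor_spec (sp_hom (la p) I) by rewrite /la; case: cid => a [].
have lai p : is_iso (la p) by rewrite /la; case: cid => a [].
pose ra (p : Sp k) := projT1 (cid (runitor_hom_exists p)).
have raP p I : runitor_spec (sp_hom (ra p) I) by rewrite /ra; case: cid => a [].
have rai p : is_iso (ra p) by rewrite /ra; case: cid => a [].
clearbody al la ra.
exists (@Monoidal (Sp k) (heisSp k) (oneSp k) al la ra ali lai rai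
  (fun p p' q q' r r' => @al_nat k al alP p p' q q' r r')
  (@la_nat k la laP) (@ra_nat k ra raP)
  (@sp_triangle k al alP la laP ra raP) (@sp_pentagon k al alP)).
split=> /=.
- move=> p q r I st ab au bt f g h fE gE hE x y z.
  rewrite !gpure_cov.
  have [U [u [b [c [H K bE cE]]]]] := cover2_assoc (cover2_cov st) (cover2_cov ab).
  rewrite (alE alP (cover2_cov st) (cover2_cov ab) H K) //.
  (* The bijections supplied by [is_canonical] between nested subsets merely relabel the three
     blocks. *)
  apply/esym/gpure3r_bij => w.
  + exact: fE.
  + by rewrite bE; apply: gE.
  + by rewrite cE; apply: hE.
- by move=> p I st f fE c x; rewrite gpure_cov; apply: laP.
- by move=> p I st f fE x c; rewrite gpure_cov; apply: raP.
Qed.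

(** * Species and sequences of representations *)

Section RestrictionEquivalence.
Variable k : fieldType.

Lemma rep_iso (gT : finGroupType) (V W : rep k gT) (f : rep_hom V W)
  (g : 'Hom(rep_sp W, rep_sp V)) :
  (forall x, g (f x) = x) -> (forall y, f (g y) = y) ->
  @is_iso (rep_category k gT) V W f.
Proof.
move=> fK gK.
have ga s : (g \o rep_act W s)%VF = (rep_act V s \o g)%VF.
  apply/lfunP => y; rewrite -{1}[y]gK !comp_lfunE.
  have := congr1 (fun u => u (g y)) (congr1 (@fun_of_lfun _ _ _) (rhom_act f s)).
  by rewrite !comp_lfunE => <-; rewrite fK.
by exists (RepHom ga); split; apply: rep_hom_eq; apply/lfunP => y;
  rewrite comp_lfunE id_lfunE.
Qed.

Lemma Rcat_iso (V W : Rcat k) (f : hom V W) :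
  (forall n, @is_iso (rep_category k 'S_n) (V n) (W n) (f n)) -> is_iso f.
Proof.
move=> fi; exists (fun n => projT1 (cid (fi n))).
by split; apply: functional_extensionality_dep => n;
  have [] := projT2 (cid (fi n)).
Qed.

Lemma bij_inv_exists (I J : finType) (f : bij I J) :
  exists g : bij J I, cancel f g /\ cancel g f.
Proof. by have [g fK gK] := bij_bij f; exists (Bij (Bijective gK fK)). Qed.

Lemma bij_perm (n : nat) (f : bij 'I_n 'I_n) :
  exists s : 'S_n, forall i, s i = f i.
Proof.
exists (perm (bij_inj (bij_bij f))) => i; exact: permE.
Qed.

Lemma rhom_actE (gT : finGroupType) (V W : rep k gT) (f : rep_hom V W) s x :
  f (rep_act V s x) = rep_act W s (f x).
Proof. by rewrite -!comp_lfunE rhom_act. Qed.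

(** On I the map is the component of [h] in degree [#|I|], conjugated by a numbering of I. Two
    numberings differ by a permutation, with which [h] commutes, so any numbering computes the same
    map; naturality follows. *)
Lemma FR_full (p q : Sp k) (h : hom (FR k p) (FR k q)) :
  exists f : hom p q, h = fmap (FR k) f.
Proof.
pose e (I : finType) : bij 'I_#|I| I := Bij (enum_val_bij I).
have ex (I : finType) := bij_inv_exists (e I).
pose e' I := projT1 (cid (ex I)).
have e'K I : cancel (e I) (e' I) by rewrite /e'; case: cid => g [].
have eK I : cancel (e' I) (e I) by rewrite /e'; case: cid => g [].
pose hh n : 'Hom(sp_ob p 'I_n, sp_ob q 'I_n) := rhom (h n).
have hhE n (s : 'S_n) x : hh n (sp_map p (perm_bij s) x) =
    sp_map q (perm_bij s) (hh n x) := rhom_actE (h n) s x.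
pose F I : 'Hom(sp_ob p I, sp_ob q I) :=
  (sp_map q (e I) \o (hh #|I| \o sp_map p (e' I)))%VF.
have FE I n (g : bij 'I_n I) x : F I (sp_map p g x) = sp_map q g (hh n x).
  have en : n = #|I| by rewrite -(bij_eq_card (bij_bij g)) card_ord.
  subst n; rewrite /F !comp_lfunE sp_map_compE.
  have [s sE] := bij_perm (bij_comp (e' I) g).
  rewrite (_ : bij_comp (e' I) g = perm_bij s); last exact/esym/bij_eq.
  rewrite hhE sp_map_compE; apply: eq_sp_map => i.
  by rewrite -[LHS]/(e I (s i)) sE; apply: eK.
have [|f fE] := @sp_hom_exists k p q F.
  move=> I J g x.
  have -> : x = sp_map p (e I) (sp_map p (e' I) x) by rewrite sp_mapK //; apply: eK.
  by rewrite sp_map_compE !FE sp_map_compE.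
exists f; apply: functional_extensionality_dep => n.
apply: rep_hom_eq; apply/lfunP => x.
rewrite [RHS](_ : _ = F 'I_n x); last by rewrite -fE.
by rewrite -{2}(@sp_map_idE _ p _ (bij_id 'I_n) x) // FE sp_map_idE.
Qed.

Section Extension.
Variable V : Rcat k.

Lemma bij_ord_eq (m n : nat) (g : bij 'I_m 'I_n) : m = n.
Proof. by rewrite -(card_ord m) (bij_eq_card (bij_bij g)) card_ord. Qed.

Fact vact_inj (m n : nat) (g : bij 'I_m 'I_n) :
  injective (fun i => cast_ord (esym (bij_ord_eq g)) (g i)).
Proof. exact: inj_comp (@cast_ord_inj _ _ _) (bij_inj (bij_bij g)). Qed.

(* [V m] and [V n] are unrelated types unless m and n are identified. *)
Definition vcast (m n : nat) (e : m = n) : 'Hom(rep_sp (V m), rep_sp (V n)) :=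
  match e in _ = n' return 'Hom(rep_sp (V m), rep_sp (V n')) with
  | erefl => \1%VF
  end.

(** A bijection between ordinals forces m = n: it acts as a permutation of ['I_m], followed by the
    identification of [V m] with [V n]. Allowing m and n to differ keeps casts out of the
    composition law. *)
Definition vact (m n : nat) (g : bij 'I_m 'I_n) :
  'Hom(rep_sp (V m), rep_sp (V n)) :=
  (vcast (bij_ord_eq g) \o rep_act (V m) (perm (@vact_inj _ _ g)))%VF.

Lemma vactE (n : nat) (g : bij 'I_n 'I_n) (s : 'S_n) :
  (forall i, s i = g i) -> vact g = rep_act (V n) s.
Proof.
move=> sE; rewrite /vact.
have -> : perm (@vact_inj _ _ g) = s.
  by apply/permP => i; rewrite permE sE; apply: val_inj.
by rewrite (eq_axiomK (bij_ord_eq g)) comp_lfun1l.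
Qed.

Lemma vact_comp (l m n : nat) (g : bij 'I_m 'I_n) (f : bij 'I_l 'I_m) :
  vact (bij_comp g f) = (vact g \o vact f)%VF.
Proof.
have e := bij_ord_eq f; subst l; have e := bij_ord_eq g; subst m.
have [s sE] := bij_perm f; have [t tE] := bij_perm g.
rewrite (vactE sE) (vactE tE) -rep_mul; apply: vactE => i.
by rewrite permM sE tE.
Qed.

Lemma vact_id (n : nat) (g : bij 'I_n 'I_n) : (forall i, g i = i) -> vact g = \1%VF.
Proof.
by move=> gE; rewrite (@vactE n g 1%g) ?rep_one // => i; rewrite perm1 gE.
Qed.

Let rank (I : finType) : bij I 'I_#|I| := Bij (enum_rank_bij I).
Let unrank (I : finType) : bij 'I_#|I| I := Bij (enum_val_bij I).

(** The species takes the value [V #|I|] at I, bijections being read through enumerations. As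
    [#|'I_n|] and [n] are equal but not convertible, the comparison with [V n] is itself the action
    of an enumeration. *)
Lemma FR_esurj : exists (p : Sp k) (e : hom (FR k p) V), is_iso e.
Proof.
pose pm (I J : finType) (f : bij I J) :=
  vact (bij_comp (rank J) (bij_comp f (unrank I))).
have pm1 I : pm I I (bij_id I) = \1%VF.
  by apply: vact_id => i; rewrite /= enum_valK.
have pmM I J K (g : bij J K) (f : bij I J) :
    pm I K (bij_comp g f) = (pm J K g \o pm I J f)%VF.
  rewrite /pm -vact_comp; congr vact; apply: bij_eq => i /=.
  by rewrite enum_rankK.
pose p : Sp k := @Functor finbij_category (vect_category k)
  (fun I : finType => rep_sp (V #|I|)) pm pm1 pmM.
have ea n (s : 'S_n) : (vact (unrank 'I_n) \o rep_act (FR k p n) s)%VF =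
    (rep_act (V n) s \o vact (unrank 'I_n))%VF.
  have sE i : s i = perm_bij s i by [].
  rewrite -(vactE sE) -[rep_act _ s]/(pm _ _ (perm_bij s)) /pm -!vact_comp.
  by congr vact; apply: bij_eq => i /=; rewrite enum_rankK.
exists p, (fun n => RepHom (ea n)); apply: Rcat_iso => n.
apply: (@rep_iso 'S_n (FR k p n) (V n) (RepHom (ea n)) (vact (rank 'I_n))) => x;
  rewrite -comp_lfunE -vact_comp vact_id ?id_lfunE // => i /=.
  exact: enum_valK.
exact: enum_rankK.
Qed.

End Extension.

End RestrictionEquivalence.

(** * Coordinates in the Heisenberg product of representations *)

Section HeisVal.
Variable k : fieldType.

Section Degree.
Variables (a b n : nat) (abn : (maxn a b <= n <= a + b)%N).
Variables (V : rep k 'S_a) (W : rep k 'S_b).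

Definition overlap_rep : rep k (overlap_group a b n) :=
  rep_res (overlap_to_pqM abn) (rep_tens V W).

Definition deg_val (F : rep_sp (heis_degree abn V W)) (s : 'S_n) :
  tens (rep_sp V) (rep_sp W) := vsval (F : ind_sp _ overlap_rep) s.

Lemma deg_val_eq F G : (forall s, deg_val F s = deg_val G s) -> F = G.
Proof.
by move=> e; apply: (@ind_sp_eq k _ _ (overlap_to_n abn) overlap_rep F G) => s; apply: e.
Qed.

Lemma deg_val_lin s : linear (deg_val^~ s).
Proof.
move=> l u v; rewrite /deg_val.
have -> : vsval (l *: u + v : ind_sp (overlap_to_n abn) overlap_rep) =
    l *: vsval (u : ind_sp _ overlap_rep) + vsval (v : ind_sp _ overlap_rep).
  exact: linearP.
by rewrite !ffunE.
Qed.

Lemma deg_valM F s x : deg_val F (s * overlap_to_n abn x)%g =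
  tmap (rep_act V (overlap_to_pq abn x).1) (rep_act W (overlap_to_pq abn x).2)
    (deg_val F s).
Proof. exact: (@ind_spP k _ _ (overlap_to_n abn) overlap_rep F). Qed.

Lemma deg_val_act t F s :
  deg_val (rep_act (heis_degree abn V W) t F) s = deg_val F (t * s)%g.
Proof. exact: (@ind_actE k _ _ (overlap_to_n abn) overlap_rep t F). Qed.

(** [vsproj] only serves to enter the type of the subspace; on equivariant [g] it changes
    nothing. *)
Definition deg_of (g : 'S_n -> tens (rep_sp V) (rep_sp W)) :
  rep_sp (heis_degree abn V W) :=
  vsproj (ind_space (overlap_to_n abn) overlap_rep) [ffun s => g s].

Lemma deg_ofE g : (forall s x, g (s * overlap_to_n abn x)%g =
    tmap (rep_act V (overlap_to_pq abn x).1)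
      (rep_act W (overlap_to_pq abn x).2) (g s)) ->
  forall s, deg_val (deg_of g) s = g s.
Proof.
move=> gM s; rewrite /deg_val /deg_of vsprojK ?ffunE //.
by apply/ind_spaceP => x t; rewrite !ffunE gM.
Qed.

End Degree.

Lemma deg_val_hom (a b n : nat) (abn : (maxn a b <= n <= a + b)%N)
  (V V' : rep k 'S_a) (W W' : rep k 'S_b) (f : rep_hom V V') (g : rep_hom W W')
  F s :
  deg_val (heis_degree_hom abn f g F) s = tmap (rhom f) (rhom g) (deg_val F s).
Proof. exact: (ind_mapE (rep_res_hom (overlap_to_pqM abn) (rep_tens_hom f g))). Qed.

Section Total.
Variables (V W : Rcat k) (n : nat).

(** Coordinates of an element of the product: a tensor for each pair of degrees and each
    permutation, subject to the equivariance [heis_valM]. *)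
Definition heis_val (F : rep_sp (heis_rep V W n)) (d : degrees n) (s : 'S_n) :
  tens (rep_sp (V (val d).1)) (rep_sp (W (val d).2)) := deg_val (dproj d F) s.

Lemma heis_val_eq F G : (forall d s, heis_val F d s = heis_val G d s) -> F = G.
Proof. by move=> e; apply: dsumP => d; apply: deg_val_eq => s; apply: e. Qed.

Lemma heis_val_lin d s : linear (fun F => heis_val F d s).
Proof. by move=> l u v; rewrite /heis_val dproj_lin deg_val_lin. Qed.

Lemma heis_valM F d s x : heis_val F d (s * overlap_to_n (valP d) x)%g =
  tmap (rep_act (V (val d).1) (overlap_to_pq (valP d) x).1)
    (rep_act (W (val d).2) (overlap_to_pq (valP d) x).2) (heis_val F d s).
Proof. exact: deg_valM. Qed.

Lemma heis_val_act t F d s :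
  heis_val (rep_act (heis_rep V W n) t F) d s = heis_val F d (t * s)%g.
Proof. by rewrite /heis_val dproj_map; apply: deg_val_act. Qed.

Definition heis_of (g : forall d : degrees n, 'S_n ->
    tens (rep_sp (V (val d).1)) (rep_sp (W (val d).2))) :
  rep_sp (heis_rep V W n) :=
  [ffun d => deg_of (valP d) (g d)] : dsum_type (fun d : degrees n =>
    rep_sp (heis_degree (valP d) (V (val d).1) (W (val d).2))).

Lemma heis_ofE (g : forall d : degrees n, 'S_n ->
    tens (rep_sp (V (val d).1)) (rep_sp (W (val d).2))) :
  (forall d s x, g d (s * overlap_to_n (valP d) x)%g =
    tmap (rep_act (V (val d).1) (overlap_to_pq (valP d) x).1)
      (rep_act (W (val d).2) (overlap_to_pq (valP d) x).2) (g d s)) ->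
  forall d s, heis_val (heis_of g) d s = g d s.
Proof.
move=> gM d s; rewrite /heis_val /dproj ffunE.
by apply: deg_ofE => t x; apply: gM.
Qed.

End Total.

Lemma heis_val_hom (V V' W W' : Rcat k) (f : hom V V') (g : hom W W') n F d s :
  heis_val (heis_rep_hom f g n F) d s =
  tmap (rhom (f (val d).1)) (rhom (g (val d).2)) (heis_val F d s).
Proof.
have e : dproj d (heis_rep_hom f g n F) =
    heis_degree_hom (valP d) (f (val d).1) (g (val d).2) (dproj d F).
  exact: (@dproj_map k (degrees n) _ _
    (fun d => rhom (heis_degree_hom (valP d) (f (val d).1) (g (val d).2))) F d).
exact: (etrans (congr1 (fun G => deg_val G s) e)
  (deg_val_hom (f (val d).1) (g (val d).2) (dproj d F) s)).
Qed.

End HeisVal.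

(** * Covers in standard position *)

Definition bij_inv (I J : finType) (f : bij I J) : bij J I :=
  projT1 (cid (bij_inv_exists f)).

Lemma bij_invK (I J : finType) (f : bij I J) : cancel f (bij_inv f).
Proof. by rewrite /bij_inv; case: cid => g []. Qed.

Lemma bijK_inv (I J : finType) (f : bij I J) : cancel (bij_inv f) f.
Proof. by rewrite /bij_inv; case: cid => g []. Qed.

Section StandardCover.
Variables a b n : nat.
Hypothesis abn : (maxn a b <= n <= a + b)%N.

Let an : (a <= n)%N.
Proof. by move: abn; rewrite geq_max => /andP[/andP[]]. Qed.

Let bn : (b <= n)%N.
Proof. by move: abn; rewrite geq_max => /andP[/andP[]]. Qed.

Let nab : (n <= a + b)%N.
Proof. by case/andP: abn. Qed.

Let ltbn (j : 'I_b) : (n - b + j < n)%N.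
Proof. by rewrite -{2}(subnK bn) ltn_add2l. Qed.

Definition stdl (i : 'I_a) : 'I_n := widen_ord an i.

Definition stdr (j : 'I_b) : 'I_n := Ordinal (ltbn j).

Lemma stdl_image (i : 'I_n) : (exists j, stdl j = i) <-> (i < a)%N.
Proof.
split=> [[j <-]|ia]; first exact: (ltn_ord j).
by exists (Ordinal ia); apply: val_inj.
Qed.

Lemma stdr_image (i : 'I_n) : (exists j, stdr j = i) <-> (n - b <= i)%N.
Proof.
split=> [[j <-]|ib]; first exact: leq_addr.
have h : (i - (n - b) < b)%N.
  by rewrite ltn_subLR // subnK.
by exists (Ordinal h); apply: val_inj; rewrite /= subnKC.
Qed.

Lemma std_cover : cover2 stdl stdr.
Proof.
split=> [i j /(congr1 val) /= e|i j /(congr1 val) /= /addnI e|i].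
- exact: val_inj.
- exact: val_inj.
have [ia|ai] := ltnP i a; [by left; apply/stdl_image | right].
(* The final block starts at n - b, which is at most a because n <= a + b. *)
by apply/stdr_image; apply: leq_trans ai; rewrite leq_subLR addnC.
Qed.

Lemma juxt_l (p q : nat) (s : 'S_p) (t : 'S_q) j :
  juxt s t (lshift q j) = lshift q (s j).
Proof. by rewrite permE /juxt_fun -[lshift q j]/(unsplit (inl _)) unsplitK. Qed.

Lemma juxt_r (p q : nat) (s : 'S_p) (t : 'S_q) j :
  juxt s t (rshift p j) = rshift p (t j).
Proof. by rewrite permE /juxt_fun -[rshift p j]/(unsplit (inr _)) unsplitK. Qed.

(** [b1], [b2], [b3] parametrize the three intervals permuted by the factors of the overlap group:
    initial block only, intersection, final block only. *)
Let b1 (j : 'I_(n - b)) : 'I_n :=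
  cast_ord (overlap_n abn) (lshift _ (lshift _ j)).
Let b2 (j : 'I_(a + b - n)) : 'I_n :=
  cast_ord (overlap_n abn) (lshift _ (rshift _ j)).
Let b3 (j : 'I_(n - a)) : 'I_n := cast_ord (overlap_n abn) (rshift _ j).

Lemma overlap_b1 x j : overlap_to_n abn x (b1 j) = b1 (x.1.1 j).
Proof. by rewrite /overlap_to_n cast_permE cast_ordK !juxt_l. Qed.

Lemma overlap_b2 x j : overlap_to_n abn x (b2 j) = b2 (x.1.2 j).
Proof. by rewrite /overlap_to_n cast_permE cast_ordK juxt_l juxt_r. Qed.

Lemma overlap_b3 x j : overlap_to_n abn x (b3 j) = b3 (x.2 j).
Proof. by rewrite /overlap_to_n cast_permE cast_ordK juxt_r. Qed.

Lemma overlap_stdl x i :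
  stdl ((overlap_to_pq abn x).1 i) = overlap_to_n abn x (stdl i).
Proof.
have -> : i = cast_ord (overlap_p abn) (cast_ord (esym (overlap_p abn)) i).
  by apply: val_inj.
set i' := cast_ord _ i; rewrite -(splitK i') /= cast_permE cast_ordK.
case: (split i') => j /=.
  rewrite juxt_l (_ : stdl (cast_ord _ (lshift _ j)) = b1 j); last exact: val_inj.
  by rewrite overlap_b1; apply: val_inj.
rewrite juxt_r (_ : stdl (cast_ord _ (rshift _ j)) = b2 j); last exact: val_inj.
by rewrite overlap_b2; apply: val_inj.
Qed.

Lemma overlap_stdr x i :
  stdr ((overlap_to_pq abn x).2 i) = overlap_to_n abn x (stdr i).
Proof.
have -> : i = cast_ord (overlap_q abn) (cast_ord (esym (overlap_q abn)) i).
  by apply: val_inj.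
set i' := cast_ord _ i; rewrite -(splitK i') /= cast_permE cast_ordK.
case: (split i') => j /=.
  rewrite juxt_l (_ : stdr (cast_ord _ (lshift _ j)) = b2 j); last exact: val_inj.
  by rewrite overlap_b2; apply: val_inj.
rewrite juxt_r (_ : stdr (cast_ord _ (rshift _ j)) = b3 j).
  by rewrite overlap_b3; apply: val_inj; rewrite /= addnA.
by apply: val_inj; rewrite /= addnA.
Qed.

Lemma perm_restrict (m : nat) (e : 'I_m -> 'I_n) (s : 'S_n) : injective e ->
  (forall i, exists j, e j = s (e i)) ->
  exists t : 'S_m, forall i, e (t i) = s (e i).
Proof.
move=> ei H; pose f i := projT1 (cid (H i)).
have fE i : e (f i) = s (e i) by rewrite /f; case: cid.
have fi : injective f.
  by move=> i j /(congr1 e); rewrite !fE => /perm_inj/ei.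
by exists (perm fi) => i; rewrite permE.
Qed.

(** An injection of a finite set into itself is onto, so the complement is preserved too. *)
Lemma perm_stable_out (P : pred 'I_n) (s : 'S_n) :
  (forall i, P i -> P (s i)) -> forall i, P (s i) = P i.
Proof.
move=> H.
have sub : s @: [set i | P i] = [set i | P i].
  apply/eqP; rewrite eqEcard card_imset ?leqnn ?andbT; last exact: perm_inj.
  by apply/subsetP => j /imsetP[i]; rewrite !inE => /H Psi ->.
move=> i; apply/idP/idP => [Psi|/H //].
have : s i \in s @: [set i | P i] by rewrite sub inE.
by rewrite mem_imset ?inE //; apply: perm_inj.
Qed.

(** Preserving both blocks entails preserving their intersection and both differences, so the
    permutation is the juxtaposition of three restrictions. With [overlap_stdl] and [overlap_stdr]
    this identifies the stabilizer of the standard cover. *)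
Lemma overlap_onto (s : 'S_n) :
  (forall i, exists j, stdl j = s (stdl i)) ->
  (forall i, exists j, stdr j = s (stdr i)) ->
  exists x, overlap_to_n abn x = s.
Proof.
move=> Hl Hr.
have sl : forall i, (s i < a)%N = (i < a)%N.
  apply: (@perm_stable_out (fun i => (i < a)%N)) => i /stdl_image[j <-].
  exact/stdl_image.
have sr : forall i, (n - b <= s i)%N = (n - b <= i)%N.
  apply: (@perm_stable_out (fun i => (n - b <= i)%N)) => i /stdr_image[j <-].
  exact/stdr_image.
have e3 : (n - b + (a + b - n) = a)%N := overlap_p abn.
have im1 (i : 'I_n) : (i < n - b)%N -> exists j, b1 j = i.
  by move=> ib; exists (Ordinal ib); apply: val_inj.
have im2 (i : 'I_n) : (i < a)%N -> (n - b <= i)%N -> exists j, b2 j = i.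
  move=> ia ib; have h : (i - (n - b) < a + b - n)%N.
    by rewrite ltn_subLR // e3.
  by exists (Ordinal h); apply: val_inj; rewrite /= subnKC.
have im3 (i : 'I_n) : (a <= i)%N -> exists j, b3 j = i.
  move=> ai; have h : (i - a < n - a)%N by rewrite ltn_sub2r // (leq_ltn_trans ai).
  by exists (Ordinal h); apply: val_inj; rewrite /= e3 subnKC.
have b1_lt j : (b1 j < n - b)%N by rewrite /= ltn_ord.
have b2_lt j : (b2 j < a)%N by rewrite /= -[X in (_ < X)%N]e3 ltn_add2l.
have b2_ge j : (n - b <= b2 j)%N by rewrite /= leq_addr.
have b3_ge j : (a <= b3 j)%N by rewrite /= e3 leq_addr.
have [s1 s1E] : exists t : 'S_(n - b), forall i, b1 (t i) = s (b1 i).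
  apply: perm_restrict => [i j /(congr1 val) /= e|i]; first exact: val_inj.
  by apply: im1; rewrite ltnNge sr -ltnNge.
have [s2 s2E] : exists t : 'S_(a + b - n), forall i, b2 (t i) = s (b2 i).
  apply: perm_restrict => [i j /(congr1 val) /= /addnI e|i]; first exact: val_inj.
  by apply: im2; rewrite ?sl ?sr.
have [s3 s3E] : exists t : 'S_(n - a), forall i, b3 (t i) = s (b3 i).
  apply: perm_restrict => [i j /(congr1 val) /= /addnI e|i]; first exact: val_inj.
  by apply: im3; rewrite leqNgt sl -leqNgt.
exists (s1, s2, s3); apply/permP => i.
have [ib|bi] := ltnP i (n - b).
  by have [j <-] := im1 i ib; rewrite overlap_b1 s1E.
have [ia|ai] := ltnP i a.
  by have [j <-] := im2 i ia bi; rewrite overlap_b2 s2E.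
by have [j <-] := im3 i ai; rewrite overlap_b3 s3E.
Qed.

End StandardCover.

(** Listing the elements of S only, then of both sets, then of T only, puts S first and T last; the
    inverse of this listing moves the cover to standard position. *)
Lemma std_exists (n : nat) (c : cov 'I_n) :
  exists (d : degrees n) (s : 'S_n)
    (f : bij 'I_(val d).1 (covl c)) (g : bij 'I_(val d).2 (covr c)),
  (forall i, s (linc (f i)) = stdl (valP d) i) /\
  (forall i, s (rinc (g i)) = stdr (valP d) i).
Proof.
pose S := (val c).1; pose T := (val c).2.
have ST i : (i \in S) || (i \in T) by rewrite -in_setU (eqP (valP c)) inE.
pose s1 := enum (S :\: T); pose s2 := enum (S :&: T); pose s3 := enum (T :\: S).
have z12 : (size s1 + size s2 = #|S|)%N by rewrite -!cardE addnC cardsID.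
have z23 : (size s2 + size s3 = #|T|)%N by rewrite -!cardE /S /T setIC cardsID.
have z123 : (#|S| + size s3 = n)%N.
  rewrite -cardE -[RHS](card_ord n) -(cardsC S); congr (_ + _)%N.
  apply: eq_card => i; rewrite !inE; have := ST i.
  by case: (i \in S) => //= ->.
have z1 : size s1 = (n - #|T|)%N by apply: (canRL (addnK _)); rewrite -z23 addnA z12.
have dP : (maxn #|S| #|T| <= n <= #|S| + #|T|)%N.
  by move: z12 z23 z123; lia.
have Sn : (#|S| < n.+1)%N by rewrite ltnS; case/andP: dP; rewrite geq_max => /andP[].
have Tn : (#|T| < n.+1)%N by rewrite ltnS; case/andP: dP; rewrite geq_max => /andP[].
pose d : degrees n := exist _ (Ordinal Sn, Ordinal Tn) dP.
pose sq := s1 ++ s2 ++ s3.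
have zsq : size sq = n by rewrite !size_cat addnA z12.
have usq : uniq sq.
  rewrite !cat_uniq !enum_uniq !andbT /=; apply/andP; split.
    apply/hasPn => i; rewrite mem_cat !mem_enum !inE.
    by case: (i \in S); case: (i \in T).
  by apply/hasPn => i; rewrite !mem_enum !inE; case: (i \in S); case: (i \in T).
pose ka (i : 'I_n) := nth i sq i.
have kaS i : (ka i \in S) = (i < #|S|)%N.
  rewrite /ka /sq catA nth_cat size_cat z12; case: ltnP => iS.
    have : nth i (s1 ++ s2) i \in s1 ++ s2 by apply: mem_nth; rewrite size_cat z12.
    by rewrite mem_cat !mem_enum !inE; case: (_ \in S); rewrite ?andbF.
  have : nth i s3 (i - #|S|) \in s3 by apply: mem_nth; rewrite ltn_subLR // z123.
  by rewrite mem_enum inE; case: (_ \in S).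
have kaT i : (ka i \in T) = (n - #|T| <= i)%N.
  rewrite /ka /sq nth_cat z1; case: ltnP => iT.
    have : nth i s1 i \in s1 by apply: mem_nth; rewrite z1.
    by rewrite mem_enum inE; case: (_ \in T).
  have : nth i (s2 ++ s3) (i - (n - #|T|)) \in s2 ++ s3.
    apply: mem_nth; rewrite size_cat z23; have := ltn_ord i.
    by move: iT z12 z23 z123; lia.
  by rewrite mem_cat !mem_enum !inE; case: (_ \in T); rewrite ?andbF.
have ki : injective ka.
  (* The two values of [nth] have different defaults; they are made equal, which is harmless below
     the length n, before uniqueness of the list applies. *)
  move=> i j; rewrite /ka (set_nth_default j) ?zsq // => /eqP.
  by rewrite nth_uniq ?zsq // => /eqP/val_inj.
have [si sj cov] := std_cover (valP d).
have kon j : exists i, ka i = j.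
  by have [g gK Kg] := injF_bij ki; exists (g j).
have [f fE] : exists f : bij 'I_(val d).1 (covl c),
    forall i, linc (f i) = ka (stdl (valP d) i).
  apply: (lift_bij (inj_comp ki si) (@linc_inj _ _)) => j; split=> [[i <-]|[y <-]].
    by apply: inc_onto; rewrite [_ \in _]kaS; apply/(stdl_image (valP d)); exists i.
  have [i ie] := kon (linc y).
  have /(stdl_image (valP d))[i' i'E] : (i < #|S|)%N by rewrite -kaS ie; apply: incP.
  by exists i'; rewrite /= i'E.
have [g gE] : exists g : bij 'I_(val d).2 (covr c),
    forall i, rinc (g i) = ka (stdr (valP d) i).
  apply: (lift_bij (inj_comp ki sj) (@rinc_inj _ _)) => j; split=> [[i <-]|[y <-]].
    by apply: inc_onto; rewrite [_ \in _]kaT; apply/(stdr_image (valP d)); exists i.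
  have [i ie] := kon (rinc y).
  have /(stdr_image (valP d))[i' i'E] : (n - #|T| <= i)%N by rewrite -kaT ie; apply: incP.
  by exists i'; rewrite /= i'E.
exists d, (perm ki)^-1%g, f, g; split=> i.
  by rewrite fE -(permE ki) permK.
by rewrite gE -(permE ki) permK.
Qed.

(** * Comparison of the two Heisenberg products *)

Section Nu.
Variable k : fieldType.
Variables P Q : Sp k.

Lemma sp_tmap_comp (A B C A' B' C' : finType) (f : bij B C) (f0 : bij A B)
  (g : bij B' C') (g0 : bij A' B') t :
  tmap (sp_map P f) (sp_map Q g) (tmap (sp_map P f0) (sp_map Q g0) t) =
  tmap (sp_map P (bij_comp f f0)) (sp_map Q (bij_comp g g0)) t.
Proof. by rewrite -comp_lfunE -tmap_comp -!sp_map_comp. Qed.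

Lemma eq_sp_tmap (A A' B B' : finType) (f f' : bij A A') (g g' : bij B B') t :
  f =1 f' -> g =1 g' ->
  tmap (sp_map P f) (sp_map Q g) t = tmap (sp_map P f') (sp_map Q g') t.
Proof. by move=> /bij_eq -> /bij_eq ->. Qed.

Lemma sp_tmap_id (A B : finType) (f : bij A A) (g : bij B B) t :
  f =1 id -> g =1 id -> tmap (sp_map P f) (sp_map Q g) t = t.
Proof.
move=> fE gE; rewrite -[RHS]id_lfunE -tmap_id -!sp_map_id.
exact: eq_sp_tmap.
Qed.

(* The coordinate of [w] along [gpure H]. *)
Definition gproj (A B I : finType) (a : A -> I) (b : B -> I) (H : cover2 a b)
  (w : sp_ob (heis_sp P Q) I) : tens (sp_ob P A) (sp_ob Q B) :=
  tmap (sp_map P (bij_inv (cov_ofl H))) (sp_map Q (bij_inv (cov_ofr H)))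
    (@dproj k (cov I) (@heis_summand k P Q I) (cov_of H) w).

Lemma gproj_lin (A B I : finType) (a : A -> I) (b : B -> I) (H : cover2 a b) :
  linear (gproj H).
Proof. by move=> l u v; rewrite /gproj dproj_lin linearP. Qed.

Lemma gprojE (A B I : finType) (a : A -> I) (b : B -> I) (H : cover2 a b)
  (c : cov I) (f : bij A (covl c)) (g : bij B (covr c)) (f' : bij (covl c) A)
  (g' : bij (covr c) B) w :
  (forall x, linc (f x) = a x) -> (forall x, rinc (g x) = b x) ->
  cancel f f' -> cancel g g' ->
  gproj H w = tmap (sp_map P f') (sp_map Q g')
    (@dproj k (cov I) (@heis_summand k P Q I) c w).
Proof.
move=> fE gE fK gK; have e : cov_of H = c.
  by apply: (@cov_eq I A B _ _ (cov_ofl H) (cov_ofr H) f g) => z;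
    rewrite ?cov_oflE ?fE ?cov_ofrE ?gE.
rewrite /gproj; move: (cov_ofl H) (cov_ofr H) (cov_oflE H) (cov_ofrE H).
case: _ / e f g f' g' fE gE fK gK => f g f' g' fE gE fK gK h h' hE h'E.
apply: eq_sp_tmap => x.
  rewrite -[x in RHS](bijK_inv h); set y := bij_inv h x.
  by rewrite -[LHS](fK y); congr (f' _); apply: linc_inj; rewrite fE hE.
rewrite -[x in RHS](bijK_inv h'); set y := bij_inv h' x.
by rewrite -[LHS](gK y); congr (g' _); apply: rinc_inj; rewrite gE h'E.
Qed.

Lemma gproj_map (A B I J : finType) (a : A -> J) (b : B -> J) (a' : A -> I)
  (b' : B -> I) (H : cover2 a b) (H' : cover2 a' b') (h : bij I J) w :
  (forall x, h (a' x) = a x) -> (forall x, h (b' x) = b x) ->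
  gproj H (sp_map (heis_sp P Q) h w) = gproj H' w.
Proof.
move=> aE bE; have [ai bi _] := H'.
have [f fE] : exists f : bij A (covl (precov h (cov_of H))),
    forall x, linc (f x) = a' x.
  by apply: (preim_bij (f := cov_ofl H)) => // z; rewrite aE; apply/esym/cov_oflE.
have [g gE] : exists g : bij B (covr (precov h (cov_of H))),
    forall x, rinc (g x) = b' x.
  by apply: (preim_bij (f := cov_ofr H)) => // z; rewrite bE; apply/esym/cov_ofrE.
rewrite {1}/gproj [dproj _ _](heis_sp_mapE h w (cov_of H)) sp_tmap_comp.
apply/esym/(@gprojE _ _ _ _ _ H' _ f g) => // x; rewrite /=.
  apply: (can_inj (bij_invK (cov_ofl H))); rewrite bijK_inv; apply: linc_inj.
  by rewrite cov_oflE -aE -fE.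
apply: (can_inj (bij_invK (cov_ofr H))); rewrite bijK_inv; apply: rinc_inj.
by rewrite cov_ofrE -bE -gE.
Qed.

Lemma gproj_reindex (A B A' B' I : finType) (a : A -> I) (b : B -> I)
  (a' : A' -> I) (b' : B' -> I) (H : cover2 a b) (H' : cover2 a' b')
  (u : bij A A') (v : bij B B') w :
  (forall x, a' (u x) = a x) -> (forall x, b' (v x) = b x) ->
  gproj H' w = tmap (sp_map P u) (sp_map Q v) (gproj H w).
Proof.
move=> uE vE; rewrite {2}/gproj sp_tmap_comp.
apply: (@gprojE _ _ _ _ _ H' _ (bij_comp (cov_ofl H) (bij_inv u))
  (bij_comp (cov_ofr H) (bij_inv v))) => x /=.
- by rewrite cov_oflE -uE bijK_inv.
- by rewrite cov_ofrE -vE bijK_inv.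
- by rewrite bij_invK bijK_inv.
- by rewrite bij_invK bijK_inv.
Qed.

Section Degree.
Variables (n : nat) (d : degrees n).

(** With products composed from left to right, [(s * x)^-1] applies [x^-1] first, so a right factor
    from the overlap group only relabels the standard blocks. This gives the equivariance required
    of induced elements. *)
Definition std_perm (s : 'S_n) :
  cover2 (perm_bij s^-1%g \o stdl (valP d)) (perm_bij s^-1%g \o stdr (valP d)) :=
  cover2_bij (perm_bij s^-1%g) (std_cover (valP d)).

Lemma gproj_overlap (w : sp_ob (heis_sp P Q) 'I_n) s x :
  gproj (std_perm (s * overlap_to_n (valP d) x)%g) w =
  tmap (sp_map P (perm_bij (overlap_to_pq (valP d) x).1))
    (sp_map Q (perm_bij (overlap_to_pq (valP d) x).2)) (gproj (std_perm s) w).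
Proof.
apply: gproj_reindex => i /=; rewrite ?overlap_stdl ?overlap_stdr;
  by rewrite invMg permM permK.
Qed.

End Degree.

Local Notation heis_FR := (heis_rep (FR_ob P) (FR_ob Q)).

Definition nu_fun n (w : sp_ob (heis_sp P Q) 'I_n) : rep_sp (heis_FR n) :=
  @heis_of k (FR_ob P) (FR_ob Q) n (fun d s => gproj (std_perm d s) w).

Lemma nu_funE n w d s :
  @heis_val k (FR_ob P) (FR_ob Q) n (nu_fun w) d s = gproj (std_perm d s) w.
Proof. by rewrite heis_ofE // => {}d {}s x; apply: gproj_overlap. Qed.

Lemma nu_fun_lin n : linear (@nu_fun n).
Proof.
move=> l u v; apply: heis_val_eq => d s.
rewrite heis_val_lin !nu_funE; exact: gproj_lin.
Qed.

Definition nu_lfun n : 'Hom(sp_ob (heis_sp P Q) 'I_n, rep_sp (heis_FR n)) :=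
  linfun (@nu_fun n).

Lemma nu_lfunE n w d s :
  @heis_val k (FR_ob P) (FR_ob Q) n (nu_lfun n w) d s = gproj (std_perm d s) w.
Proof. by rewrite linfunE ?nu_funE //; apply: nu_fun_lin. Qed.

Lemma nu_act n (s : 'S_n) :
  (nu_lfun n \o rep_act (FR_ob (heis_sp P Q) n) s)%VF =
  (rep_act (heis_FR n) s \o nu_lfun n)%VF.
Proof.
apply/lfunP => w; rewrite [LHS]comp_lfunE [RHS]comp_lfunE.
apply: heis_val_eq => d t; rewrite heis_val_act !nu_lfunE.
by apply: gproj_map => i /=; rewrite invMg permM permKV.
Qed.

Definition nu_hom n : rep_hom (FR_ob (heis_sp P Q) n) (heis_FR n) :=
  RepHom (@nu_act n).

(* Reconstruction of the coordinate at [c] from an element of the sum of the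
   induced representations: two ways of moving [c] to standard position
   differ by an element of S_p x_n S_q.                                       *)
Lemma nu_coord_exists n (c : cov 'I_n) :
  exists L : 'Hom(rep_sp (heis_FR n), heis_summand P Q c),
  forall (d : degrees n) (s : 'S_n) (f : bij 'I_(val d).1 (covl c))
    (g : bij 'I_(val d).2 (covr c)),
  (forall i, s (linc (f i)) = stdl (valP d) i) ->
  (forall i, s (rinc (g i)) = stdr (valP d) i) ->
  forall F, L F = tmap (sp_map P f) (sp_map Q g) (heis_val F d s).
Proof.
have [d [s [f [g [fE gE]]]]] := std_exists c.
pose L (F : rep_sp (heis_FR n)) : heis_summand P Q c :=
  tmap (sp_map P f) (sp_map Q g) (heis_val F d s).
have Llin : linear L.
  by move=> l u v; rewrite /L heis_val_lin linearP.
exists (linfun L) => d' s' f' g' f'E g'E F; rewrite linfunE // /L.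
(* The two degrees are the sizes of the blocks of [c]. *)
have e : d = d'.
  apply: val_inj; rewrite [LHS]surjective_pairing [RHS]surjective_pairing.
  by congr pair; apply: val_inj;
    [apply: (bij_ord_eq (bij_comp (bij_inv f') f))
    | apply: (bij_ord_eq (bij_comp (bij_inv g') g))].
subst d'.
pose r := (s^-1 * s')%g.
have rl i : r (stdl (valP d) i) = stdl (valP d) (bij_inv f' (f i)).
  by rewrite permM -fE permK -f'E bijK_inv.
have rr i : r (stdr (valP d) i) = stdr (valP d) (bij_inv g' (g i)).
  by rewrite permM -gE permK -g'E bijK_inv.
have [||x xE] := @overlap_onto _ _ _ (valP d) r.
- by move=> i; exists (bij_inv f' (f i)); rewrite rl.
- by move=> i; exists (bij_inv g' (g i)); rewrite rr.
have -> : s' = (s * overlap_to_n (valP d) x)%g by rewrite xE /r mulgA mulgV mul1g.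
rewrite heis_valM sp_tmap_comp.
have [sli sri _] := std_cover (valP d).
apply: eq_sp_tmap => i /=.
  rewrite -[LHS](bijK_inv f'); congr (f' _).
  by apply: sli; rewrite overlap_stdl xE rl.
rewrite -[LHS](bijK_inv g'); congr (g' _).
by apply: sri; rewrite overlap_stdr xE rr.
Qed.

(** The maps of [nu_coord_exists] assemble into the inverse. One composite is checked at a cover
    through any standardization of it, the other at the cover attached to (d, s), which [s] itself
    standardizes. *)
Lemma nu_hom_iso n :
  @is_iso (rep_category k 'S_n) (FR_ob (heis_sp P Q) n) (heis_FR n) (nu_hom n).
Proof.
pose L c := projT1 (cid (@nu_coord_exists n c)).
have LP c := projT2 (cid (@nu_coord_exists n c)).
pose M (F : rep_sp (heis_FR n)) : sp_ob (heis_sp P Q) 'I_n :=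
  [ffun c => L c F] : dsum_type (@heis_summand k P Q 'I_n).
have ME c F : @dproj k _ (@heis_summand k P Q 'I_n) c (M F) = L c F.
  by rewrite /dproj ffunE.
have Mlin : linear M.
  by move=> l u v; apply: dsumP => c; rewrite dproj_lin !ME linearP.
have linM F : linfun M F = M F by rewrite linfunE.
apply: (@rep_iso k _ _ _ (nu_hom n) (linfun M)) => x; rewrite linM.
  apply: dsumP => c; rewrite ME.
  have [d [s [f [g [fE gE]]]]] := std_exists c.
  rewrite (LP c d s f g fE gE) nu_lfunE.
  rewrite (@gprojE _ _ _ _ _ (std_perm d s) c f g (bij_inv f) (bij_inv g)).
  - by rewrite sp_tmap_comp sp_tmap_id // => i /=; rewrite bijK_inv.
  - by move=> i /=; rewrite -fE permK.
  - by move=> i /=; rewrite -gE permK.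
  - exact: bij_invK.
  - exact: bij_invK.
apply: heis_val_eq => d s; rewrite [LHS](nu_lfunE (M x) d s).
rewrite /gproj ME (LP _ d s (cov_ofl (std_perm d s)) (cov_ofr (std_perm d s))).
- by rewrite sp_tmap_comp sp_tmap_id // => i /=; rewrite bij_invK.
- by move=> i; rewrite cov_oflE /= permKV.
- by move=> i; rewrite cov_ofrE /= permKV.
Qed.

End Nu.

Section Comparison.
Variable k : fieldType.

Lemma gproj_hom (P P' Q Q' : Sp k) (f : hom P P') (g : hom Q Q')
  (A B I : finType) (a : A -> I) (b : B -> I) (H : cover2 a b)
  (w : sp_ob (heis_sp P Q) I) :
  gproj H (sp_hom (heis_sp_hom f g) I w) =
  tmap (sp_hom f A) (sp_hom g B) (gproj H w).
Proof.
rewrite /gproj -comp_lfunE -tmap_comp !sp_hom_nat tmap_comp comp_lfunE.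
by congr (fun_of_lfun _ _); apply: dproj_map.
Qed.

Definition nuR (P Q : Sp k) :
  @hom (Rcat k) (FR_ob (heis_sp P Q)) (heis_rep (FR_ob P) (FR_ob Q)) :=
  nu_hom P Q.

Lemma nuR_nat (P P' Q Q' : Sp k) (f : hom P P') (g : hom Q Q') :
  nuR P' Q' \oc FR_hom (heis_sp_hom f g) =
  heis_rep_hom (FR_hom f) (FR_hom g) \oc nuR P Q.
Proof.
apply: functional_extensionality_dep => n; apply: rep_hom_eq; apply/lfunP => w.
rewrite [LHS]comp_lfunE [RHS]comp_lfunE; apply: heis_val_eq => d s.
rewrite [LHS](nu_lfunE (sp_hom (heis_sp_hom f g) 'I_n w) d s) gproj_hom.
rewrite [RHS]heis_val_hom; congr (fun_of_lfun _ _).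
exact: (esym (nu_lfunE w d s)).
Qed.

Lemma nuR_iso (P Q : Sp k) : is_iso (nuR P Q).
Proof. by apply: Rcat_iso => n; apply: nu_hom_iso. Qed.

Lemma k_if_mapK (b c : bool) : b = c ->
  (k_if_map k c b \o k_if_map k b c)%VF = \1%VF.
Proof. by move=> ->; rewrite k_if_map_comp k_if_map_id. Qed.

(** In each degree both objects are k or 0, but by tests, [n == 0] and [#|'I_n| == 0], that agree
    without being convertible; [k_if_map] bridges them. *)
Lemma FR_one : exists e : hom (oneR k) (FR k (oneSp k)), is_iso e.
Proof.
have en n : (n == 0%N) = is_empty 'I_n by rewrite /is_empty card_ord.
have ea n (s : 'S_n) :
    (k_if_map k (n == 0%N) (is_empty 'I_n) \o rep_act (oneR k n) s)%VF =
    (rep_act (FR_ob (oneSp k) n) s \o k_if_map k (n == 0%N) (is_empty 'I_n))%VF.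
  rewrite comp_lfun1r -[rep_act (FR_ob _ _) _]/(k_if_map k _ _) k_if_map_id.
  by rewrite comp_lfun1l.
pose e n : rep_hom (oneR k n) (FR_ob (oneSp k) n) :=
  @RepHom k 'S_n (oneR k n) (FR_ob (oneSp k) n) _ (ea n).
exists e; apply: Rcat_iso => n.
apply: (@rep_iso k 'S_n (oneR k n) (FR_ob (oneSp k) n) (e n)
  (k_if_map k (is_empty 'I_n) (n == 0%N))) => x /=;
  by rewrite -comp_lfunE k_if_mapK ?id_lfunE.
Qed.

End Comparison.

(** * Additivity of R and of the Heisenberg product *)

Section Additivity.
Variable k : fieldType.

Section DirectSum.
Variables (gT : finGroupType) (I : finType) (V : I -> rep k gT).

Lemma rep_inj_act i (g : gT) :
  (linfun (@dinj k I (fun i => rep_sp (V i)) i) \o rep_act (V i) g)%VF =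
  (rep_act (rep_dsum V) g \o linfun (@dinj k I (fun i => rep_sp (V i)) i))%VF.
Proof.
apply/lfunP => x; rewrite !comp_lfunE !(linfunE (@dinj_lin _ _ _ _)).
apply: dsumP => j; rewrite dproj_map.
have [<-|ij] := eqVneq i j; first by rewrite !dproj_dinj.
by rewrite !dproj_dinj_neq // linear0.
Qed.

Lemma rep_proj_act i (g : gT) :
  (linfun (@dproj k I (fun i => rep_sp (V i)) i) \o rep_act (rep_dsum V) g)%VF =
  (rep_act (V i) g \o linfun (@dproj k I (fun i => rep_sp (V i)) i))%VF.
Proof.
apply/lfunP => x; rewrite !comp_lfunE !(linfunE (@dproj_lin _ _ _ _)).
exact: dproj_map.
Qed.

Definition rep_inj i : rep_hom (V i) (rep_dsum V) :=
  @RepHom k gT (V i) (rep_dsum V) _ (rep_inj_act i).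

Definition rep_proj i : rep_hom (rep_dsum V) (V i) :=
  @RepHom k gT (rep_dsum V) (V i) _ (rep_proj_act i).

Lemma rep_injE i x : rep_inj i x = dinj x.
Proof. exact: (linfunE (@dinj_lin _ _ _ _)). Qed.

Lemma rep_projE i x : rep_proj i x = dproj i x.
Proof. exact: (linfunE (@dproj_lin _ _ _ _)). Qed.

Lemma rep_injK i : rep_comp (rep_proj i) (rep_inj i) = rep_id (V i).
Proof.
apply: rep_hom_eq; apply/lfunP => x.
by rewrite [LHS]comp_lfunE rep_injE rep_projE dproj_dinj id_lfunE.
Qed.

Lemma rep_inj0 i j : i != j ->
  rep_comp (rep_proj j) (rep_inj i) = rep_hom_zero (V i) (V j).
Proof.
move=> ij; apply: rep_hom_eq; apply/lfunP => x.
by rewrite [LHS]comp_lfunE rep_injE rep_projE dproj_dinj_neq // [RHS]lfunE.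
Qed.

End DirectSum.

Lemma rep_dsum_bool (gT : finGroupType) (V : bool -> rep k gT) :
  rep_hom_add (rep_comp (rep_inj V true) (rep_proj V true))
    (rep_comp (rep_inj V false) (rep_proj V false)) = rep_id (rep_dsum V).
Proof.
apply: rep_hom_eq; apply/lfunP => x.
rewrite [RHS]id_lfunE [RHS]dsum_decomp big_bool [LHS]add_lfunE.
rewrite [X in X + _ = _]comp_lfunE [X in _ + X = _]comp_lfunE.
by rewrite !rep_injE !rep_projE.
Qed.

(** Biproducts are the direct sums indexed by [bool] in each degree. *)
Lemma Rcat_additive : is_additive (Rpreadditive k).
Proof.
split.
  have one1 (gT : finGroupType) (_ _ : gT) :
      \1%VF = (\1%VF \o \1%VF)%VF :> 'End('rV[k]_0) by rewrite comp_lfun1l.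
  exists (fun n => @Rep k 'S_n ('rV[k]_0 : vectType k) (fun=> \1%VF) erefl
    (@one1 _)) => X.
  split=> f; apply: functional_extensionality_dep => n; apply: rep_hom_eq;
    apply/lfunP => x /=.
    by apply/rowP => -[].
  have -> : x = 0 by apply/rowP => -[].
  by rewrite !linear0.
move=> X Y; pose V n b := if b then X n else Y n.
exists (fun n => rep_dsum (V n)), (fun n => @rep_inj _ _ (V n) true),
  (fun n => @rep_inj _ _ (V n) false), (fun n => @rep_proj _ _ (V n) true),
  (fun n => @rep_proj _ _ (V n) false).
split; apply: functional_extensionality_dep => n.
- exact: (rep_injK (V n) true).
- exact: (rep_injK (V n) false).
- exact: (@rep_inj0 _ _ (V n) false true).
- exact: (@rep_inj0 _ _ (V n) true false).
- exact: (rep_dsum_bool (V n)).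
Qed.

Lemma tmapDl (V V' W W' : vectType k) (f f' : 'Hom(V, V')) (g : 'Hom(W, W')) :
  tmap (f + f') g = tmap f g + tmap f' g.
Proof.
apply: tens_ext => v w; rewrite add_lfunE !tmap_pure add_lfunE.
by have := pureDl (g w) 1 (f v) (f' v); rewrite !scale1r.
Qed.

Lemma tmapDr (V V' W W' : vectType k) (f : 'Hom(V, V')) (g g' : 'Hom(W, W')) :
  tmap f (g + g') = tmap f g + tmap f g'.
Proof.
apply: tens_ext => v w; rewrite add_lfunE !tmap_pure add_lfunE.
by have := pureDr (f v) 1 (g w) (g' w); rewrite !scale1r.
Qed.

Lemma heis_valD (V W : Rcat k) n (F G : rep_sp (heis_rep V W n)) d s :
  heis_val (F + G) d s = heis_val F d s + heis_val G d s.
Proof. by have := heis_val_lin d s 1 F G; rewrite !scale1r. Qed.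

(** In the coordinates [heis_val] the product acts on morphisms by [tmap], which is additive in each
    argument. *)
Lemma heisR_additive : is_additive_bifunctor (Rpreadditive k) (heisR k).
Proof.
split=> V V' W W'.
  move=> f f' g; apply: functional_extensionality_dep => n; apply: rep_hom_eq.
  apply/lfunP => F; apply: heis_val_eq => d s.
  rewrite [LHS]heis_val_hom [in RHS]add_lfunE [RHS]heis_valD.
  rewrite [X in _ = X + _]heis_val_hom [X in _ = _ + X]heis_val_hom.
  by rewrite [tmap _ _]tmapDl add_lfunE.
move=> f g g'; apply: functional_extensionality_dep => n; apply: rep_hom_eq.
apply/lfunP => F; apply: heis_val_eq => d s.
rewrite [LHS]heis_val_hom [in RHS]add_lfunE [RHS]heis_valD.
rewrite [X in _ = X + _]heis_val_hom [X in _ = _ + X]heis_val_hom.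
by rewrite [tmap _ _]tmapDr add_lfunE.
Qed.

End Additivity.

Theorem theorem2p6 (k : fieldType) (k_char0 : [pchar k]%R =i pred0) :
  is_additive (Rpreadditive k) /\
  exists MR : monoidal (heisR k) (oneR k),
    is_additive_bifunctor (Rpreadditive k) (heisR k) /\
    exists MSp : monoidal (heisSp k) (oneSp k),
      is_canonical MSp /\ is_monoidal_functor (FR k) MSp MR.
Proof.
split; first exact: Rcat_additive.
have [MSp MSpP] := sp_monoidal k.
(* The structure map of the functor is the inverse of the explicit comparison [nuR]. *)
pose mu (P Q : Sp k) := projT1 (cid (nuR_iso P Q)).
have muP (P Q : Sp k) := projT2 (cid (nuR_iso P Q)).
have [eps [eta [etaK epsK]]] := FR_one k.
have [MR MRP] := @transport_monoidal (Sp k) (Rcat k) (FR k) (heisSp k) (oneSp k)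
  (heisR k) (oneR k) MSp mu (@nuR k) (fun P Q => proj1 (muP P Q))
  (fun P Q => proj2 (muP P Q)) (fun P P' Q Q' => @nuR_nat k P P' Q Q') eps eta
  epsK etaK (fun P Q => @FR_full k P Q) (@FR_esurj k).
exists MR; split; first exact: heisR_additive.
by exists MSp.
Qed.
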